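(* Let $A$ be an irreducible affine Cartan matrix not of type $A_{2n}^{(2)}$, with double affine Artin group $\mathcal A_{\tilde W}$ and double affine Hecke algebra $\mathcal H_{\tilde W}$, and let $\mathcal A_{\tilde W^\iota}$, $\mathcal H_{\tilde W^\iota}$ be the corresponding objects for the root system $R^\iota$ associated with $R$ by the involution $\iota$ (see context; objects attached to $R^\iota$ carry the superscript $\iota$). The group isomorphism $\phi_{\tilde W}:\mathcal A_{\tilde W}\to\mathcal A_{\tilde W^\iota}$ determined by $$\phi_{\tilde W}(T_j)=(T_j^\iota)^{-1}\ (1\le j\le n),\quad \phi_{\tilde W}(Y_\mu)=X^\iota_{\frac1{\sqrt p}\mu}\ (\mu\in M),\quad \phi_{\tilde W}(X_\beta)=Y^\iota_{\sqrt p\,\beta}\ (\beta\in\mathring Q),\quad \phi_{\tilde W}(X_\delta)=X^\iota_{-\delta},$$ extended $\mathbb C$-linearly and by $$\phi_{\tilde W}(t_j)=(t_j^{\iota})^{-1}\ \text{ for } 1\le j\le n,\qquad \phi_{\tilde W}(q)=q^{-1}$$ (with the corresponding roots: $t_j^{1/2}\mapsto (t_j^\iota)^{-1/2}$, $q^{1/m}\mapsto q^{-1/m}$), induces an isomorphism $\mathcal H_{\tilde W}\to\mathcal H_{\tilde W^\iota}$ between the double affine Hecke algebras. Its inverse is $\phi_{\tilde W^\iota}$ (the map defined in the same way starting from $R^\iota$, using $(R^\iota)^\iota=R$).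
   Context: Root data. $A=(a_{jk})_{0\le j,k\le n}$ is an irreducible affine Cartan matrix (enumeration of vertices as in Kac's Table Aff), not of type $A_{2n}^{(2)}$. $a_j$ are the numerical labels of the Dynkin diagram of $A$, $a_j^\vee$ those of $A^t$ (so $a_0=1$), $d_j=a_j/a_j^\vee$. $R$ is the affine root system with basis $\alpha_0,\dots,\alpha_n$, $\mathring R$ the finite root system with basis $\alpha_1,\dots,\alpha_n$, $\mathring{\mathfrak h}^*$ the real span of $\alpha_1,\dots,\alpha_n$, $\delta=\sum_j a_j\alpha_j$, and $\mathfrak h^*=\mathring{\mathfrak h}^*\oplus\mathbb R\delta\oplus\mathbb R\Lambda_0$ with symmetric bilinear form $(\alpha_j,\alpha_k)=d_j^{-1}a_{jk}$, $(\Lambda_0,\alpha_j)=\delta_{j,0}$ (Kronecker), $(\Lambda_0,\Lambda_0)=0$. $\alpha^\vee=2\alpha/(\alpha,\alpha)$ (so $\alpha_j^\vee=d_j\alpha_j$), $\theta=\delta-\alpha_0\in\mathring R$, $\mathring Q=\oplus_{j=1}^n\mathbb Z\alpha_j$, $Q=\mathring Q\oplus\mathbb Z\delta$. $s_\alpha(x)=x-(x,\alpha^\vee)\alpha$, $s_j=s_{\alpha_j}$; $W=\langle s_0,\dots,s_n\rangle$, $\mathring W=\langle s_1,\dots,s_n\rangle$. Set $e_j=\max\{1,d_j\}$ for $1\le j\le n$; this depends only on the length of $\alpha_j$, so write $e_s,e_l$ for short, long simple roots ($e_s=e_l$ if all roots have the same length), and $e_\beta$ for $\beta\in\mathring R$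 according to its length. $p:=e_s\in\{1,2,3\}$. $A_\beta=e_\beta\beta$, $A_\beta^\vee=e_\beta^{-1}\beta^\vee$, $A_j=e_j\alpha_j$, $M=\oplus_{j=1}^n\mathbb ZA_j$. $W$ is the semidirect product of $\mathring W$ and the lattice $\{\lambda_\mu:\mu\in M\}$, $w\lambda_\mu w^{-1}=\lambda_{w(\mu)}$, where $\lambda_\mu(x)=x-(x,\mu)\delta$ for $x\in\mathring{\mathfrak h}^*\oplus\mathbb R\delta$ and $\lambda_\mu(x+\Lambda_0)\equiv x+\mu+\Lambda_0 \bmod \mathbb R\delta$ for $x\in\mathring{\mathfrak h}^*$ (so $\lambda_{-\theta}=s_\theta s_0$). Artin groups. The affine Artin group $\mathcal A_W$ is generated by $T_0,\dots,T_n$ subject to the braid relations satisfied by $s_0,\dots,s_n$. For $w\in W$ with reduced expression $w=s_{j_l}\cdots s_{j_1}$, $T_w=T_{j_l}\cdots T_{j_1}$. For $\mu\in M$ the elements $Y_\mu\in\mathcal A_W$ satisfy $Y_\mu Y_\nu=Y_{\mu+\nu}$, and $Y_\mu=T_{\lambda_\mu}$ for $\mu$ anti-dominant (e.g. $Y_{-\theta}=T_{s_\theta}T_0$). $\mathcal A_W$ is also presented as generated by $T_1,\dots,T_n$ with their braid relations and the commutative group $\{Y_\mu\}_{\mu\in M}$, with relations for $1\le j\le n$: $T_jY_\mu=Y_\mu T_j$ if $(\mu,A_j^\vee)=0$; $T_jY_\mu T_j=Y_{s_j(\mu)}$ if $(\mu,A_j^\vee)=1$. The double affine Artin group $\mathcal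 A_{\tilde W}$ is generated by $\mathcal A_W$, the commutative group $\{X_\beta\}_{\beta\in\mathring Q}$ ($X_\beta X_\gamma=X_{\beta+\gamma}$) and an element $X_\delta$, with the notation $X_{\beta+k\delta}=X_\beta X_\delta^k$, subject to, for all $0\le j\le n$ and $\beta\in\mathring Q$: $X_\delta$ is central; $T_jX_\beta=X_\beta T_j$ if $(\beta,\alpha_j^\vee)=0$; $T_jX_\beta T_j=X_{s_j(\beta)}$ if $(\beta,\alpha_j^\vee)=-1$. Hecke algebra. Fix indeterminates $q$ and $t_0,\dots,t_n$ with $t_j=t_k$ iff $d_j=d_k$. Let $m$ be the lowest common denominator of the numbers $(\alpha_j,\lambda_k)$, $1\le j,k\le n$, where $\lambda_k$ are the fundamental weights of $\mathring R$ ($(\lambda_k,\alpha_j^\vee)=\delta_{jk}$), and let $\mathbb F$ be the field of rational functions over $\mathbb C$ in $q^{1/m}$ and the $t_j^{1/2}$. The double affine Hecke algebra $\mathcal H_{\tilde W}$ is the quotient of the group algebra $\mathbb F[\mathcal A_{\tilde W}]$ by the relations, for all $1\le j\le n$, $$T_j-T_j^{-1}=t_j^{1/2}-t_j^{-1/2},\quad Y_{-A_j}T_j^{-1}-T_jY_{A_j}=t_j^{1/2}-t_j^{-1/2},\quad T_j^{-1}X_{\alpha_j}-X_{-\alpha_j}T_j=t_j^{1/2}-t_j^{-1/2},$$ together with $T_0^{-1}X_{\alpha_0}-X_{-\alpha_0}T_0=t_0^{1/2}-t_0^{-1/2}$ and $X_\delta=q^{-1}$. $\mathcal H_{\tilde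 W^\iota}$ is defined likewise from $R^\iota$, with parameters $q$ and $t_j^\iota$. The involution $\iota$. $R^\iota$ is the affine root system realized in $\mathfrak h^*$, with the same scalar product, $\delta^\iota=\delta$, $\Lambda_0^\iota=\Lambda_0$, whose finite part $\mathring R^\iota$ has basis $\alpha_j^\iota=A_j/\sqrt p$ ($1\le j\le n$) and which has the same affine type (untwisted/twisted) as $R$: if $p=1$ then $R^\iota=R$, $\alpha_0^\iota=\alpha_0$; if $p\ne1$ (types $B_n^{(1)},C_n^{(1)},F_4^{(1)},G_2^{(1)}$) then $R^\iota$ is the untwisted affine root system of $\mathring R^\iota$, $\alpha_0^\iota=\delta-\theta^\iota$ with $\theta^\iota$ the highest root of $\mathring R^\iota$. One has $M^\iota=\sqrt p\,\mathring Q$ and $\mathring Q^\iota=\frac1{\sqrt p}M$, and $(R^\iota)^\iota=R$, $p^\iota=p$. The displayed formulas for $\phi_{\tilde W}$ on generators do determine a group isomorphism $\mathcal A_{\tilde W}\to\mathcal A_{\tilde W^\iota}$ with inverse $\phi_{\tilde W^\iota}$. *)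

(* Defs.v *)
From HB Require Import structures.
From mathcomp Require Import all_boot all_order all_algebra.
From mathcomp Require Import boolp reals complex fraction ring_quotient.
From mathcomp Require Import finmap monalg.
From mathcomp Require Import(canonicals) mpoly.
Set Implicit Arguments.
Unset Strict Implicit.
Unset Printing Implicit Defensive.
Import Order.TTheory GRing.Theory Num.Theory.
Local Open Scope ring_scope.
Local Open Scope quotient_scope.

(* The group generated by X subject to the relations u = v for rel u v.       *)
(* Words are sequences of letters; (x, true) is x and (x, false) is x^-1.     *)

Definition word (X : Type) := seq (X * bool).
HB.instance Definition _ X := gen_eqMixin (word X).
HB.instance Definition _ X := gen_choiceMixin (word X).

Section PresentedGroup.
Variables (X : Type) (rel : word X -> word X -> Prop).
Implicit Types u v w : word X.

Inductive word_cong : word X -> word X -> Prop :=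
| Cong_refl u : word_cong u u
| Cong_sym u v : word_cong u v -> word_cong v u
| Cong_trans u v w : word_cong u v -> word_cong v w -> word_cong u w
| Cong_cat u u' v v' :
    word_cong u u' -> word_cong v v' -> word_cong (u ++ v) (u' ++ v')
| Cong_inv x b : word_cong [:: (x, b); (x, ~~ b)] [::]
| Cong_rel u v : rel u v -> word_cong u v.

Definition winv u : word X := rev [seq (x.1, ~~ x.2) | x <- u].

Lemma winv_cat u v : winv (u ++ v) = winv v ++ winv u.
Proof. by rewrite /winv map_cat rev_cat. Qed.

Lemma winvK : involutive winv.
Proof.
move=> u; rewrite /winv map_rev revK -map_comp -[RHS]map_id.
by apply: eq_map => -[x b] /=; rewrite negbK.
Qed.

Lemma cong_winv u : word_cong (u ++ winv u) [::].
Proof.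
elim: u => [|[x b] u IH]; first exact: Cong_refl.
rewrite -cat1s winv_cat -catA (catA u).
apply: (@Cong_trans _ ([:: (x, b)] ++ ([::] ++ winv [:: (x, b)]))).
  apply: Cong_cat; first exact: Cong_refl.
  by apply: Cong_cat; [exact: IH | exact: Cong_refl].
exact: Cong_inv.
Qed.

Lemma winv_cong u v : word_cong u v -> word_cong (winv u) (winv v).
Proof.
move=> uv; apply: (@Cong_trans _ (winv u ++ (v ++ winv v))).
  rewrite -{1}[winv u]cats0; apply: Cong_cat; first exact: Cong_refl.
  exact/Cong_sym/cong_winv.
rewrite catA -[X in word_cong _ X]cat0s.
apply: Cong_cat; last exact: Cong_refl.
apply: (@Cong_trans _ (winv u ++ u)).
  by apply: Cong_cat; [exact: Cong_refl | exact: Cong_sym].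
by rewrite -{2}[u]winvK; exact: cong_winv.
Qed.

Definition wequiv u v : bool := `[< word_cong u v >].

Lemma wequiv_is_equiv : equiv_class_of wequiv.
Proof.
split=> [u|u v|v u w].
- exact/asboolP/Cong_refl.
- by apply/asboolP/asboolP => /Cong_sym.
- by move=> /asboolP uv /asboolP vw; apply/asboolP/(Cong_trans uv vw).
Qed.

Canonical wequiv_equiv := EquivRelPack wequiv_is_equiv.
Canonical wequiv_encModRel := defaultEncModRel wequiv.

Definition presented := {eq_quot wequiv}.
HB.instance Definition _ := EqQuotient.on presented.
HB.instance Definition _ := Choice.on presented.

Definition word_class u : presented := \pi_presented u.

Lemma word_classP u v : reflect (word_cong u v) (word_class u == word_class v).
Proof. by rewrite /word_class piE; exact: asboolP. Qed.

Lemma repr_classK u : word_cong (repr (word_class u)) u.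
Proof. by apply/word_classP; rewrite /word_class reprK. Qed.

Definition pone : presented := word_class [::].
Definition pmul (g h : presented) : presented := word_class (repr g ++ repr h).
Definition pinv (g : presented) : presented := word_class (winv (repr g)).

Lemma pmulE u v : pmul (word_class u) (word_class v) = word_class (u ++ v).
Proof. by apply/eqP/word_classP/Cong_cat; exact: repr_classK. Qed.

Lemma pinvE u : pinv (word_class u) = word_class (winv u).
Proof. by apply/eqP/word_classP/winv_cong; exact: repr_classK. Qed.

Lemma classW (P : presented -> Prop) :
  (forall u, P (word_class u)) -> forall g, P g.
Proof. by move=> H g; rewrite -[g]reprK; exact: H. Qed.

Lemma pmulA : associative pmul.
Proof.
by elim/classW=> u; elim/classW=> v; elim/classW=> w; rewrite !pmulE catA.
Qed.
Lemma pmul1 : left_id pone pmul.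
Proof. by elim/classW=> u; rewrite pmulE. Qed.
Lemma pmulr1 : right_id pone pmul.
Proof. by elim/classW=> u; rewrite pmulE cats0. Qed.
Lemma pmulV : right_inverse pone pinv pmul.
Proof.
elim/classW=> u; rewrite pinvE pmulE.
exact/eqP/word_classP/cong_winv.
Qed.
Lemma pmulVl : left_inverse pone pinv pmul.
Proof.
elim/classW=> u; rewrite pinvE pmulE -{2}[u]winvK.
exact/eqP/word_classP/cong_winv.
Qed.

HB.instance Definition _ :=
  isGroup.Build presented pmulA pmul1 pmulr1 pmulVl pmulV.

End PresentedGroup.

Section GroupAlgebra.
Variables (F : fieldType) (G : groupType).

Definition group_algebra := {malg F[G]}.
HB.instance Definition _ := GRing.Lmodule.on group_algebra.
Implicit Types (a b c : group_algebra) (g h : G) (x y : F).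

Local Notation U g x := (mkmalgU g x : group_algebra).

Definition ga_mul a b : group_algebra :=
  \sum_(g <- msupp a) \sum_(h <- msupp b) U (g * h)%g (a@_g * b@_h).

Lemma ga_mulw (d1 d2 : {fset G}) a b :
    fsubset (msupp a) d1 -> fsubset (msupp b) d2 ->
  ga_mul a b = \sum_(g <- d1) \sum_(h <- d2) U (g * h)%g (a@_g * b@_h).
Proof.
move=> le1 le2; rewrite /ga_mul (big_fset_incl _ le1) /=.
  apply/eq_bigr=> g _; apply/big_fset_incl => // h _ /mcoeff_outdom ->.
  by rewrite mulr0 monalgU0.
move=> g _ /mcoeff_outdom ag.
by rewrite big1 // => h _; rewrite ag mul0r monalgU0.
Qed.

Lemma ga_mulUU g h x y : ga_mul (U g x) (U h y) = U (g * h)%g (x * y).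
Proof. by rewrite (ga_mulw msuppU_le msuppU_le) !big_seq_fset1 !mcoeffUU. Qed.

Lemma ga_mulDl : left_distributive ga_mul +%R.
Proof.
move=> a b c; have sc := fsubset_refl (msupp c).
have sa := fsubsetUl (msupp a) (msupp b).
have sb := fsubsetUr (msupp a) (msupp b).
rewrite (ga_mulw (msuppD_le a b) sc) (ga_mulw sa sc) (ga_mulw sb sc).
rewrite -big_split /=; apply/eq_bigr=> g _.
rewrite -big_split /=; apply/eq_bigr=> h _.
by rewrite mcoeffD mulrDl monalgUD.
Qed.

Lemma ga_mulDr : right_distributive ga_mul +%R.
Proof.
move=> c a b; have sc := fsubset_refl (msupp c).
have sa := fsubsetUl (msupp a) (msupp b).
have sb := fsubsetUr (msupp a) (msupp b).
rewrite (ga_mulw sc (msuppD_le a b)) (ga_mulw sc sa) (ga_mulw sc sb).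
rewrite -big_split /=; apply/eq_bigr=> g _.
rewrite -big_split /=; apply/eq_bigr=> h _.
by rewrite mcoeffD mulrDr monalgUD.
Qed.

Lemma ga_ind (P : group_algebra -> Prop) :
    P 0 -> (forall a b, P a -> P b -> P (a + b)) -> (forall g x, P (U g x)) ->
  forall a, P a.
Proof. by move=> P0 PD PU a; rewrite [a]monalgE; elim/big_ind: _. Qed.

Lemma ga_mul0l b : ga_mul 0 b = 0.
Proof. by apply: (addIr (ga_mul 0 b)); rewrite -ga_mulDl !add0r. Qed.

Lemma ga_mul0r a : ga_mul a 0 = 0.
Proof. by apply: (addIr (ga_mul a 0)); rewrite -ga_mulDr !add0r. Qed.

Lemma ga_mulA : associative ga_mul.
Proof.
move=> a b c; elim/ga_ind: a => [|a1 a2 I1 I2|g x].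
- by rewrite !ga_mul0l.
- by rewrite !ga_mulDl I1 I2.
elim/ga_ind: b => [|b1 b2 I1 I2|h y].
- by rewrite !(ga_mul0r, ga_mul0l).
- by rewrite !(ga_mulDr, ga_mulDl) I1 I2.
elim/ga_ind: c => [|c1 c2 I1 I2|k z].
- by rewrite !ga_mul0r.
- by rewrite !ga_mulDr I1 I2.
by rewrite !ga_mulUU mulgA mulrA.
Qed.

Lemma ga_mul1l : left_id (U 1%g 1) ga_mul.
Proof.
move=> c; elim/ga_ind: c => [|a b I1 I2|g x]; first exact: ga_mul0r.
- by rewrite ga_mulDr I1 I2.
- by rewrite ga_mulUU mul1g mul1r.
Qed.

Lemma ga_mul1r : right_id (U 1%g 1) ga_mul.
Proof.
move=> c; elim/ga_ind: c => [|a b I1 I2|g x]; first exact: ga_mul0l.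
- by rewrite ga_mulDl I1 I2.
- by rewrite ga_mulUU mulg1 mulr1.
Qed.

Lemma ga_oner_neq0 : U 1%g 1 != 0.
Proof. by rewrite monalgU_eq0 oner_neq0. Qed.

HB.instance Definition _ := GRing.Zmodule_isNzRing.Build group_algebra
  ga_mulA ga_mul1l ga_mul1r ga_mulDl ga_mulDr ga_oner_neq0.

Lemma ga_mulE g h x y : U g x * U h y = U (g * h)%g (x * y).
Proof. exact: ga_mulUU. Qed.

Lemma ga_scaleU x g y : x *: U g y = U g (x * y).
Proof. by apply/malgP=> h; rewrite mcoeffZ !mcoeffU mulrnAr. Qed.

Lemma ga_scaleAl x a b : x *: (a * b) = (x *: a) * b.
Proof.
elim/ga_ind: a => [|a1 a2 I1 I2|g y]; first by rewrite !(mul0r, scaler0).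
  by rewrite !(mulrDl, scalerDr) I1 I2.
elim/ga_ind: b => [|b1 b2 I1 I2|h z]; first by rewrite !(mulr0, scaler0).
  by rewrite !(mulrDr, scalerDr) I1 I2.
by rewrite !(ga_scaleU, ga_mulE) mulrA.
Qed.

Lemma ga_scaleAr x a b : x *: (a * b) = a * (x *: b).
Proof.
elim/ga_ind: a => [|a1 a2 I1 I2|g y]; first by rewrite !(mul0r, scaler0).
  by rewrite !(mulrDl, scalerDr) I1 I2.
elim/ga_ind: b => [|b1 b2 I1 I2|h z]; first by rewrite !(mulr0, scaler0).
  by rewrite !(mulrDr, scalerDr) I1 I2.
by rewrite !(ga_scaleU, ga_mulE) mulrCA.
Qed.

HB.instance Definition _ :=
  GRing.Lmodule_isLalgebra.Build F group_algebra ga_scaleAl.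
HB.instance Definition _ :=
  GRing.Lalgebra_isAlgebra.Build F group_algebra ga_scaleAr.

Definition ga_elt g : group_algebra := U g 1.

End GroupAlgebra.

(* The quotient of an algebra by the two-sided ideal generated by S. It is    *)
(* only declared as a pzRingType and an lmodType: lalgType would require      *)
(* 1 != 0 in the quotient.                                                    *)

Section AlgebraQuotient.
Variables (F : fieldType) (A : algType F) (S : A -> Prop).

Inductive two_sided_ideal : A -> Prop :=
| Ideal0 : two_sided_ideal 0
| IdealD a s b x :
    S s -> two_sided_ideal x -> two_sided_ideal (a * s * b + x).

Definition ideal_pred : {pred A} := fun x => `[< two_sided_ideal x >].

Lemma ideal_predD x y :
  two_sided_ideal x -> two_sided_ideal y -> two_sided_ideal (x + y).
Proof.
move=> Ix Iy; elim: Ix => [|a s b z Ss _ IH]; first by rewrite add0r.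
by rewrite -addrA; exact: IdealD.
Qed.

Lemma ideal_predM c x d : two_sided_ideal x -> two_sided_ideal (c * x * d).
Proof.
elim=> [|a s b z Ss _ IH]; first by rewrite mulr0 mul0r; exact: Ideal0.
have -> : c * (a * s * b + z) * d = (c * a) * s * (b * d) + c * z * d.
  by rewrite mulrDr mulrDl !mulrA.
exact: IdealD.
Qed.

Lemma ideal_pred_zmod : zmod_closed ideal_pred.
Proof.
split=> [|x y /asboolP Ix /asboolP Iy]; apply/asboolP; first exact: Ideal0.
apply: ideal_predD => //; rewrite -mulN1r -[_ * y]mulr1.
exact: ideal_predM.
Qed.

HB.instance Definition _ := GRing.isZmodClosed.Build A ideal_pred ideal_pred_zmod.

Definition alg_quot := Quotient.quot ideal_pred.
HB.instance Definition _ := GRing.Zmodule.on alg_quot.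

Definition alg_class (x : A) : alg_quot := \pi_alg_quot x.

Lemma alg_classP x y : reflect (two_sided_ideal (x - y))
  (alg_class x == alg_class y).
Proof. by rewrite /alg_class piE; exact: asboolP. Qed.

Lemma alg_classD x y : alg_class (x + y) = alg_class x + alg_class y.
Proof. by rewrite /alg_class piE. Qed.

Lemma repr_alg_class x : two_sided_ideal (repr (alg_class x) - x).
Proof. by apply/alg_classP; rewrite /alg_class reprK. Qed.

Lemma alg_classW (P : alg_quot -> Prop) :
  (forall x, P (alg_class x)) -> forall u, P u.
Proof. by move=> H u; rewrite -[u]reprK; exact: H. Qed.

Definition aq_mul (u v : alg_quot) := alg_class (repr u * repr v).
Definition aq_scale (c : F) (u : alg_quot) := alg_class (c *: repr u).

Lemma aq_mulE x y : aq_mul (alg_class x) (alg_class y) = alg_class (x * y).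
Proof.
apply/eqP/alg_classP; set x' := repr _; set y' := repr _.
have -> : x' * y' - x * y = 1 * (x' - x) * y' + x * (y' - y) * 1.
  by rewrite mul1r mulr1 mulrBl mulrBr addrA subrK.
by apply: ideal_predD; apply: ideal_predM; exact: repr_alg_class.
Qed.

Lemma aq_scaleE c x : aq_scale c (alg_class x) = alg_class (c *: x).
Proof.
apply/eqP/alg_classP; rewrite -scalerBr -[_ - x]mul1r scalerAl.
by rewrite -[X in two_sided_ideal X]mulr1; exact/ideal_predM/repr_alg_class.
Qed.

Lemma aq_mulA : associative aq_mul.
Proof.
elim/alg_classW=> x; elim/alg_classW=> y; elim/alg_classW=> z.
by rewrite !aq_mulE mulrA.
Qed.
Lemma aq_mul1 : left_id (alg_class 1) aq_mul.
Proof. by elim/alg_classW=> x; rewrite aq_mulE mul1r. Qed.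
Lemma aq_mulr1 : right_id (alg_class 1) aq_mul.
Proof. by elim/alg_classW=> x; rewrite aq_mulE mulr1. Qed.
Lemma aq_mulDl : left_distributive aq_mul +%R.
Proof.
elim/alg_classW=> x; elim/alg_classW=> y; elim/alg_classW=> z.
by rewrite -alg_classD !aq_mulE -alg_classD mulrDl.
Qed.
Lemma aq_mulDr : right_distributive aq_mul +%R.
Proof.
elim/alg_classW=> x; elim/alg_classW=> y; elim/alg_classW=> z.
by rewrite -alg_classD !aq_mulE -alg_classD mulrDr.
Qed.

HB.instance Definition _ := GRing.Zmodule_isPzRing.Build alg_quot
  aq_mulA aq_mul1 aq_mulr1 aq_mulDl aq_mulDr.

Lemma aq_scaleA c d v : aq_scale c (aq_scale d v) = aq_scale (c * d) v.
Proof. by elim/alg_classW: v => x; rewrite !aq_scaleE scalerA. Qed.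
Lemma aq_scale1 : left_id 1 aq_scale.
Proof. by elim/alg_classW=> x; rewrite aq_scaleE scale1r. Qed.
Lemma aq_scaleDr : right_distributive aq_scale +%R.
Proof.
move=> c; elim/alg_classW=> x; elim/alg_classW=> y.
by rewrite -alg_classD !aq_scaleE -alg_classD scalerDr.
Qed.
Lemma aq_scaleDl v : {morph aq_scale^~ v : c d / c + d}.
Proof.
by elim/alg_classW: v => x c d; rewrite !aq_scaleE -alg_classD scalerDl.
Qed.

HB.instance Definition _ := GRing.Zmodule_isLmodule.Build F alg_quot
  aq_scaleA aq_scale1 aq_scaleDr aq_scaleDl.

End AlgebraQuotient.

(* The rank is n.+1: the vertices of the affine diagram are 'I_n.+2, vertex 0 *)
(* is ord0, and the vertices of the finite diagram are the lift ord0 j for    *)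
(* j : 'I_n.+1.                                                               *)

Section CartanMatrices.
Variable n : nat.
Implicit Type A : 'M[int]_n.+2.

Definition generalized_cartan A : Prop :=
  [/\ forall j, A j j = 2,
      forall j k, j != k -> A j k <= 0
    & forall j k, A j k = 0 -> A k j = 0].

Definition indecomposable A : Prop :=
  forall S : {set 'I_n.+2}, S != set0 -> S != setT ->
  exists j k, [/\ j \in S, k \notin S & A j k != 0].

Definition irreducible_affine_cartan A : Prop :=
  [/\ generalized_cartan A, indecomposable A
    & exists u : 'I_n.+2 -> rat, (forall j, 0 < u j) /\
      forall j, \sum_k (A j k)%:~R * u k = 0].

Definition numerical_labels A (a : 'I_n.+2 -> nat) : Prop :=
  [/\ forall j, (0 < a j)%N,
      forall j, \sum_k A j k * (a k)%:Z = 0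
    & \big[gcdn/0%N]_j a j = 1%N].

End CartanMatrices.

(* The tables Aff 1, Aff 2, Aff 3 of Kac, "Infinite dimensional Lie algebras".*)
(* X_m^(r) is the type Xr m (with A_{2m-1}^(2), A_{2m}^(2), D_{m+1}^(2)       *)
(* written Aff_A2odd m, Aff_A2even m, Aff_D2 m); the table entry for          *)
(* Aff_A2odd 2 etc. is excluded by kac_admissible.                            *)

Inductive affine_type :=
| Aff_A of nat | Aff_B of nat | Aff_C of nat | Aff_D of nat
| Aff_E6 | Aff_E7 | Aff_E8 | Aff_F4 | Aff_G2
| Aff_A2even of nat | Aff_A2odd of nat | Aff_D2 of nat | Aff_E6_2 | Aff_D4_3.

Definition kac_rank (X : affine_type) : nat :=
  match X with
  | Aff_A l | Aff_B l | Aff_C l | Aff_D l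
  | Aff_A2even l | Aff_A2odd l | Aff_D2 l => l
  | Aff_E6 => 6 | Aff_E7 => 7 | Aff_E8 => 8
  | Aff_F4 | Aff_E6_2 => 4
  | Aff_G2 | Aff_D4_3 => 2
  end.

Definition kac_admissible (X : affine_type) : bool :=
  match X with
  | Aff_A l | Aff_A2even l => (1 <= l)%N
  | Aff_C l | Aff_D2 l => (2 <= l)%N
  | Aff_B l | Aff_A2odd l => (3 <= l)%N
  | Aff_D l => (4 <= l)%N
  | _ => true
  end.

(* Edges {j, k} of the diagram, given for j < k. *)
Definition kac_edge (X : affine_type) (j k : nat) : bool :=
  let succ := k == j.+1 in
  match X with
  | Aff_A l => succ || [&& j == 0%N & k == l]
  | Aff_B l | Aff_A2odd l => [&& (0 < j)%N & succ] || [&& j == 0%N & k == 2%N]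
  | Aff_D l => [&& (0 < j)%N, (k < l)%N & succ] || [&& j == 0%N & k == 2%N]
               || [&& j == (l - 2)%N & k == l]
  | Aff_E6 => [&& (0 < j)%N, (k < 6)%N & succ]
              || ((j, k) \in [:: (3, 6); (0, 6)]%N)
  | Aff_E7 => [&& (k < 7)%N & succ] || ((j, k) == (3, 7)%N)
  | Aff_E8 => [&& (k < 8)%N & succ] || ((j, k) == (5, 8)%N)
  | _ => succ
  end.

(* -a_jk for adjacent vertices j and k. When it is larger than 1, the arrow   *)
(* of the diagram points to j.                                                *)
Definition kac_mult (X : affine_type) (j k : nat) : nat :=
  let at_ (jk : nat * nat) m := if (j, k) == jk then m else 1%N in
  match X with
  | Aff_A l => if l == 1%N then 2%N else 1%N
  | Aff_B l => at_ (l, l.-1) 2%N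
  | Aff_C l => if (j, k) == (1, 0)%N then 2%N else at_ (l.-1, l) 2%N
  | Aff_F4 => at_ (3, 2)%N 2%N
  | Aff_G2 => at_ (2, 1)%N 3%N
  | Aff_A2even l => if l == 1%N then at_ (0, 1)%N 4%N
                    else if (j, k) == (0, 1)%N then 2%N else at_ (l.-1, l) 2%N
  | Aff_A2odd l => at_ (l.-1, l) 2%N
  | Aff_D2 l => if (j, k) == (0, 1)%N then 2%N else at_ (l, l.-1) 2%N
  | Aff_E6_2 => at_ (2, 3)%N 2%N
  | Aff_D4_3 => at_ (1, 2)%N 3%N
  | _ => 1%N
  end.

Definition kac_entry (X : affine_type) (j k : nat) : int :=
  if j == k then 2
  else if kac_edge X (minn j k) (maxn j k) then - (kac_mult X j k)%:Z else 0.

Definition kac_enumerated n (A : 'M[int]_n.+2) (X : affine_type) : Prop :=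
  [/\ kac_admissible X, kac_rank X = n.+1
    & forall j k : 'I_n.+2, A j k = kac_entry X j k].

Definition is_A2even (X : affine_type) : bool :=
  if X is Aff_A2even _ then true else false.

(* Coordinates in h^* with respect to the basis alpha_0, ..., alpha_n,        *)
(* Lambda_0; this is the same space as that spanned by alpha_1, ..., alpha_n, *)
(* delta, Lambda_0, because a_0 != 0.                                         *)

Section Realization.
Variables (R : realType) (n : nat).

Definition hdual := 'rV[R]_(n.+2 + 1).

Record affine_data := AffineData {
  form : hdual -> hdual -> R;
  delta : hdual;
  Lambda0 : hdual;
  simple : 'I_n.+2 -> hdual
}.

Section FromCartan.
Variables (A : 'M[int]_n.+2) (a av : 'I_n.+2 -> nat).

Definition cartan_d j : R := (a j)%:R / (av j)%:R.

Definition gram : 'M[R]_(n.+2 + 1) :=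
  block_mx (\matrix_(j, k) ((cartan_d j)^-1 * (A j k)%:~R))
           (\col_j (j == ord0)%:R) (\row_j (j == ord0)%:R) 0.

Definition cartan_data : affine_data := AffineData
  (fun x y => (x *m gram *m y^T) 0 0)
  (\sum_j (a j)%:R *: delta_mx 0 (lshift 1 j))
  (delta_mx 0 (rshift n.+2 0))
  (fun j => delta_mx 0 (lshift 1 j)).

Lemma cartan_data_form j k :
  form cartan_data (simple cartan_data j) (simple cartan_data k)
  = (cartan_d j)^-1 * (A j k)%:~R.
Proof.
rewrite /= -rowE trmx_delta -colE !mxE.
by rewrite (unsplitK (inl j)) mxE (unsplitK (inl k)) mxE.
Qed.

Lemma cartan_data_formL0 j :
  form cartan_data (Lambda0 cartan_data) (simple cartan_data j)
  = (j == ord0)%:R.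
Proof.
rewrite /= -rowE trmx_delta -colE !mxE.
by rewrite (unsplitK (inr ord0)) mxE (unsplitK (inl j)) mxE.
Qed.

End FromCartan.

Variable D : affine_data.
Local Notation "'( x , y )" := (form D x y) (format "''(' x ,  y )").
Local Notation alpha := (simple D).
Implicit Types (x y beta mu : hdual) (j k : 'I_n.+2) (i : 'I_n.+1).

Definition fin i : 'I_n.+2 := lift ord0 i.

Definition coroot x : hdual := (2 / '(x, x)) *: x.
Definition reflection beta x : hdual := x - '(x, coroot beta) *: beta.
Definition s_ j := reflection (alpha j).

(* See d_cartan_data below for d_j = a_j / a_j^vee. The data attached to R^iota are normalized in the same way (long  *)
(* roots of an untwisted R^iota have square length 2).                        *)
Definition d_ j : R := 2 / '(alpha j, alpha j).

Definition e_ i : R := Num.max 1 (d_ (fin i)).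
Definition A_ i : hdual := e_ i *: alpha (fin i).

(* e_s: the value of e at a simple root of the finite root system that has    *)
(* minimal length.                                                            *)
Definition p_ : R :=
  e_ [arg min_(i < ord0) '(alpha (fin i), alpha (fin i))]%O.

Definition in_Qo x : bool :=
  `[< exists c : 'I_n.+1 -> int, x = \sum_i alpha (fin i) *~ c i >].
Definition in_M x : bool :=
  `[< exists c : 'I_n.+1 -> int, x = \sum_i A_ i *~ c i >].
Definition in_fin x : Prop :=
  exists c : 'I_n.+1 -> R, x = \sum_i c i *: alpha (fin i).

Definition act (u : seq 'I_n.+2) x : hdual := foldr s_ x u.

Definition reduced (u : seq 'I_n.+2) : Prop :=
  forall v, act v =1 act u -> (size u <= size v)%N.

(* The word u represents the translation lambda_mu. *)
Definition represents_translation (u : seq 'I_n.+2) mu : Prop :=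
  (forall x r, in_fin x ->
     act u (x + r *: delta D) =
       x + r *: delta D - '(x + r *: delta D, mu) *: delta D)
  /\ (forall x, in_fin x -> exists r,
     act u (x + Lambda0 D) = x + mu + Lambda0 D + r *: delta D).

Definition antidominant mu : Prop :=
  forall i, '(mu, coroot (alpha (fin i))) <= 0.

Definition order_ss j k (m : nat) : Prop :=
  [/\ (0 < m)%N, forall x, iter m (s_ j \o s_ k) x = x
    & forall m', (0 < m' < m)%N -> ~ (forall x, iter m' (s_ j \o s_ k) x = x)].

End Realization.

Lemma d_cartan_data (R : realType) n (A : 'M[int]_n.+2) a av j :
  A j j = 2 -> d_ (cartan_data R A a av) j = cartan_d R a av j.
Proof.
move=> Ajj; rewrite /d_ cartan_data_form Ajj invfM invrK mulrCA divff ?mulr1 //.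
by rewrite pnatr_eq0.
Qed.

Section Iota.
Variables (R : realType) (n : nat) (D : affine_data R n).

Definition fin_root (b : 'I_n.+1 -> hdual R n) (x : hdual R n) : Prop :=
  exists (u : seq 'I_n.+1) i,
    x = foldr (fun k => reflection D (b k)) (b i) u.

Definition highest_root (b : 'I_n.+1 -> hdual R n) (x : hdual R n) : Prop :=
  fin_root b x /\ forall y, fin_root b y ->
    exists c : 'I_n.+1 -> nat, x - y = \sum_i b i *+ c i.

Definition iota_fin_simple i : hdual R n := (Num.sqrt (p_ D))^-1 *: A_ D i.

Definition iota_theta : hdual R n :=
  if pselect (exists x, highest_root iota_fin_simple x) is left h
  then projT1 (cid h) else 0.

Definition iota_data : affine_data R n := AffineData
  (form D) (delta D) (Lambda0 D)
  (fun j => if unlift ord0 j is Some i then iota_fin_simple i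
            else if p_ D == 1 then simple D ord0
            else delta D - iota_theta).

End Iota.

Section Artin.
Variables (R : realType) (n : nat) (D : affine_data R n).
Local Notation V := (hdual R n).

Inductive artin_gen :=
| GenT of 'I_n.+2
| GenX of {x : V | in_Qo D x}
| GenDelta.

Local Notation W := (word artin_gen).

Definition wT j : W := [:: (GenT j, true)].
Definition wdelta (k : int) : W := nseq `|k|%N (GenDelta, 0 <= k).

(* X_{beta + k delta} = X_beta X_delta^k for beta in the finite root lattice; *)
(* junk value off the lattice Q.                                              *)
Definition wX (x : V) : W :=
  if pselect (exists bk : {x : V | in_Qo D x} * int,
                x = val bk.1 + delta D *~ bk.2) is left h
  then let bk := projT1 (cid h) in (GenX bk.1, true) :: wdelta bk.2
  else [::].

Fixpoint walt (m : nat) j k : W :=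
  if m is m'.+1 then wT j ++ walt m' k j else [::].

Inductive artin_rel : W -> W -> Prop :=
| Rel_braid j k m : j != k -> order_ss D j k m ->
    artin_rel (walt m j k) (walt m k j)
| Rel_XX x y : in_Qo D x -> in_Qo D y ->
    artin_rel (wX x ++ wX y) (wX (x + y))
| Rel_delta g :
    artin_rel (wdelta 1 ++ [:: (g, true)]) ([:: (g, true)] ++ wdelta 1)
| Rel_TX0 j x : in_Qo D x -> form D x (coroot D (simple D j)) = 0 ->
    artin_rel (wT j ++ wX x) (wX x ++ wT j)
| Rel_TX1 j x : in_Qo D x -> form D x (coroot D (simple D j)) = -1 ->
    artin_rel (wT j ++ wX x ++ wT j) (wX (s_ D j x)).

Definition daag := presented artin_rel.
HB.instance Definition _ := Group.on daag.

Definition T_ j : daag := word_class artin_rel (wT j).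
Definition X_ x : daag := word_class artin_rel (wX x).

Definition Tword (u : seq 'I_n.+2) : daag := (\prod_(j <- u) T_ j)%g.

(* These properties determine Y_mu for mu in M, since the anti-dominant       *)
(* elements of M generate M; the values of Y off M are irrelevant.            *)
Definition translation_elements (Y : V -> daag) : Prop :=
  (forall mu nu, in_M D mu -> in_M D nu -> (Y mu * Y nu)%g = Y (mu + nu)) /\
  (forall mu u, in_M D mu -> antidominant D mu ->
     represents_translation D u mu -> reduced D u -> Y mu = Tword u).

End Artin.

Section Hecke.
Variables (R : realType) (n : nat) (D : affine_data R n).
Local Notation V := (hdual R n).

(* lambda_k = \sum_i (B^-1)_ki alpha_i, where B_ij = (alpha_i, alpha_j^vee).  *)
Definition fundamental_weight (k : 'I_n.+1) : V :=
  let B : 'M[R]_n.+1 := \matrix_(i, j)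
    form D (simple D (fin i)) (coroot D (simple D (fin j))) in
  \sum_i (invmx B) k i *: simple D (fin i).

Definition common_denominator (m : nat) : Prop :=
  (0 < m)%N /\ forall j k : 'I_n.+1,
    m%:R * form D (simple D (fin j)) (fundamental_weight k) \is a Num.int.

Definition lcd_spec (m : nat) : Prop :=
  common_denominator m /\ forall m', common_denominator m' -> (m <= m')%N.

Definition m_ : nat :=
  if pselect (exists m, lcd_spec m) is left h then projT1 (cid h) else 1%N.

(* One indeterminate for q^(1/m), and one for each of the distinct values of  *)
(* the d_j.                                                                   *)
Definition d_values : seq R := undup [seq d_ D j | j <- enum 'I_n.+2].

Definition scalars : fieldType :=
  {fraction (mpoly.mpoly (size d_values).+1 R[i])}.

Definition scalar_const (c : R[i]) : scalars :=
  tofrac (mpoly.mpolyC (size d_values).+1 c).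
Definition indet (k : nat) : scalars :=
  tofrac (mpoly.mpolyX R[i] (mpoly.mnm1 (inord k : 'I_(size d_values).+1))).

Definition q_root : scalars := indet 0.
Definition q_ : scalars := q_root ^+ m_.
Definition t_root (j : 'I_n.+2) : scalars := indet (index (d_ D j) d_values).+1.
Definition t_ j : scalars := t_root j ^+ 2.

Variable Y : V -> daag D.

Local Notation GA := (group_algebra scalars (daag D)).
Local Notation "[ g ]" := (ga_elt scalars (g : daag D)) (format "[ g ]").
Local Notation rhs j := ((t_root j - (t_root j)^-1)%:A : GA).

Inductive hecke_rel : GA -> Prop :=
| Hecke_T i : hecke_rel ([T_ D (fin i)] - [(T_ D (fin i))^-1%g] - rhs (fin i))
| Hecke_Y i : hecke_rel ([(Y (- A_ D i) * (T_ D (fin i))^-1)%g]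
    - [(T_ D (fin i) * Y (A_ D i))%g] - rhs (fin i))
| Hecke_X j : hecke_rel ([((T_ D j)^-1 * X_ D (simple D j))%g]
    - [(X_ D (- simple D j) * T_ D j)%g] - rhs j)
| Hecke_q : hecke_rel ([X_ D (delta D)] - (q_^-1)%:A).

Definition daha := alg_quot hecke_rel.
HB.instance Definition _ := GRing.PzRing.on daha.
HB.instance Definition _ := GRing.Lmodule.on daha.

Definition hecke_elt (g : daag D) : daha := alg_class hecke_rel [g].

End Hecke.

(* Used for (D, D') the data of (R, R^iota), and of (R^iota, R), where        *)
(* R = (R^iota)^iota.                                                         *)

Section Phi.
Variables (R : realType) (n : nat) (D D' : affine_data R n).
Local Notation V := (hdual R n).
Variables (Y : V -> daag D) (Y' : V -> daag D').

Definition phi_group_spec (phi : daag D -> daag D') : Prop :=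
  [/\ forall i, phi (T_ D (fin i)) = (T_ D' (fin i))^-1%g,
      forall mu, in_M D mu ->
        phi (Y mu) = X_ D' ((Num.sqrt (p_ D))^-1 *: mu),
      forall beta, in_Qo D beta ->
        phi (X_ D beta) = Y' (Num.sqrt (p_ D) *: beta)
    & phi (X_ D (delta D)) = X_ D' (- delta D')].

Definition phi_scalar_spec (sigma : scalars D -> scalars D') : Prop :=
  [/\ forall c, sigma (scalar_const D c) = scalar_const D' c,
      forall i, sigma (t_root D (fin i)) = (t_root D' (fin i))^-1,
      forall i, sigma (t_ D (fin i)) = (t_ D' (fin i))^-1,
      sigma (q_root D) = (q_root D')^-1
    & sigma (q_ D) = (q_ D')^-1].

Definition phi_algebra_spec (phi : daag D -> daag D')
    (sigma : scalars D -> scalars D') (Phi : daha Y -> daha Y') : Prop :=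
  (forall c u, Phi (c *: u) = sigma c *: Phi u) /\
  (forall g, Phi (hecke_elt Y g) = hecke_elt Y' (phi g)).

End Phi.

(* Main.v *)
Require Import Defs.
From HB Require Import structures.
From mathcomp Require Import all_boot all_order all_algebra.
From mathcomp Require Import boolp reals complex fraction ring_quotient.
From mathcomp Require Import finmap monalg.
From mathcomp Require Import(canonicals,coercions) mpoly.
From mathcomp Require Import ring lra zify.
(* Again, because all_algebra shadows the projection form. *)
Import Defs.
Set Implicit Arguments.
Unset Strict Implicit.
Unset Printing Implicit Defensive.
Import Order.TTheory GRing.Theory Num.Theory.
Local Open Scope ring_scope.
Local Open Scope quotient_scope.

(* Apart from X_delta = q^-1, each relation of the Hecke algebra says that    *)
(* some g in the group satisfies g - g^-1 = s - s^-1, a condition which is    *)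
(* invariant under conjugation and, up to s |-> s^-1, under inversion. For    *)
(* 1 <= i <= n, phi inverts T_i and exchanges Y_{-A_i} T_i^-1 and             *)
(* T_i^-1 X_{alpha_i} up to inversion. There remains                          *)
(* g = T_0^-1 X_{alpha_0}. If a simple edge joins the vertices 0 and i, then  *)
(* g is conjugate to T_0 and T_0 to T_i. Otherwise R has type A_1^(1),        *)
(* C_l^(1) or D_{l+1}^(2), theta is the first vector f_0 of an orthogonal     *)
(* basis permuted up to signs by s_1, ..., s_n, and s_theta is a palindrome   *)
(* in s_1, ..., s_n. As Y_{-theta} = T_{s_theta} T_0, one finds               *)
(* phi(g) = (T_0^-1 X_{alpha_0})^-1 when p = 1. In type C_l^(1), g is         *)
(* conjugate to T_0 and phi(T_0) = T_{s_theta} X_{- theta / sqrt p} is        *)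
(* conjugate to T_n X_{- alpha_n}.                                            *)

(** The group isomorphism and its inverse are given, so only scalars and Hecke relations have to be
    followed. [scalar_inversion] inverts the indeterminates, matching those of the two root systems
    through the values d_j: by the identity if p = 1, by x -> p / x otherwise. [ga_map] joins this
    to phi in a semilinear map of group algebras, and [hecke_morphism] makes it descend to the Hecke
    algebras as soon as the relation of T_0^-1 X_{alpha_0} is respected. The opposite map is
    obtained in the same way, and the composites are the identity because they fix scalars and group
    elements ([algebra_morphismK]).

    The relation at the vertex 0 is settled by one of three lemmas. [h0_edge] serves when 0 lies on
    a simple edge. [h0_chain1] (types A_1^(1) and D_{l+1}^(2)) and [h0_chain2] (type C_l^(1)) work
    in an orthogonal basis f_k with theta = f_0. There s_theta is given by a palindromic word, a
    length count shows that this word followed by s_0 is reduced ([translation_word_reduced]), and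
    Y_{-theta} = T_{s_theta} T_0 follows ([Y_chain]).

    The vertex 0 of R^iota must be treated as well. For p = 1 the two root systems agree
    ([iota_data_p1]). For p > 1 the highest root of the finite part of R^iota is determined: in
    orthogonal coordinates for types B and C ([highest_root_B], [highest_root_C]), by enumeration
    for F_4 and G_2 ([check_highest_root]). Since a highest root is unique, this identifies R^iota
    ([iota_data_theta]). Types B and C are exchanged, so that [h0_chain2] serves on one side and
    [h0_edge] on the other, except in rank 2, where both sides have type C; for F_4 and G_2 both
    sides have a simple edge at 0 ([duality_untwisted]).

    The numbers d_j are read off the tables, because a null vector of A is unique up to a factor
    ([labelsE]). *)

Local Notation tofrac := (@FracField.tofrac _).

(** * Inversion of the variables of a rational function field *)

Lemma tofrac_div (R : idomainType) (u : {fraction R}) :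
  exists xy : R * R, xy.2 != 0 /\ u = tofrac xy.1 / tofrac xy.2.
Proof.
exists (\n_(repr u), \d_(repr u)) => /=; have d0 := denom_ratioP (repr u).
split=> //; apply/(canRL (mulfK _)); first by rewrite tofrac_eq0.
rewrite -{1}[u]reprK; case: (repr u) d0 => -[a b] /= b0 _.
unlock FracField.tofrac; rewrite -[LHS]FracField.pi_mul.
apply/eqP; rewrite FracField.equivf_def /FracField.mulf /=.
by rewrite !numden_Ratio ?mulf_neq0 ?oner_neq0 //= !mulr1 mulrC.
Qed.

Section FractionLift.
Variables (R : idomainType) (K : fieldType) (f : {rmorphism R -> K}).
Hypothesis f_inj : forall x, f x = 0 -> x = 0.

(** The value is computed on a chosen fraction; injectivity of [f] keeps denominators nonzero, and
    [frac_liftE] shows that the choice is immaterial. *)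
Definition frac_lift (u : {fraction R}) : K :=
  let xy := projT1 (cid (tofrac_div u)) in f xy.1 / f xy.2.

Let f_neq0 x : x != 0 -> f x != 0.
Proof. by apply: contraNneq => /f_inj ->. Qed.

Lemma frac_liftE x y : y != 0 -> frac_lift (tofrac x / tofrac y) = f x / f y.
Proof.
move=> y0; rewrite /frac_lift; case: cid => -[a b] /= [b0 /eqP].
rewrite eqr_div ?tofrac_eq0 // -!tofracM tofrac_eq => /eqP xb.
by apply/eqP; rewrite eqr_div ?f_neq0 // -!rmorphM xb.
Qed.

Lemma frac_lift_zmod : zmod_morphism frac_lift.
Proof.
move=> u v; have [[a b] /= [b0 ->]] := tofrac_div u.
have [[c d] /= [d0 ->]] := tofrac_div v.
rewrite -mulNr addf_div ?tofrac_eq0 // -!(tofracM, tofracN, tofracD).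
rewrite !frac_liftE ?mulf_neq0 // -mulNr addf_div ?f_neq0 //.
by rewrite !(rmorphM, rmorphD, rmorphN).
Qed.

Lemma frac_lift_monoid : monoid_morphism frac_lift.
Proof.
split=> [|u v].
  by rewrite -[1]divr1 -tofrac1 frac_liftE ?oner_neq0 // rmorph1 divr1.
have [[a b] /= [b0 ->]] := tofrac_div u.
have [[c d] /= [d0 ->]] := tofrac_div v.
rewrite mulf_div -!tofracM !frac_liftE ?mulf_neq0 // !rmorphM.
by rewrite mulf_div.
Qed.

HB.instance Definition _ :=
  GRing.isZmodMorphism.Build {fraction R} K frac_lift frac_lift_zmod.
HB.instance Definition _ :=
  GRing.isMonoidMorphism.Build {fraction R} K frac_lift frac_lift_monoid.

Lemma ex_frac_lift :
  exists g : {rmorphism {fraction R} -> K}, forall x, g (tofrac x) = f x.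
Proof.
exists frac_lift => x /=; rewrite -[tofrac x]divr1 -tofrac1.
by rewrite frac_liftE ?oner_neq0 // rmorph1 divr1.
Qed.

End FractionLift.

Lemma fraction_rmorph_eq (R : idomainType) (K : fieldType)
    (f g : {rmorphism {fraction R} -> K}) :
  (forall x, f (tofrac x) = g (tofrac x)) -> f =1 g.
Proof.
by move=> fg u; have [[a b] /= [_ ->]] := tofrac_div u; rewrite !fmorph_div !fg.
Qed.

Section InverseSubstitution.
Variables (C : fieldType) (N N' : nat) (pi : 'I_N -> 'I_N') (pi' : 'I_N' -> 'I_N).
Hypotheses (piK : cancel pi pi') (piK' : cancel pi' pi).
Local Notation P := (mpoly.mpoly N C).
Local Notation P' := (mpoly.mpoly N' C).

Let cst : {rmorphism C -> {fraction P'}} :=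
  GRing.RMorphism.clone _ _ (FracField.tofrac (R:=P') \o @mpoly.mpolyC N' C) _.
Let var (i : 'I_N') : {fraction P'} := tofrac (mpoly.mpolyX C (mpoly.mnm1 i)).

Definition inv_subst : {rmorphism P -> {fraction P'}} :=
  GRing.RMorphism.clone _ _
    (mpoly.mmap cst (fun i => (var (pi i))^-1)) _.

Lemma var_neq0 i : var i != 0.
Proof.
rewrite tofrac_eq0 -mpoly.msupp_eq0 mpoly.msuppX.
by [].
Qed.

(* Multiplying p(1/X) by a high power of the product of the variables gives   *)
(* the polynomial with the coefficients of p in reversed order.               *)
Lemma inv_subst_inj p : inv_subst p = 0 -> p = 0.
Proof.
move=> p0; pose d := mpoly.mmeasure mpoly.mdeg p.
(* [d] bounds every exponent in [p], so these truncated subtractions are exact and [m] can be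
   recovered from [rv m]. *)
pose rv (m : mpoly.multinom N) : mpoly.multinom N' :=
  mpoly.Multinom [tuple (d - m (pi' j))%N | j < N'].
have rvE m j : rv m j = (d - m (pi' j))%N by rewrite mpoly.mnmE.
have ltd m i : m \in mpoly.msupp p -> (m i <= d)%N.
  move=> /mpoly.msize_mdeg_lt /ltnW; apply: leq_trans.
  by rewrite mpoly.mdegE (bigD1 i) //= leq_addr.
pose q : P' := \sum_(m <- mpoly.msupp p) mpoly.mcoeff m p *: mpoly.mpolyX C (rv m).
have q0 : q = 0.
  apply/eqP; rewrite -tofrac_eq0 rmorph_sum /=; apply/eqP.
  transitivity ((\prod_(j < N') var j ^+ d) * inv_subst p); last by rewrite p0 mulr0.
  rewrite /inv_subst /= /mpoly.mmap mulr_sumr big_seq [RHS]big_seq.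
  apply: eq_bigr => m pm; rewrite -mpoly.mul_mpolyC rmorphM /= mulrCA; congr (_ * _).
  rewrite mpoly.mpolyXE_id rmorph_prod /mpoly.mmap1.
  have -> : \prod_i (var (pi i))^-1 ^+ m i = \prod_j (var j)^-1 ^+ m (pi' j).
    rewrite (reindex pi'); last by exists pi => ? _; rewrite ?piK ?piK'.
    by apply: eq_bigr => j _; rewrite piK'.
  rewrite -big_split /=; apply: eq_bigr => j _.
  rewrite rmorphXn rvE exprVn; apply/(canRL (mulfK _)).
    by rewrite expf_neq0 ?var_neq0.
  by rewrite -exprD subnK ?ltd.
apply/eqP; rewrite -mpoly.msupp_eq0; case Ep: (mpoly.msupp p) => [//|m0 s].
have pm0 : m0 \in mpoly.msupp p by rewrite Ep mem_head.
have : mpoly.mcoeff (rv m0) q = mpoly.mcoeff m0 p.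
  rewrite /q raddf_sum /= (bigD1_seq m0) ?mpoly.msupp_uniq //= [X in _ + X]big1_seq.
    by rewrite addr0 mpoly.mcoeffZ mpoly.mcoeffX eqxx mulr1.
  move=> m /andP[ne pm]; rewrite mpoly.mcoeffZ mpoly.mcoeffX.
  case: eqP => [E|_]; last by rewrite mulr0.
  case/eqP: ne; apply/mpoly.mnmP => i; have := rvE m (pi i); rewrite E rvE piK.
  by move=> E2; rewrite -(subKn (ltd m i pm)) -E2 subKn ?ltd.
rewrite q0 mpoly.mcoeff0 => /esym/eqP.
by move: pm0; rewrite mpoly.mcoeff_msupp => /negPf ->.
Qed.

Lemma ex_inv_subst : exists g : {rmorphism {fraction P} -> {fraction P'}},
  (forall c, g (tofrac (mpoly.mpolyC N c)) = tofrac (mpoly.mpolyC N' c)) /\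
  forall i, g (tofrac (mpoly.mpolyX C (mpoly.mnm1 i)))
    = (tofrac (mpoly.mpolyX C (mpoly.mnm1 (pi i))))^-1.
Proof.
have [g gE] := ex_frac_lift inv_subst_inj; exists g.
split=> [c|i]; rewrite gE /inv_subst /=; first by rewrite mpoly.mmapC.
by rewrite mpoly.mmapX mpoly.mmap1U.
Qed.

End InverseSubstitution.

Lemma mfraction_rmorph_eq (C K : fieldType) (N : nat)
    (f g : {rmorphism {fraction mpoly.mpoly N C} -> K}) :
  (forall c, f (tofrac (mpoly.mpolyC N c)) = g (tofrac (mpoly.mpolyC N c))) ->
  (forall i, f (tofrac (mpoly.mpolyX C (mpoly.mnm1 i)))
    = g (tofrac (mpoly.mpolyX C (mpoly.mnm1 i)))) -> f =1 g.
Proof.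
move=> fgC fgX; apply: fraction_rmorph_eq => p; rewrite [p]mpoly.mpolyE !rmorph_sum.
apply: eq_bigr => m _; rewrite -mpoly.mul_mpolyC !rmorphM /= fgC; congr (_ * _).
rewrite mpoly.mpolyXE_id !rmorph_prod; apply: eq_bigr => i _.
by rewrite !rmorphXn /= fgX.
Qed.

(** * Quadratic relations in quotients of group algebras *)

Section MultiplicativeGroup.
Variables (G H : groupType) (f : {multiplicative G -> H}).
Local Open Scope group_scope.

Lemma multiplicative1 : f 1 = 1.
Proof. by apply: (mulgI (f 1)); rewrite -gmulfM !mulg1. Qed.

Lemma multiplicativeV x : f x^-1 = (f x)^-1.
Proof. by apply: (mulgI (f x)); rewrite -gmulfM !mulgV multiplicative1. Qed.

Lemma multiplicative_prod I (r : seq I) (F : I -> G) :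
  f (\prod_(i <- r) F i) = \prod_(i <- r) f (F i).
Proof. exact: (big_morph f (@gmulfM _ _ f) multiplicative1). Qed.

End MultiplicativeGroup.

Section GroupAlgebraMap.
Variables (F K : fieldType) (G H : groupType).
Variables (s : {rmorphism F -> K}) (f : {multiplicative G -> H}).
Local Notation GF := (group_algebra F G).
Local Notation KH := (group_algebra K H).

(** Coefficients are moved along [s], because phi acts on the parameters too: the map is semilinear,
    not linear. *)
Definition ga_map (a : GF) : KH :=
  \sum_(g <- msupp a) (mkmalgU (f g) (s a@_g) : KH).

Lemma ga_mapw (d : {fset G}) (a : GF) : fsubset (msupp a) d ->
  ga_map a = \sum_(g <- d) (mkmalgU (f g) (s a@_g) : KH).
Proof.
move=> le; rewrite /ga_map (big_fset_incl _ le) //= => g _ /mcoeff_outdom ->.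
by rewrite rmorph0 monalgU0.
Qed.

Lemma ga_mapU g x : ga_map (mkmalgU g x : GF) = mkmalgU (f g) (s x) :> KH.
Proof. by rewrite (ga_mapw msuppU_le) big_seq_fset1 mcoeffUU. Qed.

Lemma ga_mapD a b : ga_map (a + b) = ga_map a + ga_map b.
Proof.
rewrite (ga_mapw (msuppD_le a b)) (ga_mapw (fsubsetUl (msupp a) (msupp b))).
rewrite (ga_mapw (fsubsetUr (msupp a) (msupp b))) -big_split /=.
by apply: eq_bigr => g _; rewrite mcoeffD rmorphD monalgUD.
Qed.

Lemma ga_map_zmod : zmod_morphism ga_map.
Proof. by move=> a b; apply/(canRL (addrK _)); rewrite -ga_mapD subrK. Qed.

HB.instance Definition _ := GRing.isZmodMorphism.Build GF KH ga_map ga_map_zmod.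

Lemma ga_map_monoid : monoid_morphism ga_map.
Proof.
split=> [|a b]; first by rewrite ga_mapU multiplicative1 rmorph1.
elim/ga_ind: a => [|a1 a2 I1 I2|g x]; first by rewrite !(mul0r, raddf0).
  by rewrite mulrDl !ga_mapD mulrDl I1 I2.
elim/ga_ind: b => [|b1 b2 I1 I2|h y]; first by rewrite !(mulr0, raddf0).
  by rewrite mulrDr !ga_mapD mulrDr I1 I2.
by rewrite ga_mulE !ga_mapU ga_mulE gmulfM rmorphM.
Qed.

HB.instance Definition _ := GRing.isMonoidMorphism.Build GF KH ga_map ga_map_monoid.

Lemma ga_mapZ c a : ga_map (c *: a) = s c *: ga_map a.
Proof.
elim/ga_ind: a => [|a1 a2 I1 I2|g x]; first by rewrite !(scaler0, raddf0).
  by rewrite scalerDr !ga_mapD scalerDr I1 I2.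
by rewrite ga_scaleU !ga_mapU ga_scaleU rmorphM.
Qed.

Lemma ga_map_elt g : ga_map (ga_elt F g) = ga_elt K (f g).
Proof. by rewrite ga_mapU rmorph1. Qed.

End GroupAlgebraMap.

Section QuotientLift.
Variables (F K : fieldType) (A : algType F) (B : algType K).
Variables (S : A -> Prop) (S' : B -> Prop) (h : {rmorphism A -> B}).
Hypothesis hS : forall x, S x -> two_sided_ideal S' (h x).

Lemma two_sided_ideal_map x : two_sided_ideal S x -> two_sided_ideal S' (h x).
Proof.
elim=> [|a u b y Su _ IH]; first by rewrite raddf0; exact: Ideal0.
rewrite raddfD /= !rmorphM; apply: ideal_predD IH; apply: ideal_predM.
exact: hS.
Qed.

Definition quot_lift (u : alg_quot S) : alg_quot S' := alg_class S' (h (repr u)).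

Lemma quot_liftE x : quot_lift (alg_class S x) = alg_class S' (h x).
Proof.
apply/eqP/alg_classP; rewrite -raddfB; apply: two_sided_ideal_map.
exact: repr_alg_class.
Qed.

Lemma alg_classB x y : alg_class S (x - y) = alg_class S x - alg_class S y.
Proof. by apply/(canRL (addrK _)); rewrite -alg_classD subrK. Qed.

End QuotientLift.

Section QuotientLiftMorphism.
Variables (F K : fieldType) (A : algType F) (B : algType K).
Variables (S : A -> Prop) (S' : B -> Prop) (h : {rmorphism A -> B}).
Hypothesis hS : forall x, S x -> two_sided_ideal S' (h x).

Let lift : alg_quot S -> alg_quot S' := quot_lift S' h.

Lemma quot_lift_zmod : zmod_morphism lift.
Proof.
elim/alg_classW=> x; elim/alg_classW=> y.
by rewrite -alg_classB /lift !quot_liftE // raddfB alg_classB.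
Qed.

Lemma quot_lift_monoid : monoid_morphism lift.
Proof.
split; first by rewrite /lift [LHS]quot_liftE // rmorph1.
elim/alg_classW=> x; elim/alg_classW=> y.
rewrite [_ * _]aq_mulE /lift !quot_liftE // rmorphM.
by rewrite [RHS]aq_mulE.
Qed.

HB.instance Definition _ :=
  GRing.isZmodMorphism.Build (alg_quot S) (alg_quot S') lift quot_lift_zmod.
HB.instance Definition _ :=
  GRing.isMonoidMorphism.Build (alg_quot S) (alg_quot S') lift quot_lift_monoid.

Lemma ex_quot_lift : exists g : {rmorphism alg_quot S -> alg_quot S'},
  forall x, g (alg_class S x) = alg_class S' (h x).
Proof. by exists lift => x /=; exact: quot_liftE. Qed.

End QuotientLiftMorphism.

Section QuadraticElements.
Variables (F : fieldType) (G : groupType) (S : group_algebra F G -> Prop).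
Local Notation GA := (group_algebra F G).
Local Notation "[ g ]" := (ga_elt F (g : G)) (format "[ g ]").
Implicit Types (v g : G) (s : F).

(** The second terms T_i Y_{A_i} and X_{-alpha_j} T_j of the Hecke relations are the inverses of the
    first ones, so all of them take this shape. *)
Definition quad_elt v s : GA := [v] - [v^-1%g] - (s - s^-1)%:A.
Definition quad v s := two_sided_ideal S (quad_elt v s).

Lemma ga_eltM v g : [(v * g)%g] = [v] * [g].
Proof. by rewrite ga_mulE mulr1. Qed.

Lemma ga_eltV v : [v] * [v^-1%g] = 1.
Proof. by rewrite -ga_eltM mulgV. Qed.

Lemma quad_conj g v s : quad v s -> quad (g * v * g^-1)%g s.
Proof.
move=> /(ideal_predM [g] [g^-1%g]); rewrite /quad /quad_elt.
rewrite !(mulrBr, mulrBl) -!ga_eltM -scalerAr -scalerAl mulr1 ga_eltV.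
by rewrite !invgM invgK mulgA.
Qed.

Lemma quadV v s : quad v s -> quad v^-1%g s^-1.
Proof.
move=> /(ideal_predM (-1) 1); rewrite mulN1r mulr1 /quad /quad_elt.
by rewrite invgK invrK opprD opprK opprB -[s^-1 - s]opprB scaleNr opprK.
Qed.

Lemma quad_conjM v g s : quad (v * g)%g s -> quad (g * v)%g s.
Proof. by move=> /(quad_conj g); rewrite mulgA mulgK. Qed.

End QuadraticElements.

Lemma ga_map_quad (F K : fieldType) (G H : groupType) (s : {rmorphism F -> K})
    (f : {multiplicative G -> H}) v x :
  ga_map s f (quad_elt v x) = quad_elt (f v) (s x).
Proof.
rewrite /quad_elt !raddfB /= !ga_map_elt ga_mapZ rmorph1 multiplicativeV.
by rewrite rmorphB fmorphV.
Qed.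

(** * Lattice elements and braids in the double affine Artin group *)

(** The properties shared by the data of a Cartan matrix and those of R^iota; the computations in
    the Artin groups rest on them and so apply to both sides. The last one makes the fundamental
    weights well defined. *)
Record affine_realization (R : realType) (n : nat) (D : affine_data R n) : Prop := {
  formC : forall x y, form D x y = form D y x;
  formDl : forall x y z, form D (x + y) z = form D x z + form D y z;
  formZl : forall c x z, form D (c *: x) z = c * form D x z;
  simple_free : forall (c : 'I_n.+1 -> R) r,
    \sum_i c i *: simple D (fin i) + r *: delta D = 0 -> (forall i, c i = 0) /\ r = 0;
  theta_in_Qo : in_Qo D (delta D - simple D ord0);
  form_delta_simple : forall i, form D (delta D) (simple D (fin i)) = 0;
  form_delta : form D (delta D) (delta D) = 0;
  form_Lambda0_simple : forall i, form D (Lambda0 D) (simple D (fin i)) = 0;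
  form_Lambda0_delta : form D (Lambda0 D) (delta D) = 1;
  simple_norm_gt0 : forall j, 0 < form D (simple D j) (simple D j);
  fin_nondegenerate : forall c : 'I_n.+1 -> R,
    (forall i, form D (\sum_k c k *: simple D (fin k)) (simple D (fin i)) = 0) ->
    forall i, c i = 0
}.

Section Realization.
Variables (R : realType) (n : nat) (D : affine_data R n).
Hypothesis rD : affine_realization D.
Local Notation V := (hdual R n).
Local Notation "'( x , y )" := (form D x y) (format "''(' x ,  y )").
Local Notation alpha := (simple D).
Implicit Types (x y z : V) (j : 'I_n.+2) (i : 'I_n.+1).

Lemma formDr x y z : '(x, y + z) = '(x, y) + '(x, z).
Proof. by rewrite !(formC rD x) formDl. Qed.
Lemma formZr c x y : '(x, c *: y) = c * '(x, y).
Proof. by rewrite !(formC rD x) formZl. Qed.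
Lemma formNl x y : '(- x, y) = - '(x, y).
Proof. by rewrite -scaleN1r formZl // mulN1r. Qed.
Lemma formNr x y : '(x, - y) = - '(x, y).
Proof. by rewrite !(formC rD x) formNl. Qed.
Lemma formBl x y z : '(x - y, z) = '(x, z) - '(y, z).
Proof. by rewrite formDl // formNl. Qed.
Lemma formBr x y z : '(x, y - z) = '(x, y) - '(x, z).
Proof. by rewrite formDr formNr. Qed.
Lemma form0l y : '(0, y) = 0.
Proof. by rewrite -(scale0r 0) formZl // mul0r. Qed.
Lemma form0r y : '(y, 0) = 0.
Proof. by rewrite formC // form0l. Qed.
Lemma form_suml I (r : seq I) (F : I -> V) y :
  '(\sum_(i <- r) F i, y) = \sum_(i <- r) '(F i, y).
Proof.
by elim/big_rec2: _ => [|i a b _ <-]; [exact: form0l|exact: formDl].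
Qed.
Lemma form_sumr I (r : seq I) (F : I -> V) y :
  '(y, \sum_(i <- r) F i) = \sum_(i <- r) '(y, F i).
Proof. by rewrite formC // form_suml; apply: eq_bigr => i _; rewrite formC. Qed.

Definition formE := (formDr, formZr, formBr, formNr, form0r,
  (formDl rD, formZl rD, formBl, formNl, form0l)).

Lemma form_coroot x y : '(x, coroot D y) = 2 * '(x, y) / '(y, y).
Proof. by rewrite /coroot formZr mulrAC. Qed.

Lemma reflectionD b x y :
  reflection D b (x + y) = reflection D b x + reflection D b y.
Proof. by rewrite /reflection formDl // scalerDl opprD addrACA. Qed.

Lemma reflectionZ b c x : reflection D b (c *: x) = c *: reflection D b x.
Proof. by rewrite /reflection formZl // scalerBr scalerA. Qed.

Lemma reflection_orth b x : '(x, b) = 0 -> reflection D b x = x.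
Proof. by rewrite /reflection form_coroot => ->; rewrite mulr0 mul0r scale0r subr0. Qed.

Lemma in_QoP x : reflect (exists c : 'I_n.+1 -> int, x = \sum_i alpha (fin i) *~ c i)
  (in_Qo D x).
Proof. exact: asboolP. Qed.

Lemma in_Qo0 : in_Qo D 0.
Proof. by apply/in_QoP; exists (fun=> 0); rewrite big1. Qed.

Lemma in_QoD x y : in_Qo D x -> in_Qo D y -> in_Qo D (x + y).
Proof.
move=> /in_QoP[c ->] /in_QoP[d ->]; apply/in_QoP; exists (fun i => c i + d i).
by rewrite -big_split; apply: eq_bigr => i _; rewrite mulrzDr.
Qed.

Lemma in_QoN x : in_Qo D x -> in_Qo D (- x).
Proof.
move=> /in_QoP[c ->]; apply/in_QoP; exists (fun i => - c i).
by rewrite -sumrN; apply: eq_bigr => i _; rewrite mulrNz.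
Qed.

Lemma in_Qo_simple i : in_Qo D (alpha (fin i)).
Proof.
apply/in_QoP; exists (fun k => (k == i)%:Z).
rewrite (bigD1 i) //= eqxx big1 ?addr0 // => k /negPf ->.
by rewrite mulr0z.
Qed.

Lemma in_finD x y : in_fin D x -> in_fin D y -> in_fin D (x + y).
Proof.
move=> [c ->] [d ->]; exists (fun i => c i + d i).
by rewrite -big_split; apply: eq_bigr => i _; rewrite scalerDl.
Qed.

Lemma in_finZ a x : in_fin D x -> in_fin D (a *: x).
Proof.
move=> [c ->]; exists (fun i => a * c i).
by rewrite scaler_sumr; apply: eq_bigr => i _; rewrite scalerA.
Qed.

Lemma in_fin_simple i : in_fin D (alpha (fin i)).
Proof.
exists (fun k => (k == i)%:R).
rewrite (bigD1 i) //= eqxx scale1r big1 ?addr0 // => k /negPf ->.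
by rewrite scale0r.
Qed.

Lemma in_Qo_fin x : in_Qo D x -> in_fin D x.
Proof.
move=> /in_QoP[c ->]; exists (fun i => (c i)%:~R).
by apply: eq_bigr => i _; rewrite scaler_int.
Qed.

Lemma in_fin_delta x r : in_fin D x -> x + r *: delta D = 0 -> x = 0 /\ r = 0.
Proof.
move=> [c ->] /(simple_free rD)[c0 ->]; split=> //.
by apply: big1 => i _; rewrite c0 scale0r.
Qed.

Lemma form_fin_delta x : in_fin D x -> '(x, delta D) = 0.
Proof.
move=> [c ->]; rewrite form_suml big1 // => i _.
by rewrite formZl // formC // form_delta_simple // mulr0.
Qed.

Lemma form_fin_Lambda0 x : in_fin D x -> '(x, Lambda0 D) = 0.
Proof.
move=> [c ->]; rewrite form_suml big1 // => i _.
by rewrite formZl // formC // form_Lambda0_simple // mulr0.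
Qed.

Lemma form_simple_delta j : '(alpha j, delta D) = 0.
Proof.
have [i ->|->] := unliftP ord0 j; first exact/form_fin_delta/in_fin_simple.
rewrite -[alpha ord0](subKr
  (delta D)) formBl form_delta // sub0r form_fin_delta ?oppr0 //.
exact/in_Qo_fin/theta_in_Qo.
Qed.

Section ArtinGroup.
Local Notation W := (word (artin_gen D)).
Local Notation cls := (word_class (@artin_rel R n D)).
Local Open Scope group_scope.
Local Notation "x + y" := (GRing.add x y).
Local Notation "- x" := (GRing.opp x).

Lemma clsM (u v : W) : cls u * cls v = cls (u ++ v).
Proof. exact: pmulE. Qed.

Lemma cls_rel (u v : W) : artin_rel u v -> cls u = cls v.
Proof. by move=> uv; apply/eqP/word_classP; exact: Cong_rel. Qed.

(** The alpha_i with i > 0 and delta are independent, so the decomposition picked by [wX] is the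
    only one. *)
Lemma wXE x (hx : in_Qo D x) (k : int) :
  wX D (x + delta D *~ k)%R = (GenX (exist _ x hx), true) :: wdelta D k.
Proof.
rewrite /wX; case: pselect => [h|nh]; last first.
  by case: nh; exists (exist _ x hx, k).
case: cid => -[[y hy] l] /= E.
have /in_fin_delta[] : (x - y + (k - l)%:~R *: delta D = 0)%R.
- by rewrite scaler_int mulrzBr addrACA -opprD E subrr.
- exact/in_Qo_fin/in_QoD/in_QoN.
move=> /eqP; rewrite subr_eq0 => /eqP xy /eqP; rewrite intr_eq0 subr_eq0 => /eqP kl.
by rewrite -kl; congr (_ :: _); congr (GenX _, _); exact: val_inj.
Qed.

Lemma wXE0 x (hx : in_Qo D x) : wX D x = [:: (GenX (exist _ x hx), true)].
Proof. by rewrite -[x in wX D x]addr0 -(mulr0z (delta D)) wXE. Qed.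

Lemma X_M x y : in_Qo D x -> in_Qo D y -> X_ D x * X_ D y = X_ D (x + y).
Proof. by move=> hx hy; rewrite clsM; apply/cls_rel/Rel_XX. Qed.

Lemma X_0 : X_ D 0 = 1.
Proof. by apply: (mulgI (X_ D 0)); rewrite X_M ?in_Qo0 // addr0 mulg1. Qed.

Lemma X_N x : in_Qo D x -> X_ D (- x) = (X_ D x)^-1.
Proof.
by move=> hx; apply: (mulgI (X_ D x)); rewrite X_M ?in_QoN // subrr X_0 mulgV.
Qed.

Lemma X_delta_mulE x (k : int) : in_Qo D x ->
  X_ D (x + delta D *~ k)%R = X_ D x * cls (wdelta D k).
Proof. by move=> hx; rewrite /X_ (wXE hx) clsM (wXE0 hx). Qed.

Lemma X_deltaE : X_ D (delta D) = cls (wdelta D 1).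
Proof. by rewrite -[delta D]add0r
  -[delta D]mulr1z X_delta_mulE ?in_Qo0 // X_0 mul1g. Qed.

Lemma X_deltaNE : X_ D (- delta D) = (X_ D (delta D))^-1.
Proof.
rewrite X_deltaE -[(- _)%R]add0r -[delta D]mulr1z -mulrNz.
rewrite X_delta_mulE ?in_Qo0 // X_0 mul1g.
by apply: (mulgI (cls (wdelta D 1))); rewrite clsM mulgV;
  apply/eqP/word_classP/Cong_inv.
Qed.

Lemma X_addD x : in_Qo D x -> X_ D (x + delta D) = X_ D x * X_ D (delta D).
Proof. by move=> hx; rewrite -[delta D in LHS]mulr1z X_delta_mulE // X_deltaE. Qed.

Lemma X_subD x : in_Qo D x -> X_ D (x - delta D) = X_ D x * (X_ D (delta D))^-1.
Proof.
move=> hx; rewrite -[(- _)%R in LHS]mulr1z mulNrz -mulrNz X_delta_mulE //.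
by rewrite -X_deltaNE -[(- _)%R in RHS]add0r
  -[delta D in RHS]mulr1z -mulrNz X_delta_mulE ?in_Qo0 // X_0 mul1g.
Qed.

(** The relations give commutation with the positive letters; the case of an inverse letter follows
    by cancellation, and words by induction. *)
Lemma X_delta_comm (g : daag D) : X_ D (delta D) * g = g * X_ D (delta D).
Proof.
rewrite X_deltaE; elim/classW: g; elim=> [|[x b] u IH]; first by rewrite !clsM cats0.
rewrite -[(x, b) :: u]cat1s -clsM mulgA -[in RHS]mulgA -IH !mulgA; congr (_ * _).
have E : cls (wdelta D 1) * cls [:: (x, true)] = cls [:: (x, true)] * cls (wdelta D 1).
  by rewrite !clsM; apply/cls_rel/Rel_delta.
case: b => //.
have -> : cls [:: (x, false)] = (cls [:: (x, true)])^-1.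
  by apply: (mulgI (cls [:: (x, true)])); rewrite clsM mulgV;
    apply/eqP/word_classP/Cong_inv.
by apply: (mulgI (cls [:: (x, true)])); rewrite mulVKg !mulgA -E mulgK.
Qed.

Lemma T_X1 j x : in_Qo D x -> '(x, coroot D (alpha j)) = (-1)%R ->
  T_ D j * X_ D x * T_ D j = X_ D (x + alpha j).
Proof.
move=> hx E; rewrite -mulgA (clsM (wX D x) (wT D j)) (clsM (wT D j));
  have -> : (x + alpha j = s_ D j x)%R.
  by rewrite /s_ /reflection E scaleN1r opprK.
exact/cls_rel/Rel_TX1.
Qed.

Lemma X_simple0 : X_ D (alpha ord0) =
  (X_ D (delta D - alpha ord0)%R)^-1 * X_ D (delta D).
Proof.
by rewrite -X_N ?theta_in_Qo // -X_addD ?in_QoN ?theta_in_Qo // opprB subrK.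
Qed.

Lemma X_simple0N : X_ D (- alpha ord0) = (X_ D (alpha ord0))^-1.
Proof.
have -> : (- alpha ord0 = (delta D - alpha ord0) - delta D)%R
  by rewrite addrAC subrr add0r.
rewrite X_subD ?theta_in_Qo // X_simple0 invgM invgK.
by apply: (mulgI (X_ D (delta D))); rewrite mulVKg mulgA X_delta_comm mulgK.
Qed.

Lemma X_simpleN j : X_ D (- alpha j) = (X_ D (alpha j))^-1.
Proof.
by have [i ->|->] := unliftP ord0 j; rewrite ?X_simple0N // X_N // in_Qo_simple.
Qed.

(* Hence the quadratic relation of T_0^-1 X_{alpha_0} is that of T_0.         *)
Lemma TX0_conj x : in_Qo D x -> '(x, coroot D (alpha ord0)) = (-1)%R ->
  (T_ D ord0)^-1 * X_ D (alpha ord0)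
    = (X_ D x * T_ D ord0)^-1 * T_ D ord0 * ((X_ D x * T_ D ord0)^-1)^-1.
Proof.
move=> hx E; have /= TX := T_X1 hx E.
(* The relation writes X_{x + alpha_0} as T_0 X_x T_0; solving for X_{alpha_0} exhibits the
   conjugating element X_x T_0. *)
have : X_ D (x + alpha ord0) = X_ D x * X_ D (alpha ord0).
  have -> : (x + alpha ord0 = (x - (delta D - alpha ord0)) + delta D)%R.
    by rewrite opprB addrA subrK.
  by rewrite X_addD ?in_QoD ?in_QoN ?theta_in_Qo // -X_M ?in_QoN ?theta_in_Qo //
     X_N ?theta_in_Qo // X_simple0 mulgA.
rewrite -TX => {}TX; rewrite invgK invgM !mulgA; apply: (mulgI (X_ D x * T_ D ord0)).
have -> : X_ D (alpha ord0) = (X_ D x)^-1 * (T_ D ord0 * X_ D x * T_ D ord0).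
  by rewrite TX mulKg.
by rewrite !mulgA.
Qed.

End ArtinGroup.
End Realization.

(** * Reflections and the braid relation of a simple edge *)

Section Reflections.
Variables (R : realType) (n : nat) (D : affine_data R n).
Hypothesis rD : affine_realization D.
Local Notation V := (hdual R n).
Local Notation "'( x , y )" := (form D x y) (format "''(' x ,  y )").
Local Notation alpha := (simple D).
Implicit Types (x y z b : V) (j k : 'I_n.+2) (i : 'I_n.+1).

Let formE := (formE rD).

Lemma reflection_isometry b x y : '(b, b) != 0 ->
  '(reflection D b x, reflection D b y) = '(x, y).
Proof.
move=> b0; rewrite /reflection !(form_coroot rD) !formE (formC rD b y).
by field.
Qed.

Lemma reflection_self b : '(b, b) != 0 -> reflection D b b = - b.
Proof.
move=> b0; rewrite /reflection (form_coroot rD) mulfK //.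
by rewrite scaler_nat mulr2n opprD addNKr.
Qed.

Lemma reflectionK b : '(b, b) != 0 -> involutive (reflection D b).
Proof.
move=> b0 x; rewrite /reflection !(form_coroot rD) !formE.
rewrite -addrA -opprD -scalerDl.
suff -> : 2 * '(x, b) / '(b, b) + 2 *
  ('(x, b) - 2 * '(x, b) / '(b, b) * '(b, b)) / '(b, b) = 0.
  by rewrite scale0r subr0.
by field.
Qed.

Lemma reflection_conj a b x : '(a, a) != 0 -> '(b, b) != 0 ->
  reflection D a (reflection D b (reflection D a x))
  = reflection D (reflection D a b) x.
Proof.
move=> a0 b0; set y := reflection D a x.
have -> : reflection D (reflection D a b) x = reflection D a y - 
    (2 * '(reflection D a y, reflection D a b) / '(reflection D a b, reflection D a b))
     *: reflection D a b.
  by rewrite /y reflectionK // {1}/reflection (form_coroot rD).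
rewrite !reflection_isometry // {2}/reflection (form_coroot rD).
by rewrite -!scaleNr (reflectionD rD) (reflectionZ rD).
Qed.

Section Edge.
Variables (j k : 'I_n.+2).
Hypotheses (jk : '(alpha j, coroot D (alpha k)) = -1)
           (kj : '(alpha k, coroot D (alpha j)) = -1).

(** In the coordinates u, v along alpha_j and alpha_k the reflection is an affine map, so that the
    powers of s_j s_k can be computed. *)
Lemma s_edge x u v :
  s_ D j (x - u *: alpha j - v *: alpha k)
  = x - ('(x, coroot D (alpha j)) - u + v) *: alpha j - v *: alpha k.
Proof.
have jj : '(alpha j, coroot D (alpha j)) = 2.
  by rewrite (form_coroot rD) mulfK // lt0r_neq0 // simple_norm_gt0.
have kj' := kj; rewrite /s_ /reflection; move: (coroot D (alpha j)) jj kj' => c jj kj'.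
rewrite !formE jj kj' addrAC; congr (_ - _).
rewrite -addrA -opprD -scalerDl; congr (_ - _ *: _); ring.
Qed.

End Edge.

(** s_j s_k rotates the plane of alpha_j and alpha_k by a third of a turn. Smaller powers are
    excluded on alpha_j, by pairing its displacement with the two coroots. *)
Lemma edge_order j k : '(alpha j, coroot D (alpha k)) = -1 ->
  '(alpha k, coroot D (alpha j)) = -1 -> order_ss D j k 3.
Proof.
move=> jk kj.
have Ej x u v := s_edge kj x u v.
have Ek x u v : s_ D k (x - u *: alpha j - v *: alpha k)
  = x - u *: alpha j - ('(x, coroot D (alpha k)) - v + u) *: alpha k.
  by rewrite addrAC (s_edge jk) addrAC.
have E0 x : x = x - 0 *: alpha j - 0 *: alpha k by rewrite !scale0r !subr0.
have jj l : '(alpha l, coroot D (alpha l)) = 2.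
  by rewrite (form_coroot rD) mulfK // lt0r_neq0 // simple_norm_gt0.
split=> // [x|m' /andP[m0 m3] /(_ (alpha j - 0 *: alpha j - 0 *: alpha k))].
  rewrite [x in LHS]E0 /= !(Ek, Ej) [RHS]E0.
  by congr (_ - _ *: _ - _ *: _); ring.
have {m0 m3} : m' = 1%N \/ m' = 2%N by lia.
move=> m12 E; have {m12}E :
  exists u v, (u, v) != (0, 0) :> R * R /\ alpha j - u *: alpha j - v *: alpha k
    = alpha j - 0 *: alpha j - 0 *: alpha k.
  by case: m12 E => -> /=; rewrite !(Ek, Ej) jj jk => E; eexists; eexists; split;
    try exact: E;
    rewrite xpair_eqE; lra.
case: E => u [v [uv E]].
have P c : '(alpha j, c) - u * '(alpha j, c) - v * '(alpha k, c) = '(alpha j, c).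
  by move/(congr1 (fun x => form D x c)): E; rewrite !scale0r !subr0 !formE.
have := P (coroot D (alpha k)); have := P (coroot D (alpha j));
  rewrite !jj jk kj => P1 P2.
have u0 : u = 0 by lra.
have v0 : v = 0 by lra.
by rewrite u0 v0 eqxx in uv.
Qed.

Local Open Scope group_scope.

Lemma edge_braid j k : '(alpha j, coroot D (alpha k)) = (-1)%R ->
  '(alpha k, coroot D (alpha j)) = (-1)%R ->
  T_ D j * T_ D k * T_ D j = T_ D k * T_ D j * T_ D k.
Proof.
move=> jk kj; have ne : j != k.
  apply/eqP => E; move: jk; rewrite E (form_coroot rD) mulfK; last first.
    by rewrite lt0r_neq0 // simple_norm_gt0.
  by move=> ?; lra.
have := cls_rel (Rel_braid ne (edge_order jk kj)).
by rewrite -!mulgA /T_ !(clsM (wT D _) (wT D _)) !(clsM (wT D _) (wT D _ ++ _)).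
Qed.

Lemma edge_conj j k : '(alpha j, coroot D (alpha k)) = (-1)%R ->
  '(alpha k, coroot D (alpha j)) = (-1)%R ->
  T_ D j = (T_ D k * T_ D j) * T_ D k * (T_ D k * T_ D j)^-1.
Proof.
by move=> jk kj; rewrite -(edge_braid jk kj) invgM !mulgA !mulgK.
Qed.

End Reflections.

Section TranslationElements.
Variables (R : realType) (n : nat) (D : affine_data R n) (Y : hdual R n -> daag D).
Hypothesis hY : translation_elements Y.

Lemma in_MP x : reflect (exists c : 'I_n.+1 -> int, x = \sum_i A_ D i *~ c i)
  (in_M D x).
Proof. exact: asboolP. Qed.

Lemma in_MD x y : in_M D x -> in_M D y -> in_M D (x + y).
Proof.
move=> /in_MP[c ->] /in_MP[d ->]; apply/in_MP; exists (fun i => c i + d i).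
by rewrite -big_split; apply: eq_bigr => i _; rewrite mulrzDr.
Qed.

Lemma in_MN x : in_M D x -> in_M D (- x).
Proof.
move=> /in_MP[c ->]; apply/in_MP; exists (fun i => - c i).
by rewrite -sumrN; apply: eq_bigr => i _; rewrite mulrNz.
Qed.

Lemma in_M_A i : in_M D (A_ D i).
Proof.
apply/in_MP; exists (fun k => (k == i)%:Z).
rewrite (bigD1 i) //= eqxx big1 ?addr0 // => k /negPf ->.
by rewrite mulr0z.
Qed.

Lemma Y_N mu : in_M D mu -> Y (- mu) = (Y mu)^-1%g.
Proof.
move=> hmu; have h0 : in_M D 0.
  by apply/in_MP; exists (fun=> 0); rewrite big1.
have Y0 : Y 0 = 1%g by apply: (mulgI (Y 0)); rewrite hY.1 // addr0 mulg1.
by apply: (mulgI (Y mu)); rewrite hY.1 ?in_MN // subrr mulgV.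
Qed.

End TranslationElements.

Section ReflectionSwap.
Variables (R : realType) (n : nat) (D : affine_data R n).
Hypothesis rD : affine_realization D.
Local Notation "'( x , y )" := (form D x y) (format "''(' x ,  y )").

Lemma reflection_swapl N kappa x y : '(x, x) = N -> '(y, y) = N -> '(x, y) = 0 ->
  N != 0 -> kappa != 0 -> reflection D (kappa *: (x - y)) x = y.
Proof.
move=> xx yy xy N0 k0; have yx : '(y, x) = 0 by rewrite formC.
rewrite /reflection (form_coroot rD) !(formZr rD) !(formZl rD) !(formBr rD)
  !(formBl rD).
rewrite xx yy xy yx scalerA.
have -> : 2 * (kappa * (N - 0)) / (kappa * (kappa * (N - 0 - (0 - N)))) * kappa = 1.
  have -> : N - 0 - (0 - N) = 2 * N by ring.
  by field; rewrite k0 N0.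
by rewrite scale1r subKr.
Qed.

Lemma reflection_swapr N kappa x y : '(x, x) = N -> '(y, y) = N -> '(x, y) = 0 ->
  N != 0 -> kappa != 0 -> reflection D (kappa *: (x - y)) y = x.
Proof.
move=> xx yy xy N0 k0; rewrite -opprB scalerN -scaleNr.
by rewrite (reflection_swapl (N := N)) ?oppr_eq0 // formC.
Qed.

End ReflectionSwap.

Section NatSpan.
Variables (R : realType) (n : nat) (b : 'I_n.+1 -> hdual R n).

(** The cone of the order by which [highest_root] compares roots. *)
Definition nat_span (x : hdual R n) : Prop :=
  exists c : 'I_n.+1 -> nat, x = \sum_i b i *+ c i.

Lemma nat_span0 : nat_span 0.
Proof. by exists (fun=> 0%N); rewrite big1. Qed.

Lemma nat_spanD x y : nat_span x -> nat_span y -> nat_span (x + y).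
Proof.
move=> [c ->] [d ->]; exists (fun i => c i + d i)%N.
by rewrite -big_split; apply: eq_bigr => i _; rewrite mulrnDr.
Qed.

Lemma nat_span_simple i : nat_span (b i).
Proof.
exists (fun k => (k == i)%N : nat);
  rewrite (bigD1 i) //= eqxx big1 ?addr0 // => k /negPf ->.
by rewrite mulr0n.
Qed.

End NatSpan.

Definition signed (V : zmodType) (s : bool) (x : V) : V := if s then x else - x.

(** * Root systems of types B and C in orthogonal coordinates *)
Section OrthogonalCoordinates.
Variables (R : realType) (n : nat) (D : affine_data R n).
Variables (b : 'I_n.+1 -> hdual R n) (c : nat -> 'I_n.+1).
Variables (g : nat -> hdual R n) (N kappa : R).
Hypothesis rD : affine_realization D.
Local Notation "'( x , y )" := (form D x y) (format "''(' x ,  y )").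
Hypotheses (N0 : N != 0) (kappa0 : kappa != 0).
Hypothesis gg : forall j k, (j <= n)%N -> (k <= n)%N ->
  '(g j, g k) = if j == k then N else 0.
Hypothesis b_mid : forall k, (k < n)%N -> b (c k) = kappa *: (g k - g k.+1).
Hypothesis b_last : b (c n) = g n.
Hypothesis c_onto : forall i, exists2 k, (k <= n)%N & i = c k.

Local Notation refl i := (reflection D (b i)).

Lemma refl_mid k j : (k < n)%N -> (j <= n)%N -> refl (c k) (g j)
  = g (if j == k then k.+1 else if j == k.+1 then k else j).
Proof.
move=> hk hj; have hk' := ltnW hk; have kS : (k == k.+1) = false by lia.
have xx : '(g k, g k) = N by rewrite gg ?eqxx.
have yy : '(g k.+1, g k.+1) = N by rewrite gg ?eqxx.
have xy : '(g k, g k.+1) = 0 by rewrite gg ?kS.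
rewrite b_mid //; case: (altP (j =P k)) => [->|jk];
  first exact: (reflection_swapl rD xx).
case: (altP (j =P k.+1)) => [->|jk']; first exact: (reflection_swapr rD xx).
rewrite (reflection_orth rD) // (formZr rD) (formBr rD) !gg //.
by rewrite (negPf jk) (negPf jk') subr0 mulr0.
Qed.

Lemma refl_last j : (j <= n)%N ->
  refl (c n) (g j) = if j == n then - g n else g j.
Proof.
move=> hj; rewrite b_last; case: (altP (j =P n)) => [->|ne].
  by rewrite (reflection_self rD) // gg // eqxx.
by rewrite (reflection_orth rD) // gg // (negPf ne).
Qed.

(** The simple reflections act by signed permutations of the [g k]. Injectivity of [p] is recorded
    because the roots of type B involve two distinct indices. *)
Lemma refl_signed i : exists (s : nat -> bool) (p : nat -> nat),
  forall j, (j <= n)%N ->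
    [/\ refl i (g j) = signed (s j) (g (p j)), (p j <= n)%N
      & forall k, (k <= n)%N -> p j = p k -> j = k].
Proof.
have [k hk ->] := c_onto i; move: hk; rewrite leq_eqVlt => /predU1P[->|hk].
  exists (fun j => j != n), id => j hj; split=> //.
  by rewrite refl_last //; case: eqP => [->|].
exists (fun=> true), (fun j => if j == k then k.+1 else if j == k.+1 then k else j).
move=> j hj; rewrite refl_mid //; split=> // [|l hl].
  by case: ifP => // _; case: ifP => // _; exact: ltnW.
by do ! case: eqP => ?; lia.
Qed.

Lemma refl_sign i s x : refl i (signed s x) = signed s (refl i x).
Proof. by case: s => //=; rewrite -scaleN1r (reflectionZ rD) scaleN1r. Qed.

Lemma fin_root_refl i x : fin_root D b x -> fin_root D b (refl i x).
Proof. by move=> [u [k ->]]; exists (i :: u), k. Qed.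

Lemma fin_root_simple i : fin_root D b (b i).
Proof. by exists [::], i. Qed.

Lemma fin_root_ind (P : hdual R n -> Prop) :
  (forall i, P (b i)) -> (forall i x, P x -> P (refl i x)) ->
  forall x, fin_root D b x -> P x.
Proof. by move=> Pb PR x [u [i ->]]; elim: u => [|k u IH] /=;
  [exact: Pb|exact: PR]. Qed.

Section TypeC.
Hypothesis kappaC : kappa = 2^-1.

Local Notation span := (nat_span b).

Lemma span_half_diff j k : (j <= k)%N -> (k <= n)%N -> span (2^-1 *: (g j - g k)).
Proof.
move=> jk kn; elim: k jk kn => [|k IH] jk kn.
  by move: jk; rewrite leqn0 => /eqP ->; rewrite subrr scaler0; exact: nat_span0.
move: jk; rewrite leq_eqVlt => /predU1P[->|jk].
  by rewrite subrr scaler0; exact: nat_span0.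
have -> : 2^-1 *: (g j - g k.+1) = 2^-1 *: (g j - g k) + b (c k).
  by rewrite b_mid // kappaC -scalerDr addrA subrK.
by apply: nat_spanD; [apply: IH; lia|exact: nat_span_simple].
Qed.

Lemma span_g k : (k <= n)%N -> span (g k).
Proof.
move=> kn; have -> : g k = 2^-1 *: (g k - g n) + 2^-1 *: (g k - g n) + b (c n).
  by rewrite b_last; apply/rowP => i; rewrite !mxE; field.
have H := span_half_diff kn (leqnn n).
by do ![apply: nat_spanD] => //; exact: nat_span_simple.
Qed.

Lemma span_half_signed s k : (k <= n)%N -> span (2^-1 *: (g 0%N - signed s (g k))).
Proof.
move=> kn; case: s; rewrite /signed; first exact: span_half_diff.
have -> : 2^-1 *: (g 0%N - - g k) = 2^-1 *: (g 0%N - g k) + g k.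
  by apply/rowP => i; rewrite !mxE; field.
by apply: nat_spanD; [exact: span_half_diff|exact: span_g].
Qed.

(** The vectors (+-g_j +- g_k) / 2 contain the simple roots and are stable under signed
    permutations, so they contain all roots; that 0 is among them is harmless for an upper bound.
    The difference from g_0 splits into (g_0 -+ g_j) / 2 and (g_0 -+ g_k) / 2, both in the cone.
    Being a root is carried from g_n down to g_0 by the reflections that exchange neighbours. *)
Lemma highest_root_C : highest_root D b (g 0%N).
Proof.
split.
  suff H m : (m <= n)%N -> fin_root D b (g (n - m)%N) by rewrite -(subnn n); exact: H.
  elim: m => [|m IH] hm; last first.
    have hm1 : (n - m = (n - m.+1).+1)%N by lia.
    have hk : (n - m.+1 < n)%N by lia.
    have := fin_root_refl (c (n - m.+1)%N) (IH (ltnW hm)).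
    by rewrite hm1 refl_mid ?eqxx //;
      have -> : ((n - m.+1).+1 == (n - m.+1)%N) = false by lia.
  by rewrite subn0 -b_last; exact: fin_root_simple.
have : forall x, fin_root D b x -> exists s t j k, [/\ (j <= n)%N, (k <= n)%N
    & x = 2^-1 *: signed s (g j) + 2^-1 *: signed t (g k)].
  apply: fin_root_ind => [i|i x [s [t [j [k [hj hk ->]]]]]].
    have [k hk ->] := c_onto i; move: hk; rewrite leq_eqVlt => /predU1P[->|hk].
      exists true, true, n, n; split=> //; rewrite b_last /signed.
      by apply/rowP => l; rewrite !mxE; field.
    by exists true, false, k, k.+1; split=> //;
      [exact: ltnW|rewrite b_mid // kappaC scalerBr scalerN].
  have [s' [p H]] := refl_signed i; have [Ej pj _] := H _ hj; have [Ek pk _] := H _ hk.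
  rewrite (reflectionD rD) !(reflectionZ rD) !refl_sign Ej Ek.
  have SS u v z : signed u (signed v z : hdual R n) = signed (u == v) z.
    by case: u v => -[] //=; rewrite opprK.
  by rewrite !SS; exists (s == s' j), (t == s' k), (p j), (p k).
move=> H x /H[s [t [j [k [hj hk ->]]]]].
have -> : g 0%N - (2^-1 *: signed s (g j) + 2^-1 *: signed t (g k))
   = 2^-1 *: (g 0%N - signed s (g j)) + 2^-1 *: (g 0%N - signed t (g k)).
  by apply/rowP => l; rewrite !mxE; field.
by apply: nat_spanD; exact: span_half_signed.
Qed.

End TypeC.

Section TypeB.
Hypotheses (kappaB : kappa = 1) (n0 : (0 < n)%N).

Local Notation span := (nat_span b).

Lemma b_mid1 k : (k < n)%N -> b (c k) = g k - g k.+1.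
Proof. by move=> hk; rewrite b_mid // kappaB scale1r. Qed.

Lemma span_diff j k : (j <= k)%N -> (k <= n)%N -> span (g j - g k).
Proof.
move=> jk kn; elim: k jk kn => [|k IH] jk kn.
  by move: jk; rewrite leqn0 => /eqP ->; rewrite subrr; exact: nat_span0.
move: jk; rewrite leq_eqVlt => /predU1P[->|jk].
  by rewrite subrr; exact: nat_span0.
have -> : g j - g k.+1 = (g j - g k) + b (c k) by rewrite b_mid1 // addrA subrK.
by apply: nat_spanD; [apply: IH; lia|exact: nat_span_simple].
Qed.

Lemma span_gB k : (k <= n)%N -> span (g k).
Proof.
move=> kn; have -> : g k = (g k - g n) + b (c n) by rewrite b_last subrK.
by apply: nat_spanD; [exact: span_diff|exact: nat_span_simple].
Qed.

Lemma span_signed s j k : (j <= k)%N -> (k <= n)%N -> span (g j - signed s (g k)).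
Proof.
move=> jk kn; case: s; rewrite /signed; first exact: span_diff.
by rewrite opprK; apply: nat_spanD; apply: span_gB => //; exact: leq_trans kn.
Qed.

(** All roots are among the +-g_j and the +-g_j +- g_k with j != k. The last reflection turns
    g_{n-1} - g_n into g_{n-1} + g_n, and the reflections k and k+1 then carry g_{k+1} + g_{k+2} to
    g_k + g_{k+1}. *)
Lemma highest_root_B : highest_root D b (g 0%N + g 1%N).
Proof.
split.
  suff H m : (m < n)%N -> fin_root D b (g (n.-1 - m)%N + g (n.-1 - m).+1).
    by have := H n.-1; rewrite subnn; apply; lia.
  elim: m => [|m IH] hm; first rewrite subn0.
    have := fin_root_refl (c n) (fin_root_simple (c n.-1)).
    have hn : (n.-1 < n)%N by lia.
    rewrite (b_mid1 hn) -(scaleN1r (g _)) (reflectionD rD) (reflectionZ rD) scaleN1r.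
    rewrite (prednK n0) (refl_last (leqnn n)) eqxx opprK (refl_last (ltnW hn)).
    by have -> : (n.-1 == n) = false by lia.
  have {IH} := IH (ltnW hm); set k := (n.-1 - m.+1)%N.
  have -> : (n.-1 - m = k.+1)%N by lia.
  have kn : (k.+1 < n)%N by lia.
  move=> /(fin_root_refl (c k)) /(fin_root_refl (c k.+1)).
  rewrite (reflectionD rD) !refl_mid ?(ltnW kn) //.
  have -> : (k.+1 == k) = false by lia.
  have -> : (k.+2 == k) = false by lia.
  have -> : (k.+2 == k.+1) = false by lia.
  rewrite eqxx (reflectionD rD) !refl_mid ?(ltnW kn) //; last by lia.
  have -> : (k == k.+1) = false by lia.
  have -> : (k == k.+2) = false by lia.
  have -> : (k.+2 == k.+1) = false by lia.
  by rewrite eqxx.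
have : forall x, fin_root D b x -> (exists s t j k, [/\ (j <= n)%N, (k <= n)%N, j != k
    & x = signed s (g j) + signed t (g k)])
      \/ exists s j, (j <= n)%N /\ x = signed s (g j).
  have SS u v z : signed u (signed v z : hdual R n) = signed (u == v) z.
    by case: u v => -[] //=; rewrite opprK.
  apply: fin_root_ind => [i|i x].
    have [k hk ->] := c_onto i; move: hk; rewrite leq_eqVlt => /predU1P[->|hk].
      by right; exists true, n; rewrite b_last.
    left; exists true, false, k, k.+1; split=> //; [exact: ltnW|by lia|exact: b_mid1].
  have [s' [p H]] := refl_signed i.
  move=> [[s [t [j [k [hj hk jk ->]]]]]|[s [j [hj ->]]]].
    have [Ej pj inj] := H _ hj; have [Ek pk _] := H _ hk.
    rewrite (reflectionD rD) !refl_sign Ej Ek !SS; left.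
    exists (s == s' j), (t == s' k), (p j), (p k); split=> //.
    by apply: contraNneq jk => /inj -> //.
  have [Ej pj _] := H _ hj; rewrite refl_sign Ej SS; right.
  by exists (s == s' j), (p j).
move=> H x /H{H}[[s [t [j [k [hj hk jk ->]]]]]|[s [j [hj ->]]]]; last first.
  rewrite addrAC; apply: nat_spanD; last exact: span_gB.
  exact: span_signed.
(* For j < k one has 0 <= j and 1 <= k, so g_0 can be compared with +-g_j and g_1 with +-g_k. *)
wlog lt_jk : s t j k hj hk jk / (j < k)%N.
  move=> W; case: (ltngtP j k) (jk) => // lt _; first exact: W.
  by rewrite [signed s _ + _]addrC; apply: W => //; rewrite eq_sym.
rewrite opprD addrACA; apply: nat_spanD; apply: span_signed => //.
by lia.
Qed.

End TypeB.

End OrthogonalCoordinates.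

(** * The translation by - theta in types A_1, C and D^(2) *)

(** The palindrome k, k+1, ..., k+m, ..., k+1, k. For k + m = n it represents the reflection in f_k,
    obtained from the last simple reflection by successive conjugations; for k = 0 this is
    s_theta. *)
Fixpoint chain_word (n : nat) (c : nat -> 'I_n.+1) (k m : nat) : seq 'I_n.+1 :=
  if m is m'.+1 then c k :: rcons (chain_word c k.+1 m') (c k) else [:: c k].

Lemma size_chain_word n (c : nat -> 'I_n.+1) k m :
  size (chain_word c k m) = m.*2.+1.
Proof. by elim: m k => [|m IH] k //=; rewrite size_rcons IH doubleS. Qed.

Lemma rev_chain_word n (c : nat -> 'I_n.+1) k m :
  rev (chain_word c k m) = chain_word c k m.
Proof. by elim: m k => [|m IH] k //=; rewrite rev_cons rev_rcons IH. Qed.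

(* Coordinates for the types A_1, C_l, D_{l+1}^(2): kappa = 1/2 in type C_l,  *)
(* kappa = 1 otherwise.                                                       *)
Record chain (R : realType) (n : nat) (D : affine_data R n)
    (c : nat -> 'I_n.+1) (f : nat -> hdual R n) (kappa : R) : Prop := {
  chain_fin : forall k, (k <= n)%N -> in_fin D (f k);
  chain_form : forall j k, (j <= n)%N -> (k <= n)%N ->
    form D (f j) (f k) = if j == k then 2 else 0;
  chain_gt0 : 0 < kappa;
  chain_mid : forall k, (k < n)%N -> simple D (fin (c k)) = kappa *: (f k - f k.+1);
  chain_last : simple D (fin (c n)) = f n;
  chain_zero : simple D ord0 = delta D - f 0%N;
  chain_onto : forall i, exists2 k, (k <= n)%N & i = c k
}.

Section Chain.
Variables (R : realType) (n : nat) (D : affine_data R n).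
Variables (c : nat -> 'I_n.+1) (f : nat -> hdual R n) (kappa : R).
Hypotheses (rD : affine_realization D) (hc : chain D c f kappa).
Local Notation V := (hdual R n).
Local Notation "'( x , y )" := (form D x y) (format "''(' x ,  y )").
Local Notation alpha := (simple D).
Implicit Types (x y z : V).

Let formE := (formE rD).

Let f_delta k : (k <= n)%N -> '(f k, delta D) = 0.
Proof. by move=> hk; exact/(form_fin_delta rD)/(chain_fin hc). Qed.

Let delta_f k : (k <= n)%N -> '(delta D, f k) = 0.
Proof. by move=> hk; rewrite formC // f_delta. Qed.

Lemma alpha0_f k : (k <= n)%N -> '(alpha ord0, f k) = if k == 0%N then -2 else 0.
Proof.
move=> hk; rewrite (chain_zero hc) !formE delta_f // (chain_form hc) // eq_sym.
by case: eqP => _; rewrite sub0r ?oppr0.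
Qed.

Lemma mid_f k j : (k < n)%N -> (j <= n)%N ->
  '(alpha (fin (c k)), f j)
    = kappa * ((if k == j then 2 else 0) - (if k.+1 == j then 2 else 0)).
Proof.
by move=> hk hj; rewrite (chain_mid hc) // !formE !(chain_form hc) // ltnW.
Qed.

Lemma mid_norm k : (k < n)%N ->
  '(alpha (fin (c k)), alpha (fin (c k))) = 4 * kappa ^+ 2.
Proof.
move=> hk; rewrite {2}(chain_mid hc) // !formE !mid_f // 1?ltnW //.
by rewrite !eqxx (gtn_eqF (ltnSn k)) (ltn_eqF (ltnSn k)); ring.
Qed.

Let kappa_neq0 : kappa != 0. Proof. by rewrite lt0r_neq0 // (chain_gt0 hc). Qed.

Let two_neq0 : 2 != 0 :> R. Proof. by rewrite pnatr_eq0. Qed.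

Lemma s_mid k j : (k < n)%N -> (j <= n)%N ->
  s_ D (fin (c k)) (f j) = f (if j == k then k.+1 else if j == k.+1 then k else j).
Proof.
exact: (refl_mid (b := fun i => alpha (fin i)) rD two_neq0 kappa_neq0
  (chain_form hc) (chain_mid hc)).
Qed.

Lemma s_last j : (j <= n)%N ->
  s_ D (fin (c n)) (f j) = if j == n then - f n else f j.
Proof.
exact: (refl_last (b := fun i => alpha (fin i)) rD two_neq0
  (chain_form hc) (chain_last hc)).
Qed.

Lemma alpha0_norm : '(alpha ord0, alpha ord0) = 2.
Proof.
rewrite {2}(chain_zero hc) (formBr rD) (form_simple_delta rD) alpha0_f //.
by rewrite sub0r opprK.
Qed.

Lemma s_zero j : (j <= n)%N ->
  s_ D ord0 (f j) = if j == 0%N then 2 *: delta D - f 0%N else f j.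
Proof.
move=> hj; case: (altP (j =P 0%N)) => [->|ne]; last first.
  by rewrite /s_ (reflection_orth rD) // (formC rD) alpha0_f // (negPf ne).
rewrite /s_ /reflection (form_coroot rD) alpha0_norm (formC rD) alpha0_f //=.
by rewrite (chain_zero hc); apply/rowP => i; rewrite !mxE; field.
Qed.

Lemma s_delta j : s_ D j (delta D) = delta D.
Proof. by rewrite /s_ (reflection_orth rD) // (formC rD) (form_simple_delta rD). Qed.

Lemma act_chain_word k m x : (k + m)%N = n ->
  act D (map (@fin n) (chain_word c k m)) x = reflection D (f k) x.
Proof.
elim: m k x => [|m IH] k x E /=.
  by move: E; rewrite addn0 => ->; rewrite /s_ (chain_last hc).
have hk : (k < n)%N by lia.
rewrite map_rcons /act -cats1 foldr_cat /= -/(act D _ _) IH; last by lia.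
have nf : '(f k.+1, f k.+1) != 0 by rewrite (chain_form hc) // eqxx pnatr_eq0.
rewrite /s_ (reflection_conj rD) ?lt0r_neq0 ?(simple_norm_gt0 rD) //.
  by have := s_mid hk hk; rewrite /s_ (gtn_eqF (ltnSn k)) eqxx => ->.
by rewrite (chain_form hc) ?eqxx.
Qed.

(** A word for s_theta s_0, the translation by -theta, as theta = f_0 by [chain_zero]. *)
Definition translation_word : seq 'I_n.+2 :=
  rcons (map (@fin n) (chain_word c 0 n)) ord0.

Lemma act_translation_word x :
  act D translation_word x = x - ('(x, delta D) - '(x, f 0%N)) *: delta D
    - '(x, delta D) *: f 0%N.
Proof.
rewrite /translation_word /act -cats1 foldr_cat /= -/(act D _ _) act_chain_word //.
have f0 : '(f 0%N, f 0%N) = 2 by rewrite (chain_form hc).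
rewrite /s_ /reflection !(form_coroot rD) alpha0_norm f0 (formBl rD)
  (formZl rD) alpha0_f //=.
have K a : 2 * a / 2 = a :> R by field.
rewrite !K (chain_zero hc) !(formBr rD); set d := '(x, delta D); set a := '(x, f 0%N).
by apply/rowP => i; rewrite !mxE; ring.
Qed.

Lemma f0_fin : in_fin D (f 0%N). Proof. exact: (chain_fin hc). Qed.

Lemma translation_word_represents :
  represents_translation D translation_word (- f 0%N).
Proof.
have dd := form_delta rD; split=> [x r hx|x hx].
  rewrite act_translation_word !(formDl rD, formZl rD, formNr rD) dd delta_f //.
  rewrite (form_fin_delta rD hx) !mulr0 !addr0.
  by apply/rowP => i; rewrite !mxE; ring.
exists ('(x, f 0%N) - 1); rewrite act_translation_word !(formDl rD).
rewrite (form_fin_delta rD hx) (form_Lambda0_delta rD) (formC rD (Lambda0 D)).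
rewrite (form_fin_Lambda0 rD f0_fin) add0r addr0.
by apply/rowP => i; rewrite !mxE; ring.
Qed.

(* The orbit of f_0 consists of the vectors +-f_k + 2 a delta. *)
Let state (e : bool) (k : nat) (a : int) : V :=
  (if e then f k else - f k) + (2 * a%:~R) *: delta D.

(* Applying a generator changes the position of a vector on the line          *)
(* ... f_0, -f_0 + 2 delta, ..., -f_n + 2 delta, f_n + 2 delta, ...,          *)
(* f_0 + 2 delta, ... by at most one step.                                    *)
Let position (e : bool) (k : nat) (a : int) : int :=
  if e then (2 * n.+1)%:Z * a - k%:Z else (2 * n.+1)%:Z * (a - 1) + k%:Z + 1.

Lemma s_D j x y : s_ D j (x + y) = s_ D j x + s_ D j y.
Proof. exact: (reflectionD rD). Qed.

Lemma s_Z j r x : s_ D j (r *: x) = r *: s_ D j x.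
Proof. exact: (reflectionZ rD). Qed.

Let sstate j e k a : s_ D j (state e k a) =
  (if e then s_ D j (f k) else - s_ D j (f k)) + (2 * a%:~R) *: delta D.
Proof. by rewrite /state s_D s_Z s_delta; case: e;
  rewrite // -scaleN1r s_Z scaleN1r. Qed.

Lemma state_step j e k a : (k <= n)%N -> exists e' k' a',
  [/\ (k' <= n)%N, s_ D j (state e k a) = state e' k' a'
    & `|position e' k' a' - position e k a|%R <= 1].
Proof.
move=> hk; rewrite sstate; have [i ->|->] := unliftP ord0 j; last first.
  rewrite s_zero //; case: (altP (k =P 0%N)) => [->|_]; last first.
    by exists e, k, a; rewrite subrr.
  exists (~~ e), 0%N, (if e then a + 1 else a - 1).
  split=> //; rewrite /state /position; case: e => /=; last by lia.
  - by rewrite rmorphD /=; apply/rowP => i; rewrite !mxE; ring.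
  - by rewrite rmorphB /=; apply/rowP => i; rewrite !mxE; ring.
  - by lia.
have [m hm ->] := chain_onto hc i; move: hm; rewrite leq_eqVlt => /predU1P[->|hm].
  rewrite s_last //; case: (altP (k =P n)) => [->|_]; last first.
    by exists e, k, a; rewrite subrr.
  exists (~~ e), n, a; split=> //; rewrite /state /position; case: e => /=.
  - by [].
  - by rewrite opprK.
  - by lia.
  - by lia.
rewrite s_mid //; exists e, (if k == m then m.+1 else if k == m.+1 then m else k), a.
split=> //; rewrite /position.
  by case: ifP => // _; case: ifP => // _; exact: ltnW.
by case: eqP => [->|_]; [|case: eqP => [->|_]]; case: e; lia.
Qed.

Lemma act_state v : exists e k a,
  [/\ (k <= n)%N, act D v (f 0%N) = state e k a
    & `|position e k a|%R <= (size v)%:Z].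
Proof.
elim: v => [|j v [e [k [a [hk E P]]]]] /=.
  exists true, 0%N, 0; split=> //; last by rewrite /position; lia.
  by rewrite /state mulr0 scale0r addr0.
rewrite -/(act D v (f 0%N)) E.
have [e' [k' [a' [hk' -> P']]]] := state_step j e a hk.
by exists e', k', a'; split=> //; lia.
Qed.

(** The translation sends f_0, at position 0, to f_0 + 2 delta, at position 2 (n + 1). A letter
    moves the position by at most one, so every word with this action has at least 2 (n + 1)
    letters, the size of [translation_word]. The form with f_0 and the coefficient of delta identify
    the final state. *)
Lemma translation_word_reduced : reduced D translation_word.
Proof.
move=> v /(_ (f 0%N)); have [e [k [a [hk -> P]]]] := act_state v.
rewrite act_translation_word f_delta // (chain_form hc) //= scale0r subr0 sub0r.
rewrite scaleNr opprK /state => E.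
have E0 : '(if e then f k else - f k, f 0%N) = 2.
  have := congr1 (fun x => '(x, f 0%N)) E.
  by rewrite !(formDl rD) !(formZl rD) delta_f // !mulr0 !addr0 (chain_form hc).
have k0 : k = 0%N /\ e = true.
  case: e E0 {E P} => /=; rewrite ?(formNl rD) (chain_form hc) //;
    by case: eqP => [->|_] H; split=> //; exfalso; lra.
move: E P; case: k0 => -> ->; rewrite /position => /addrI.
move=> /eqP; rewrite -subr_eq0 -scalerBl => /eqP E.
have [] := in_fin_delta rD (in_finZ 0 f0_fin) (r := 2 * a%:~R - 2 : R).
  by rewrite scale0r add0r.
move=> _ /eqP; rewrite -{2}[2]mulr1 -mulrBr mulf_eq0 pnatr_eq0 /= subr_eq0.
rewrite -[1]/(1%:~R) eqr_int => /eqP ->.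
by rewrite /translation_word size_rcons size_map size_chain_word; lia.
Qed.

Lemma f0_antidominant : antidominant D (- f 0%N).
Proof.
move=> i; rewrite (form_coroot rD) (formNl rD) mulrN mulNr oppr_le0.
apply: divr_ge0; last exact/ltW/(simple_norm_gt0 rD).
rewrite mulr_ge0 // (formC rD).
have [m hm ->] := chain_onto hc i; move: hm; rewrite leq_eqVlt => /predU1P[->|hm].
  by rewrite (chain_last hc) (chain_form hc) //; case: ifP.
by rewrite mid_f // subr0 mulr_ge0 ?(ltW (chain_gt0 hc)) //; case: ifP.
Qed.

Lemma Y_chain (Y : V -> daag D) : translation_elements Y -> in_M D (f 0%N) ->
  Y (- f 0%N) = (Tword D (map (@fin n) (chain_word c 0 n)) * T_ D ord0)%g.
Proof.
move=> hY hM; rewrite (hY.2 _ _ (in_MN hM) f0_antidominant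
  translation_word_represents translation_word_reduced).
by rewrite /Tword /translation_word big_rcons.
Qed.

End Chain.

(** * Images of the Hecke relations *)

Section HeckeMorphism.
Variables (R : realType) (n : nat) (D D' : affine_data R n).
Variables (Y : hdual R n -> daag D) (Y' : hdual R n -> daag D').
Variables (phi : {multiplicative daag D -> daag D'}).
Variables (s : {rmorphism scalars D -> scalars D'}) (r : R).
Hypotheses (rD : affine_realization D) (rD' : affine_realization D').
Hypotheses (hY : translation_elements Y) (hY' : translation_elements Y').
Hypotheses (hphi : phi_group_spec Y Y' phi) (hs : phi_scalar_spec s).
Hypothesis rE : Num.sqrt (p_ D) = r.
Hypotheses (AE : forall i, A_ D' i = r *: simple D (fin i))
           (simpleE : forall i, simple D' (fin i) = r^-1 *: A_ D i).
Implicit Type i : 'I_n.+1.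

Local Notation quadD' := (quad (hecke_rel Y')).
Local Notation fins := (map (@fin n)).

Lemma ideal_gen (F : fieldType) (A : algType F) (S : A -> Prop) x :
  S x -> two_sided_ideal S x.
Proof.
move=> Sx; have -> : x = 1 * x * 1 + 0 by rewrite mul1r mulr1 addr0.
by apply: IdealD Sx _; exact: Ideal0.
Qed.

(** Serves the relation X_delta = q^-1, whose image concerns the inverses of both sides. *)
Lemma ideal_inv (F : fieldType) (A : algType F) (S : A -> Prop) a b (q : F) :
  b * a = 1 -> q != 0 -> two_sided_ideal S (a - q^-1%:A) ->
  two_sided_ideal S (b - q%:A).
Proof.
move=> ba q0 /(ideal_predM (- q *: b) 1); rewrite mulr1 mulrBr -!scalerAl ba.
by rewrite -scalerAr mulr1 scalerA mulNr mulfV // scaleN1r opprK scaleNr addrC.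
Qed.

Lemma indet_neq0 (E : affine_data R n) k : indet E k != 0.
Proof. by rewrite tofrac_eq0 -mpoly.msupp_eq0 mpoly.msuppX. Qed.

Section Relations.
Variables (E : affine_data R n) (Z : hdual R n -> daag E).
Hypotheses (rE' : affine_realization E) (hZ : translation_elements Z).
Local Open Scope group_scope.

Lemma hecke_TE i : hecke_rel Z (quad_elt (T_ E (fin i)) (t_root E (fin i))).
Proof. exact: Hecke_T. Qed.

Lemma quad_elt_Y i :
  quad_elt (Z (- A_ E i)%R * (T_ E (fin i))^-1) (t_root E (fin i))
  = (ga_elt (scalars E) (Z (- A_ E i)%R * (T_ E (fin i))^-1 : daag E)
    - ga_elt (scalars E) (T_ E (fin i) * Z (A_ E i) : daag E)
    - (t_root E (fin i) - (t_root E (fin i))^-1)%:A)%R.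
Proof. by rewrite /quad_elt invgM invgK (Y_N hZ (in_M_A _ _)) invgK. Qed.

Lemma quad_elt_X j :
  quad_elt ((T_ E j)^-1 * X_ E (simple E j)) (t_root E j)
  = (ga_elt (scalars E) ((T_ E j)^-1 * X_ E (simple E j) : daag E)
    - ga_elt (scalars E) (X_ E (- simple E j)%R * T_ E j : daag E)
    - (t_root E j - (t_root E j)^-1)%:A)%R.
Proof. by rewrite /quad_elt invgM invgK (X_simpleN rE'). Qed.

Lemma quad_T i : quad (hecke_rel Z) (T_ E (fin i)) (t_root E (fin i)).
Proof. exact/ideal_gen/hecke_TE. Qed.

Lemma quad_Y i :
  quad (hecke_rel Z) (Z (- A_ E i)%R * (T_ E (fin i))^-1) (t_root E (fin i)).
Proof. by apply: ideal_gen; rewrite quad_elt_Y; exact: Hecke_Y. Qed.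

Lemma quad_X j :
  quad (hecke_rel Z) ((T_ E j)^-1 * X_ E (simple E j)) (t_root E j).
Proof. by apply: ideal_gen; rewrite quad_elt_X; exact: Hecke_X. Qed.

End Relations.

Local Open Scope group_scope.

Lemma phi_T i : phi (T_ D (fin i)) = (T_ D' (fin i))^-1.
Proof. by case: hphi. Qed.

Lemma phi_Y mu : in_M D mu -> phi (Y mu) = X_ D' (r^-1 *: mu)%R.
Proof. by case: hphi => _ + _ _ => /[apply]; rewrite rE. Qed.

Lemma phi_X b : in_Qo D b -> phi (X_ D b) = Y' (r *: b)%R.
Proof. by case: hphi => _ _ + _ => /[apply]; rewrite rE. Qed.

Lemma phi_delta : phi (X_ D (delta D)) = (X_ D' (delta D'))^-1.
Proof. by case: hphi => _ _ _ ->; rewrite (X_deltaNE rD'). Qed.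

Lemma s_t i : s (t_root D (fin i)) = (t_root D' (fin i))^-1%R.
Proof. by case: hs. Qed.

Lemma phi_Tword u : phi (Tword D (fins u)) = (Tword D' (fins (rev u)))^-1.
Proof.
rewrite /Tword multiplicative_prod !big_map; elim: u => [|i u IH];
  first by rewrite !big_nil invg1.
by rewrite big_cons IH phi_T rev_cons big_rcons invgM.
Qed.

Lemma img_T i : quadD' (phi (T_ D (fin i))) (s (t_root D (fin i))).
Proof. by rewrite phi_T s_t; apply/quadV/quad_T. Qed.

Lemma img_Y i : quadD' (phi (Y (- A_ D i)%R * (T_ D (fin i))^-1)) (s (t_root D
  (fin i))).
Proof.
rewrite gmulfM multiplicativeV phi_T phi_Y ?in_MN ?in_M_A // scalerN -simpleE invgK s_t.
by rewrite (X_simpleN rD') -[T_ _ _]invgK -invgM; apply/quadV/quad_X.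
Qed.

Lemma img_X i : quadD' (phi ((T_ D (fin i))^-1 * X_ D (simple D (fin i))))
  (s (t_root D (fin i))).
Proof.
rewrite gmulfM multiplicativeV phi_T phi_X ?in_Qo_simple // -AE s_t invgK.
rewrite -[A_ D' i]opprK (Y_N hY') ?in_MN ?in_M_A // -[T_ _ _]invgK -invgM.
exact/quadV/quad_Y.
Qed.

Lemma img_conj (g v : daag D) z : quadD' (phi v) z -> quadD' (phi (g * v * g^-1)) z.
Proof. by rewrite !gmulfM multiplicativeV; exact: quad_conj. Qed.

(** The semilinear map descends once the generators of the ideal are sent into the ideal. The vertex
    0 is left as a hypothesis, since its treatment depends on the type. *)
Lemma hecke_morphism :
  quadD' (phi ((T_ D ord0)^-1 * X_ D (simple D ord0))) (s (t_root D ord0)) ->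
  exists Phi : {rmorphism daha Y -> daha Y'}, phi_algebra_spec phi s Phi.
Proof.
move=> h0; suff hS x : hecke_rel Y x -> two_sided_ideal (hecke_rel Y') (ga_map s phi x).
  have [Phi PhiE] := ex_quot_lift hS; exists Phi; split=> [c u|g].
    elim/alg_classW: u => x; rewrite [_ *: _]aq_scaleE !PhiE /= ga_mapZ.
    by rewrite [RHS]aq_scaleE.
  by rewrite /hecke_elt PhiE /= ga_map_elt.
case=> [i|i|j|].
- by rewrite -/(quad_elt _ _) ga_map_quad; exact: img_T.
- by rewrite -(quad_elt_Y hY i) ga_map_quad; exact: img_Y.
- rewrite -(quad_elt_X rD j) ga_map_quad; have [i ->|->] := unliftP ord0 j; last by [].
  exact: img_X.
rewrite raddfB /= ga_map_elt ga_mapZ rmorph1 phi_delta fmorphV.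
have [_ _ _ _ ->] := hs; rewrite invrK.
have q0 : (q_ D' != 0)%R by rewrite expf_neq0 ?indet_neq0.
have hX : (ga_elt (scalars D') ((X_ D' (delta D'))^-1 : daag D')
   * ga_elt (scalars D') (X_ D' (delta D') : daag D') = 1)%R.
  by rewrite -ga_eltM mulVg.
exact: (ideal_inv hX q0 (ideal_gen (Hecke_q Y'))).
Qed.

(** The element is conjugate to T_0 and then to T_i, whose image is known; equality of d_0 and d_i
    makes the two parameters equal. *)
Lemma h0_edge i : form D (simple D ord0) (coroot D (simple D (fin i))) = (-1)%R ->
  form D (simple D (fin i)) (coroot D (simple D ord0)) = (-1)%R ->
  d_ D ord0 = d_ D (fin i) ->
  quadD' (phi ((T_ D ord0)^-1 * X_ D (simple D ord0))) (s (t_root D ord0)).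
Proof.
move=> e1 e2 dE; have -> : t_root D ord0 = t_root D (fin i) by rewrite /t_root dE.
rewrite (TX0_conj rD (in_Qo_simple _ i) e2); apply: img_conj.
by rewrite (edge_conj rD e1 e2); apply: img_conj; exact: img_T.
Qed.

Section ChainNode.
Variables (u : seq 'I_n.+1) (th : hdual R n).
Hypotheses (revu : rev u = u) (thE : (delta D - simple D ord0 = th)%R).
Hypotheses (Mth : in_M D th) (YE : Y (- th)%R = Tword D (fins u) * T_ D ord0).

(** T_0 = T_{s_theta}^-1 Y_{-theta}. As phi inverts each T_i it reverses words up to inversion, and
    the word [u] of s_theta is a palindrome. *)
Lemma phi_T0 : phi (T_ D ord0) = Tword D' (fins u) * X_ D' (- (r^-1 *: th))%R.
Proof.
have -> : T_ D ord0 = (Tword D (fins u))^-1 * Y (- th)%R by rewrite YE mulKg.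
by rewrite gmulfM multiplicativeV phi_Tword revu invgK phi_Y ?in_MN // scalerN.
Qed.

(** In the image, Y_{-theta} = T_{s_theta} T_0 cancels the T_{s_theta}^-1 coming from phi(T_0); what
    remains is X_theta T_0 X_delta^-1, the inverse of T_0^-1 X_{alpha_0}. *)
Lemma h0_chain1 : r = 1%R -> delta D' = delta D ->
  simple D' ord0 = simple D ord0 ->
  Y' (- th)%R = Tword D' (fins u) * T_ D' ord0 ->
  s (t_root D ord0) = (t_root D' ord0)^-1%R ->
  quadD' (phi ((T_ D ord0)^-1 * X_ D (simple D ord0))) (s (t_root D ord0)).
Proof.
move=> r1 dE a0E Y'E sE; have hth : in_Qo D th by rewrite -thE theta_in_Qo.
have hth' : in_Qo D' th by rewrite -thE -dE -a0E theta_in_Qo.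
suff -> : phi ((T_ D ord0)^-1 * X_ D (simple D ord0)) =
    ((T_ D' ord0)^-1 * X_ D' (simple D' ord0))^-1.
  by rewrite sE; apply/quadV/quad_X.
rewrite (X_simple0 rD) thE -(X_N hth) !gmulfM multiplicativeV phi_T0.
rewrite phi_X ?in_QoN // phi_delta (X_simple0 rD') a0E dE thE.
rewrite r1 invr1 !scale1r Y'E (X_N hth') !invgM !invgK !mulgA mulgVK -dE
  -[_ * _ * T_ _ _ in RHS]mulgA.
have C := X_delta_comm rD'.
apply: (mulgI (X_ D' (delta D'))); rewrite [RHS]mulVKg mulgA.
by rewrite C mulgK.
Qed.

End ChainNode.

Section ChainNode2.
Variables (c : nat -> 'I_n.+1) (f : nat -> hdual R n).

(** T_k X_{-f_k} T_k = X_{-f_{k+1}} replaces the right outer letter by T_k^-1 at the far end: the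
    outer pair becomes a conjugation, and k increases by one. *)
Lemma chain_word_X k m : (k + m)%N = n ->
  (forall j, (j <= n)%N -> in_Qo D' (- f j)%R) ->
  (forall j, (j < n)%N -> form D' (- f j)%R (coroot D' (simple D' (fin (c j)))) =
    (-1)%R) ->
  (forall j, (j < n)%N -> (- f j + simple D' (fin (c j)) = - f j.+1)%R) ->
  exists g, Tword D' (fins (chain_word c k m)) * X_ D' (- f k)%R
     = g * (T_ D' (fin (c n)) * X_ D' (- f n)%R) * g^-1.
Proof.
move=> + hQ hf hs'; elim: m k => [|m IH] k E /=.
  move: E; rewrite addn0 => ->; exists 1.
  by rewrite /Tword big_seq1 mul1g invg1 mulg1.
have hk : (k < n)%N by lia.
have [|g gE] := IH k.+1; first by lia.
exists (T_ D' (fin (c k)) * g); rewrite /Tword /= big_cons map_rcons big_rcons /=.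
have := T_X1 (hQ _ (ltnW hk)) (hf _ hk); rewrite hs' // => TX.
have -> : T_ D' (fin (c k)) * (Tword D' (fins (chain_word c k.+1 m)) * T_ D' (fin
  (c k)))
    * X_ D' (- f k)%R = T_ D' (fin (c k)) *
    (Tword D' (fins (chain_word c k.+1 m)) * X_ D' (- f k.+1)%R) * (T_ D' (fin
      (c k)))^-1.
  by rewrite -TX !mulgA mulgK.
by rewrite gE invgM !mulgA.
Qed.

End ChainNode2.

Lemma in_M_Qo x : in_M D x -> in_Qo D' (r^-1 *: x)%R.
Proof.
move=> /in_MP[c ->]; apply/in_QoP; exists c.
rewrite scaler_sumr; apply: eq_bigr => i _; rewrite simpleE.
by rewrite -[in RHS]scaler_int scalerA mulrC -scalerA scaler_int.
Qed.

(** The f_k lie in M, and in the orthonormal vectors f_k / r the simple roots of the other side have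
    type B. After reduction to T_0, the image T_{s_theta} X_{-f_0 / r} is conjugate to T_n
    X_{-alpha_n}, and so, up to inversion, to T_n^-1 X_{alpha_n}. The parameters agree because
    alpha_0 and alpha_n both have square length 2. *)
Lemma h0_chain2 (c : nat -> 'I_n.+1) (f : nat -> hdual R n) :
  chain D c f 2^-1%R -> (0 < n)%N -> (r * r = 2)%R -> form D' = form D ->
  quadD' (phi ((T_ D ord0)^-1 * X_ D (simple D ord0))) (s (t_root D ord0)).
Proof.
move=> hc n0 r2 formE'; have fE := chain_form hc.
have norm0 : form D (simple D ord0) (simple D ord0) = 2%R := alpha0_norm rD hc.
(* These simple roots have square length 1, so e = 2 cancels the factor 1/2. *)
have eM k : (k < n)%N -> A_ D (c k) = (f k - f k.+1)%R.
  move=> hk; rewrite /A_ /e_ /d_ (mid_norm rD hc hk) (chain_mid hc hk) scalerA.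
  have -> : (2 / (4 * 2^-1 ^+ 2) = 2 :> R)%R by field.
  by rewrite max_r ?ler1n // divff ?pnatr_eq0 // scale1r.
have eL : A_ D (c n) = f n.
  by rewrite /A_ /e_ /d_ (chain_last hc) fE // eqxx divff ?pnatr_eq0 // maxxx scale1r.
have fM k : (k <= n)%N -> in_M D (f k).
  move=> hk; rewrite -(subKn hk); elim: (n - k)%N (leq_subr k n) => [|m IH] hm.
    by rewrite subn0 -eL in_M_A.
  have hm1 : (n - m = (n - m.+1).+1)%N by lia.
  have := eM (n - m.+1)%N; rewrite -hm1 => /(_ _) E.
  have -> : f (n - m.+1)%N = (A_ D (c (n - m.+1)%N) + f (n - m)%N)%R.
    by rewrite E ?subrK //; lia.
  by apply: in_MD; [exact: in_M_A|apply: IH; lia].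
pose f' k := (r^-1 *: f k)%R.
have sM k : (k < n)%N -> simple D' (fin (c k)) = (f' k - f' k.+1)%R.
  by move=> hk; rewrite simpleE eM // scalerBr.
have sL : simple D' (fin (c n)) = f' n by rewrite simpleE eL.
have rr : (r^-1 * r^-1 = 2^-1)%R by rewrite -invfM r2.
have fE' j k : (j <= n)%N -> (k <= n)%N ->
  form D' (f' j) (f' k) = (if j == k then 1 else 0)%R.
  move=> hj hk; rewrite formE' (formZl rD) (formZr rD) fE // mulrA rr.
  by case: eqP => _; rewrite ?mulr0 ?mulVf ?pnatr_eq0.
have [g gE] : exists g, Tword D' (fins (chain_word c 0 n)) * X_ D' (- f' 0%N)%R
     = g * (T_ D' (fin (c n)) * X_ D' (- f' n)%R) * g^-1.
  apply: chain_word_X => // [j hj|j hj|j hj].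
  - exact/(in_QoN)/in_M_Qo/fM.
  - rewrite (form_coroot rD') sM // !(formBr rD') !(formBl rD') !(formNl rD').
    have jS : (j == j.+1) = false by lia.
    have Sj : (j.+1 == j) = false by lia.
    by rewrite !fE' ?(ltnW hj) // ?eqxx ?jS ?Sj; field.
  - by rewrite sM // addrA addNr add0r.
have -> : t_root D ord0 = t_root D (fin (c n)).
  by rewrite /t_root /d_ norm0 (chain_last hc) fE // eqxx.
(* The opposite pairing is -2, so this is not a simple edge, but [TX0_conj] asks for this pairing
   only. *)
have e2 : form D (simple D (fin (c 0%N))) (coroot D (simple D ord0)) = (-1)%R.
  rewrite (form_coroot rD) norm0 (formC rD) (chain_mid hc n0).
  by rewrite (formZr rD) (formBr rD) !(alpha0_f rD hc) //=; field.
rewrite (TX0_conj rD (in_Qo_simple _ _) e2); apply: img_conj.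
have thE : (delta D - simple D ord0 = f 0%N)%R by rewrite (chain_zero hc) subKr.
rewrite (phi_T0 (rev_chain_word _ _ _) (fM _ _) (Y_chain rD hc hY (fM _ _))) //.
rewrite -/(f' 0%N) gE; apply: quad_conj; rewrite -sL (X_simpleN rD') s_t.
by rewrite -[T_ _ _]invgK -invgM; apply/quadV/quad_conjM/quad_X.
Qed.

End HeckeMorphism.

(** * Numerical labels *)

Definition kac_label (X : affine_type) (j : nat) : nat :=
  match X with
  | Aff_B _ => if (j <= 1)%N then 1%N else 2%N
  | Aff_C l => if (j == 0)%N || (j == l) then 1%N else 2%N
  | Aff_D l => if (j <= 1)%N || (l.-1 <= j)%N then 1%N else 2%N
  | Aff_E6 => nth 0%N [:: 1; 1; 2; 3; 2; 1; 2]%N j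
  | Aff_E7 => nth 0%N [:: 1; 2; 3; 4; 3; 2; 1; 2]%N j
  | Aff_E8 => nth 0%N [:: 1; 2; 3; 4; 5; 6; 4; 2; 3]%N j
  | Aff_F4 => nth 0%N [:: 1; 2; 3; 4; 2]%N j
  | Aff_G2 => nth 0%N [:: 1; 2; 3]%N j
  | Aff_A2odd l => if (j <= 1)%N || (j == l) then 1%N else 2%N
  | Aff_E6_2 => nth 0%N [:: 1; 2; 3; 2; 1]%N j
  | Aff_D4_3 => nth 0%N [:: 1; 2; 1]%N j
  | _ => 1%N
  end.

Definition kac_dual (X : affine_type) : affine_type :=
  match X with
  | Aff_B l => Aff_A2odd l | Aff_A2odd l => Aff_B l
  | Aff_C l => Aff_D2 l | Aff_D2 l => Aff_C l
  | Aff_F4 => Aff_E6_2 | Aff_E6_2 => Aff_F4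
  | Aff_G2 => Aff_D4_3 | Aff_D4_3 => Aff_G2
  | _ => X
  end.

Lemma kac_dualP X : ~~ is_A2even X ->
  [/\ ~~ is_A2even (kac_dual X), kac_admissible (kac_dual X) = kac_admissible X
    & kac_rank (kac_dual X) = kac_rank X].
Proof. by case: X. Qed.

Lemma kac_dual_entry X j k : ~~ is_A2even X ->
  kac_entry (kac_dual X) j k = kac_entry X k j.
Proof.
move=> hX; rewrite /kac_entry [k == j]eq_sym minnC maxnC; case: ifP => // _.
case: X hX => [l|l|l|l|||||||l|l||] //= _; case: ifP => // edge; congr (- Posz _).
all: rewrite ?xpair_eqE; try by repeat case: ifP => ?; lia.
Qed.

Lemma sum_support (N : nat) (F : nat -> int) (s : seq nat) :
  uniq s -> all (fun k => k < N)%N s ->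
  (forall k, (k < N)%N -> k \notin s -> F k = 0) ->
  \sum_(k < N) F k = \sum_(k <- s) F k.
Proof.
move=> us /allP hs F0; rewrite -(big_mkord xpredT) /index_iota subn0.
rewrite (bigID (mem s)) /= [X in _ + X]big1_seq ?addr0; last first.
  by move=> k /andP[ks]; rewrite mem_iota => /andP[_ kN]; exact: F0.
rewrite -big_filter; apply: perm_big; apply: uniq_perm => //.
  by rewrite filter_uniq // iota_uniq.
move=> k; rewrite mem_filter mem_iota /= add0n.
by case ks: (k \in s) => //=; exact: hs.
Qed.

Lemma kac_row X j N (s : seq nat) :
  uniq s -> all (fun k => k < N)%N s ->
  (forall k, (k < N)%N -> k \notin s -> kac_entry X j k = 0) ->
  \sum_(k < N) kac_entry X j k * (kac_label X k)%:Z
    = \sum_(k <- s) kac_entry X j k * (kac_label X k)%:Z.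
Proof.
move=> us hs h0; apply: (sum_support (F := fun k => _ * _)) us hs _ => k hk ks.
by rewrite h0 // mul0r.
Qed.

(** [s] lists the vertex j and its neighbours; the other entries of row j vanish and the short sum
    is evaluated by cases. *)
Ltac row s := rewrite (@kac_row _ _ _ s);
  [rewrite !(big_cons, big_nil) /kac_entry /kac_label /kac_mult ?xpair_eqE /=;
    repeat (case: ifP => ?; try (exfalso; lia)); try lia
  | rewrite /= ?inE; lia | rewrite /=; lia
  | move=> k hk; rewrite !inE => ks; rewrite /kac_entry;
    case: ifP => ?; [exfalso; lia|]; rewrite /kac_edge; case: ifP => ?; [exfalso;
      lia|]; by []].

Lemma kac_null_A l j : (0 < l)%N -> (j <= l)%N ->
  \sum_(k < l.+1) kac_entry (Aff_A l) j k * (kac_label (Aff_A l) k)%:Z = 0.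
Proof.
move=> l0 hj; have [l1|l2] : l = 1%N \/ (2 <= l)%N by lia.
  by row [:: 0; 1]%N.
have [j0|[jl|[j0 jl]]] : j = 0%N \/ j = l \/ (0 < j)%N /\ (j < l)%N by lia.
- by row [:: 0; 1; l]%N.
- by row [:: 0; l.-1; l]%N.
- by row [:: j.-1; j; j.+1]%N.
Qed.

Lemma kac_null_B l j : (3 <= l)%N -> (j <= l)%N ->
  \sum_(k < l.+1) kac_entry (Aff_B l) j k * (kac_label (Aff_B l) k)%:Z = 0.
Proof.
move=> l3 hj.
have [j0|[j1|[j2|[jl|[j3 jl]]]]] : j = 0%N \/ j = 1%N \/ j = 2%N \/ j = l
  \/ (3 <= j)%N /\ (j < l)%N by lia.
- by row [:: 0; 2]%N.
- by row [:: 1; 2]%N.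
- by row [:: 0; 1; 2; 3]%N.
- by row [:: l.-1; l]%N.
- by row [:: j.-1; j; j.+1]%N.
Qed.

Lemma kac_null_C l j : (2 <= l)%N -> (j <= l)%N ->
  \sum_(k < l.+1) kac_entry (Aff_C l) j k * (kac_label (Aff_C l) k)%:Z = 0.
Proof.
move=> l2 hj.
have [j0|[jl|[j1 jl]]] : j = 0%N \/ j = l \/ (1 <= j)%N /\ (j < l)%N by lia.
- by row [:: 0; 1]%N.
- by row [:: l.-1; l]%N.
- by row [:: j.-1; j; j.+1]%N.
Qed.

Lemma kac_null_D l j : (4 <= l)%N -> (j <= l)%N ->
  \sum_(k < l.+1) kac_entry (Aff_D l) j k * (kac_label (Aff_D l) k)%:Z = 0.
Proof.
move=> l4 hj.
have [j0|[j1|[jl|[jl1|[[l4' j2]|[[l5 j2]|[[l5 jl2]|[j3 jl2]]]]]]]] : j = 0%N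
  \/ j = 1%N \/ j = l
  \/ j = l.-1 \/ (l = 4%N /\ j = 2%N) \/ ((5 <= l)%N /\ j = 2%N)
    \/ ((5 <= l)%N /\ j = l.-2)
  \/ (3 <= j)%N /\ (j < l.-2)%N by lia.
- by row [:: 0; 2]%N.
- by row [:: 1; 2]%N.
- by row [:: l.-2; l]%N.
- by row [:: l.-2; l.-1]%N.
- by row [:: 0; 1; 2; 3; 4]%N.
- by row [:: 0; 1; 2; 3]%N.
- by row [:: l.-2.-1; l.-2; l.-1; l]%N.
- by row [:: j.-1; j; j.+1]%N.
Qed.

Lemma kac_null_A2odd l j : (3 <= l)%N -> (j <= l)%N ->
  \sum_(k < l.+1) kac_entry (Aff_A2odd l) j k * (kac_label (Aff_A2odd l) k)%:Z = 0.
Proof.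
move=> l3 hj.
have [j0|[j1|[j2|[jl|[j3 jl]]]]] : j = 0%N \/ j = 1%N \/ j = 2%N \/ j = l
  \/ (3 <= j)%N /\ (j < l)%N by lia.
- by row [:: 0; 2]%N.
- by row [:: 1; 2]%N.
- by row [:: 0; 1; 2; 3]%N.
- by row [:: l.-1; l]%N.
- by row [:: j.-1; j; j.+1]%N.
Qed.

Lemma kac_null_D2 l j : (2 <= l)%N -> (j <= l)%N ->
  \sum_(k < l.+1) kac_entry (Aff_D2 l) j k * (kac_label (Aff_D2 l) k)%:Z = 0.
Proof.
move=> l2 hj.
have [j0|[jl|[j1 jl]]] : j = 0%N \/ j = l \/ (1 <= j)%N /\ (j < l)%N by lia.
- by row [:: 0; 1]%N.
- by row [:: l.-1; l]%N.
- by row [:: j.-1; j; j.+1]%N.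
Qed.

Lemma kac_null X j : ~~ is_A2even X -> kac_admissible X -> (j <= kac_rank X)%N ->
  \sum_(k < (kac_rank X).+1) kac_entry X j k * (kac_label X k)%:Z = 0.
Proof.
case: X => [l|l|l|l|||||||l|l||] //= _; [exact: kac_null_A|exact: kac_null_B
  |exact: kac_null_C|exact: kac_null_D|..|exact: kac_null_A2odd|exact: kac_null_D2| |].
all: move=> _; rewrite !big_ord_recr big_ord0 /=.
all: by do 9?[case: j => [|j] //=].
Qed.

Lemma kac_label_gt0 X j : (j <= kac_rank X)%N -> (0 < kac_label X j)%N.
Proof.
case: X => [l|l|l|l|||||||l|l||] //=; try by (case: ifP).
all: by do 9?[case: j => [|j] //=].
Qed.

Lemma kac_label0 X : kac_label X 0 = 1%N.
Proof. by case: X. Qed.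

(** Divided by a_j a_k, this is the symmetry of d_j^-1 a_jk, that is, of the bilinear form. *)
Lemma kac_symmetrizable X j k : ~~ is_A2even X -> kac_admissible X ->
  (j <= kac_rank X)%N -> (k <= kac_rank X)%N ->
  kac_entry X j k * (kac_label (kac_dual X) j)%:Z * (kac_label X k)%:Z
  = kac_entry X k j * (kac_label (kac_dual X) k)%:Z * (kac_label X j)%:Z.
Proof.
move=> hX hA hj hk; rewrite /kac_entry [k == j]eq_sym minnC maxnC.
case: eqP => [->//|ne]; case: ifP => [edge|_]; last by rewrite !mul0r.
case: X hX hA hj hk edge => [l|l|l|l|||||||l|l||] //=.
all: rewrite ?xpair_eqE.
all: try by move=> _ hA hj hk edge; repeat (case: ifP => ? /=; try (exfalso; lia)); lia.
all: move=> _ _; do 9?[case: j ne => [|j] ne //=]; do 9?[case: k ne => [|k] ne //=].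
Qed.

Section NullVector.
Variables (n : nat) (A : 'M[int]_n.+2).
Hypotheses (gA : generalized_cartan A) (iA : indecomposable A).

(* The ratio v_j / u_j is constant: the set where it is minimal is a union of *)
(* components of the diagram.                                                 *)
Lemma null_vector_unique (K : realFieldType) (u v : 'I_n.+2 -> K) :
  (forall j, 0 < u j) -> (forall j, \sum_k (A j k)%:~R * u k = 0) ->
  (forall j, \sum_k (A j k)%:~R * v k = 0) -> exists c, forall j, v j = c * u j.
Proof.
move=> u0 Au Av; case: (@arg_minP _ _ _ ord0 xpredT
  (fun j => v j / u j) isT) => j0 _ minj.
pose c := v j0 / u j0; pose w j := v j - c * u j.
have w0 j : 0 <= w j by rewrite /w subr_ge0 -ler_pdivlMr // minj.
have Aw j : \sum_k (A j k)%:~R * w k = 0.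
  rewrite (eq_bigr (fun k => (A j k)%:~R * v k - c * ((A j k)%:~R * u k))).
    by rewrite sumrB Av -mulr_sumr Au mulr0 subr0.
  by move=> k _; rewrite /w mulrBr mulrCA.
pose S : {set 'I_n.+2} := [set j | w j == 0].
have S0 : S != set0.
  by apply/set0Pn; exists j0; rewrite inE /w /c divfK ?subrr ?lt0r_neq0.
have [ST|/(iA S0)[j [k [jS kS]]]] := eqVneq S setT.
  exists c => j; have : j \in S by rewrite ST inE.
  by rewrite inE subr_eq0 => /eqP.
rewrite !inE in jS kS; case/negP; case: gA => _ offd _.
have jk : j != k by apply: contraNneq kS => <-.
have := Aw j; move/eqP; rewrite -oppr_eq0 -sumrN psumr_eq0 => [/allP|l _].
  move=> /(_ k (mem_index_enum k)); rewrite oppr_eq0 mulf_eq0 (negPf kS) orbF.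
  by rewrite intr_eq0.
rewrite -mulNr; have [->|jl] := eqVneq l j; first by rewrite (eqP jS) mulr0.
by rewrite mulr_ge0 // oppr_ge0 lerz0 offd // eq_sym.
Qed.

End NullVector.

Section KacLabels.
Variables (n : nat) (A : 'M[int]_n.+2) (X : affine_type).
Hypotheses (hX : kac_enumerated A X) (hX2 : ~~ is_A2even X).

Lemma kac_ord (j : 'I_n.+2) : (j <= kac_rank X)%N.
Proof. by case: hX => _ -> _; rewrite -ltnS. Qed.

Lemma kac_tr_enumerated : kac_enumerated A^T (kac_dual X).
Proof.
have [hA hr AE] := hX; have [_ eA er] := kac_dualP hX2.
split; rewrite ?eA ?er // => j k.
by rewrite mxE AE kac_dual_entry.
Qed.

Lemma kac_mx_null (j : 'I_n.+2) : \sum_k A j k * (kac_label X k)%:Z = 0.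
Proof.
have [hA hr AE] := hX; have := kac_null hX2 hA (kac_ord j); rewrite hr => E;
  rewrite -[RHS]E.
by apply: eq_bigr => k _; rewrite AE.
Qed.

(** Both vectors are null vectors, hence proportional. The table has 1 at the vertex 0, so a_0
    divides every a_j and is 1 by coprimality. *)
Lemma labelsE (a : 'I_n.+2 -> nat) : generalized_cartan A -> indecomposable A ->
  numerical_labels A a -> forall j, a j = kac_label X j.
Proof.
move=> gA iA [a0 Aa ga].
have toQ (u : 'I_n.+2 -> nat) : (forall j, \sum_k A j k * (u k)%:Z = 0) ->
    forall j, \sum_k (A j k)%:~R * (u k)%:R = 0 :> rat.
  move=> Au j; transitivity ((\sum_k A j k * (u k)%:Z)%:~R : rat); last by rewrite Au.
  by rewrite rmorph_sum; apply: eq_bigr => k _; rewrite rmorphM.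
have k0 (j : 'I_n.+2) : 0 < (kac_label X j)%:R :> rat.
  by rewrite ltr0n kac_label_gt0 ?kac_ord.
have [c cE] := null_vector_unique gA iA k0 (toQ _ kac_mx_null) (toQ _ Aa).
have aE j : a j = (a ord0 * kac_label X j)%N.
  apply/eqP; rewrite -(eqr_nat rat) natrM; have := cE ord0.
  by rewrite /= kac_label0 mulr1 => ->; rewrite cE.
have a01 : a ord0 = 1%N.
  apply/eqP; rewrite -dvdn1 -ga; apply/dvdn_biggcdP => j _.
  by rewrite (aE j) dvdn_mulr.
by move=> j; rewrite aE a01 mul1n.
Qed.

End KacLabels.

(** * The realization attached to a Cartan matrix *)

Section CartanData.
Variables (R : realType) (n : nat) (A : 'M[int]_n.+2) (a av : 'I_n.+2 -> nat).
Hypotheses (gA : generalized_cartan A) (iA : indecomposable A).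
Hypotheses (ha : numerical_labels A a) (a1 : a ord0 = 1%N).
Hypothesis hav : numerical_labels A^T av.
Hypothesis symA : forall j k,
  A j k * (av j)%:Z * (a k)%:Z = A k j * (av k)%:Z * (a j)%:Z.
Local Notation D := (cartan_data R A a av).
Local Notation d := (cartan_d R a av).

Lemma d_gt0 j : 0 < d j.
Proof. by case: ha hav => a0 _ _ [av0 _ _]; rewrite divr_gt0 ?ltr0n. Qed.

Lemma gram_sym j k : (d j)^-1 * (A j k)%:~R = (d k)^-1 * (A k j)%:~R.
Proof.
case: ha hav => a0 _ _ [av0 _ _].
have := congr1 (fun z : int => z%:~R : R) (symA j k).
have aj : (a j)%:R != 0 :> R by rewrite pnatr_eq0 -lt0n.
have ak : (a k)%:R != 0 :> R by rewrite pnatr_eq0 -lt0n.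
rewrite !rmorphM /= -!pmulrn => E; rewrite /cartan_d !invf_div.
have -> : (av j)%:R / (a j)%:R * (A j k)%:~R
  = (A j k)%:~R * (av j)%:R * (a k)%:R / ((a j)%:R * (a k)%:R) :> R.
  by field; rewrite aj ak.
by rewrite E; field; rewrite aj ak.
Qed.

Lemma A_diag j : A j j = 2. Proof. by case: gA. Qed.

Lemma cartan_formC x y : form D x y = form D y x.
Proof.
rewrite /= -[in LHS](trmxK (_ *m _ *m _)) [LHS]mxE !trmx_mul trmxK.
rewrite mulmxA; congr ((_ *m _ *m _) 0 0).
rewrite /gram tr_block_mx; congr block_mx.
- by apply/matrixP => j k; rewrite !mxE gram_sym.
- by apply/matrixP => j k; rewrite !mxE.
- by apply/matrixP => j k; rewrite !mxE.
- by rewrite trmx0.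
Qed.

Lemma cartan_formDl x y z : form D (x + y) z = form D x z + form D y z.
Proof. by rewrite /= !mulmxDl mxE. Qed.

Lemma cartan_formZl c x z : form D (c *: x) z = c * form D x z.
Proof. by rewrite /= -!scalemxAl mxE. Qed.

Lemma cartan_form_suml I (r : seq I) (F : I -> hdual R n) y :
  form D (\sum_(i <- r) F i) y = \sum_(i <- r) form D (F i) y.
Proof.
elim/big_rec2: _ => [|i u b _ <-]; last exact: cartan_formDl.
by rewrite -(scale0r 0) cartan_formZl mul0r.
Qed.

Lemma simple_coord j k : simple D j 0 (lshift 1 k) = (j == k)%:R.
Proof. by rewrite mxE eqxx (inj_eq (@lshift_inj _ _)) eq_sym. Qed.

Lemma form_delta_simpleE j : form D (delta D) (simple D j) = 0.
Proof.
rewrite [delta D]/= cartan_form_suml.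
transitivity ((d j)^-1 * (\sum_k A j k * (a k)%:Z)%:~R); last first.
  by case: ha => _ -> _; rewrite mulr0.
rewrite rmorph_sum mulr_sumr; apply: eq_bigr => k _.
rewrite cartan_formZl cartan_data_form gram_sym rmorphM /= -pmulrn.
by rewrite mulrC mulrA.
Qed.

Lemma cartan_delta : delta D
  = simple D ord0 + \sum_i (a (fin i))%:R *: simple D (fin i).
Proof. by rewrite [LHS]/= big_ord_recl a1 scale1r. Qed.

(** The dual labels are the coefficients of a linear relation between the rows of A, with a nonzero
    coefficient at row 0. *)
Lemma cartan_row0 (v : 'I_n.+2 -> R) :
  (forall i, \sum_k (A (fin i) k)%:~R * v k = 0) ->
    forall j, \sum_k (A j k)%:~R * v k = 0.
Proof.
move=> hv j; have [i ->|->] := unliftP ord0 j; first exact: hv.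
case: hav => av0 avA _; have : \sum_j (av j)%:R * (\sum_k (A j k)%:~R * v k) = 0.
  under eq_bigr do rewrite mulr_sumr.
  rewrite exchange_big big1 //= => k _.
  transitivity ((\sum_j A^T k j * (av j)%:Z)%:~R * v k); last by rewrite avA mul0r.
  rewrite rmorph_sum mulr_suml; apply: eq_bigr => l _.
  by rewrite mxE rmorphM /= -pmulrn mulrA [X in X * _]mulrC.
rewrite big_ord_recl [X in _ + X]big1 ?addr0 => [/eqP|i _]; last by rewrite hv mulr0.
by rewrite mulf_eq0 pnatr_eq0 eqn0Ngt av0 => /eqP.
Qed.

Lemma cartan_realization : affine_realization D.
Proof.
split; [exact: cartan_formC|exact: cartan_formDl|exact: cartan_formZl|..].
- move=> c r E; have coord l : \sum_i c i * (fin i == l)%:R + r * (a l)%:R = 0.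
    have := congr1 (fun x : hdual R n => x 0 (lshift 1 l)) E;
      rewrite !mxE summxE => H; rewrite -[RHS]H.
    congr (_ + r * _); first by apply: eq_bigr => i _; rewrite mxE simple_coord.
    rewrite summxE (bigD1 l) //= mxE
      (simple_coord l l) eqxx mulr1 big1 ?addr0 // => k kl.
    by rewrite mxE (simple_coord k l) (negPf kl) mulr0.
  have r0 : r = 0.
    have := coord ord0; rewrite a1 mulr1 big1 ?add0r // => i _.
    by rewrite mulr0.
  split=> // i; have := coord (fin i); rewrite r0 mul0r addr0 (bigD1 i) //= eqxx mulr1.
  rewrite big1 ?addr0 // => k ki.
  by rewrite (inj_eq (@lift_inj _ _)) (negPf ki) mulr0.
- apply/in_QoP; exists (fun i => (a (fin i))%:Z).
  rewrite cartan_delta addrAC subrr add0r; apply: eq_bigr => i _.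
  by rewrite scaler_nat.
- by move=> i; exact: form_delta_simpleE.
- rewrite [X in form D X _]cartan_delta cartan_formDl cartan_form_suml.
  rewrite cartan_formC form_delta_simpleE add0r big1 // => i _.
  by rewrite cartan_formZl cartan_formC form_delta_simpleE mulr0.
- by move=> i; rewrite cartan_data_formL0.
- rewrite cartan_formC cartan_delta cartan_formDl cartan_form_suml.
  rewrite cartan_formC cartan_data_formL0 eqxx big1 ?addr0 // => i _.
  by rewrite cartan_formZl cartan_formC cartan_data_formL0 mulr0.
- move=> j; rewrite cartan_data_form A_diag mulr_gt0 ?invr_gt0 ?d_gt0 //.
(* Extended by 0 at the vertex 0, a radical vector of the finite part is a null vector of A, hence a
   multiple of the labels; since a_0 = 1 the factor is 0. *)
move=> c E; pose v j := if unlift ord0 j is Some i then c i else 0.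
have vE i : v (fin i) = c i by rewrite /v /fin liftK.
have v00 : v ord0 = 0 by rewrite /v unlift_none.
have Av : forall j, \sum_k (A j k)%:~R * v k = 0.
  apply: cartan_row0 => i; rewrite big_ord_recl v00 mulr0 add0r.
  have := E i; rewrite cartan_form_suml => Ei.
  have d0 : (d (fin i))^-1 != 0 by rewrite invr_neq0 // lt0r_neq0 // d_gt0.
  apply: (mulfI d0); rewrite mulr0 -[RHS]Ei mulr_sumr; apply: eq_bigr => k _.
  by rewrite cartan_formZl cartan_data_form gram_sym -/(fin k) vE [RHS]mulrC mulrA.
have a0 j : 0 < (a j)%:R :> R by rewrite ltr0n; case: ha.
have Aa j : \sum_k (A j k)%:~R * (a k)%:R = 0 :> R.
  transitivity ((\sum_k A j k * (a k)%:Z)%:~R : R); last by case: ha => _ ->.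
  by rewrite rmorph_sum; apply: eq_bigr => k _; rewrite rmorphM.
have [z zE] := null_vector_unique gA iA a0 Aa Av.
have z0 : z = 0 by have := zE ord0; rewrite v00 a1 mulr1.
by move=> i; rewrite -vE zE z0 mul0r.
Qed.

End CartanData.

(** * The root data R^iota *)

Section WithTheta.
Variables (R : realType) (n : nat) (D : affine_data R n).
Hypothesis rD : affine_realization D.
Local Notation V := (hdual R n).
Local Notation "'( x , y )" := (form D x y) (format "''(' x ,  y )").
Local Notation alpha := (simple D).
Local Notation b := (iota_fin_simple D).
Implicit Types (x y th : V) (i : 'I_n.+1).

Lemma e_ge1 i : 1 <= e_ D i.
Proof. by rewrite le_max lexx. Qed.

Lemma e_gt0 i : 0 < e_ D i. Proof. exact: lt_le_trans (e_ge1 i). Qed.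

(** A simple root of minimal length has the largest d, hence the largest e. This characterizes p
    without the choice of a minimizer. *)
Lemma p_spec : (forall i, e_ D i <= p_ D) /\ exists i, e_ D i = p_ D.
Proof.
rewrite /p_; split; last by eexists.
case: arg_minP => // i0 _ mini i; rewrite /e_ ge_max le_max lexx /=.
rewrite le_max; apply/orP; right; rewrite /d_ ler_pM2l //.
by rewrite lef_pV2 ?posrE ?(simple_norm_gt0 rD) // mini.
Qed.

Lemma p_ge1 : 1 <= p_ D.
Proof. by case: p_spec => _ [i <-]; exact: e_ge1. Qed.

Lemma p_gt0 : 0 < p_ D. Proof. exact: lt_le_trans p_ge1. Qed.

Lemma sqrtp_gt0 : 0 < Num.sqrt (p_ D). Proof. by rewrite sqrtr_gt0 p_gt0. Qed.

Lemma iota_data_p1 : p_ D = 1 -> iota_data D = D.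
Proof.
move=> p1; suff E : simple (iota_data D) = simple D.
  by rewrite /iota_data in E *; case: D E => ? ? ? ? /= ->.
apply/funext => j; rewrite /= p1 eqxx.
case: unliftP => [i ->|-> //]; rewrite /iota_fin_simple p1 sqrtr1 invr1 scale1r.
suff -> : A_ D i = 1 *: alpha (fin i) by rewrite scale1r.
by congr (_ *: _); apply/le_anti; rewrite e_ge1 -p1 (p_spec.1 i).
Qed.

(** A stand-in for [iota_data] with an explicit vector in place of the chosen [iota_theta];
    [iota_data_theta] identifies them when p != 1. *)
Definition with_theta th : affine_data R n := AffineData (form D) (delta D)
  (Lambda0 D) (fun j => if unlift ord0 j is Some i then b i else delta D - th).

Lemma with_theta_fin th i : simple (with_theta th) (fin i) = b i.
Proof. by rewrite /= /fin liftK. Qed.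

Lemma with_theta_zero th : simple (with_theta th) ord0 = delta D - th.
Proof. by rewrite /= unlift_none. Qed.

Lemma iota_scale_gt0 i : 0 < (Num.sqrt (p_ D))^-1 * e_ D i.
Proof. by rewrite mulr_gt0 ?invr_gt0 ?sqrtp_gt0 ?e_gt0. Qed.

Lemma iota_simpleE i : b i = ((Num.sqrt (p_ D))^-1 * e_ D i) *: alpha (fin i).
Proof. by rewrite /iota_fin_simple /A_ scalerA. Qed.

Lemma with_theta_realization th :
  in_Qo (with_theta th) th -> 0 < '(th, th) -> affine_realization (with_theta th).
Proof.
move=> hQ hn; have Qfin : in_fin D th.
  case/asboolP: hQ => c ->; exists (fun i => (c i)%:~R * ((Num.sqrt
    (p_ D))^-1 * e_ D i)).
  by apply: eq_bigr => i _; rewrite with_theta_fin iota_simpleE -scaler_int scalerA.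
split.
- exact: formC rD.
- exact: formDl rD.
- exact: formZl rD.
- move=> c r E; have := simple_free rD (c := fun i => c i * ((Num.sqrt
  (p_ D))^-1 * e_ D i)) (r := r).
  case=> [|c0 r0].
    rewrite -[RHS]E; congr (_ + _); apply: eq_bigr => i _.
    by rewrite with_theta_fin iota_simpleE scalerA.
  split=> // i; have /eqP := c0 i; rewrite mulf_eq0 => /orP[/eqP //|].
  by rewrite (gt_eqF (iota_scale_gt0 i)).
- by rewrite with_theta_zero subKr.
- move=> i; rewrite with_theta_fin iota_simpleE (formZr rD).
  by rewrite [X in _ * X](form_delta_simple rD) mulr0.
- exact: form_delta rD.
- move=> i; rewrite with_theta_fin iota_simpleE (formZr rD).
  by rewrite [X in _ * X](form_Lambda0_simple rD) mulr0.
- exact: form_Lambda0_delta rD.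
- move=> j; have [i ->|->] := unliftP ord0 j.
    rewrite with_theta_fin iota_simpleE (formZl rD) (formZr rD).
    by rewrite !(pmulr_rgt0 _ (iota_scale_gt0 _)) (simple_norm_gt0 rD).
  rewrite with_theta_zero [form _ _ _](formBl rD) !(formBr rD) (form_delta rD).
  by rewrite (formC rD (delta D)) (form_fin_delta rD Qfin) !sub0r opprK oppr0 add0r.
move=> c E i; pose c' k := c k * ((Num.sqrt (p_ D))^-1 * e_ D k).
suff /eqP : c' i = 0.
  by rewrite mulf_eq0 (gt_eqF (iota_scale_gt0 i)) orbF => /eqP.
apply: (fin_nondegenerate rD) i => k; have := E k.
rewrite with_theta_fin iota_simpleE (formZr rD) => /eqP.
rewrite mulf_eq0 (gt_eqF (iota_scale_gt0 k)) => /eqP Ek; rewrite -[RHS]Ek.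
congr (form D _ _); apply: eq_bigr => l _.
by rewrite with_theta_fin iota_simpleE scalerA.
Qed.

(** Two highest roots dominate each other; the two differences, with natural coefficients, add up to
    0, so all coefficients vanish by freeness. *)
Lemma highest_root_unique th x : affine_realization (with_theta th) ->
  highest_root D b th -> highest_root D b x -> x = th.
Proof.
move=> rT [rth hth] [rx hx]; have [c cE] := hth _ rx; have [e eE] := hx _ rth.
have E : \sum_i ((c i + e i)%:R : R) *: simple (with_theta th)
  (fin i) + 0 *: delta D = 0.
  rewrite scale0r addr0; transitivity ((th - x) + (x - th));
    last by rewrite subrKA subrr.
  rewrite cE eE -big_split; apply: eq_bigr => i _.
  by rewrite with_theta_fin scaler_nat mulrnDr.
have [c0 _] := simple_free rT E.
apply/esym/eqP; rewrite -subr_eq0 cE big1 // => i _.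
have /eqP := c0 i; rewrite pnatr_eq0 addn_eq0 => /andP[/eqP -> _].
by rewrite mulr0n.
Qed.

Lemma iota_data_theta th : affine_realization (with_theta th) ->
  p_ D != 1 -> highest_root D b th -> iota_data D = with_theta th.
Proof.
move=> rT p1 hth; rewrite /iota_data /with_theta (negPf p1); congr AffineData.
apply/funext => j; case: (unlift _ j) => //; congr (_ - _).
rewrite /iota_theta; case: pselect => [h|[]]; last by exists th.
by apply: highest_root_unique rT hth _; case: cid.
Qed.

End WithTheta.

(** * Highest roots by enumeration, for F_4 and G_2 *)

Section FiniteCheck.
Variables (n : nat) (C : nat -> nat -> int).

(** The reflection in coordinates on the simple roots, where [C k j] is (b_j, b_k^vee). *)
Definition refl_seq (k : nat) (c : seq int) : seq int :=
  set_nth 0 c k (nth 0 c k - foldr (fun j z => C k j * nth 0 c j + z) 0 (iota 0 n.+1)).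

Definition unit_seq (k : nat) : seq int := mkseq (fun j => (j == k)%:Z) n.+1.

Definition close_roots (L : seq (seq int)) : seq (seq int) :=
  undup (L ++ [seq refl_seq k c | c <- L, k <- iota 0 n.+1]).

(** [L] contains the simple roots and is stable under simple reflections, hence contains all roots,
    and it is bounded by [th]; the word [u] applied to the simple root [k] shows that [th] is itself
    a root. *)
Definition check_roots (L : seq (seq int)) (th : seq int) (u : seq nat) (k : nat) :
  bool :=
  [&& all (fun i => unit_seq i \in L) (iota 0 n.+1),
      all (fun c => all (fun i => refl_seq i c \in L) (iota 0 n.+1)) L,
      all (fun c => all (fun i => (0 <= nth 0 th i - nth 0 c i)%R) (iota 0 n.+1)) L,
      foldr refl_seq (unit_seq k) u == th & all (fun i => i < n.+1)%N (k :: u)].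

Variables (R : realType) (D : affine_data R n) (b : 'I_n.+1 -> hdual R n).
Hypothesis rD : affine_realization D.
Hypothesis hC : forall i j : 'I_n.+1,
  2 * form D (b j) (b i) / form D (b i) (b i) = (C i j)%:~R.

Definition comb (c : seq int) : hdual R n := \sum_(i < n.+1) b i *~ nth 0 c i.

Lemma foldr_sum (F : nat -> int) s : foldr (fun j z => F j + z) 0 s = \sum_(j <- s) F j.
Proof. by elim: s => [|j s IH]; rewrite ?big_nil // big_cons /= IH. Qed.

Lemma comb_pairing (k : 'I_n.+1) c :
  form D (comb c) (coroot D (b k)) = (\sum_(j < n.+1) C k j * nth 0 c j)%:~R.
Proof.
rewrite (form_coroot rD) (form_suml rD) mulr_sumr mulr_suml rmorph_sum.
apply: eq_bigr => j _; rewrite rmorphM /= -hC -scaler_int (formZl rD).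
by ring.
Qed.

(** A vector orthogonal to all simple roots but b_k satisfies (c, c) = c_k (c, b_k), here 2 (b_k,
    b_k) / 2. *)
Lemma comb_norm (k : 'I_n.+1) c : nth 0 c k = 2 ->
  (forall i, form D (b i) (b i) != 0) ->
  (forall i : 'I_n.+1, \sum_(j < n.+1) C i j * nth 0 c j = (i == k)%:Z) ->
  form D (comb c) (comb c) = form D (b k) (b k).
Proof.
move=> ck b0 H; have E i : form D (comb c) (b i) = (i == k)%:R * form D (b i) (b i) / 2.
  have := comb_pairing i c; rewrite H (form_coroot rD) -pmulrn => <-.
  by field; rewrite b0.
rewrite [X in form D _ X]/comb (form_sumr rD) (bigD1 k) //= big1 ?addr0 =>
  [|i /negPf ik].
  by rewrite ck -scaler_int (formZr rD) E eqxx mul1r mulrC divfK ?pnatr_eq0.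
by rewrite -scaler_int (formZr rD) E ik !mul0r mulr0.
Qed.

Lemma refl_comb (k : 'I_n.+1) c : reflection D (b k) (comb c) = comb (refl_seq k c).
Proof.
have E := comb_pairing k c.
have FE : foldr (fun j z => C k j * nth 0 c j + z) 0 (iota 0 n.+1)
    = \sum_(j < n.+1) C k j * nth 0 c j.
  by rewrite foldr_sum -(big_mkord xpredT
    (fun j => C k j * nth 0 c j)) /index_iota subn0.
rewrite /refl_seq FE /reflection E scaler_int /comb [RHS](bigD1 k) //= (bigD1 k) //=.
rewrite nth_set_nth /= eqxx mulrzBr addrAC; congr (_ - _ *~ _ + _).
apply: eq_bigr => j jk; rewrite nth_set_nth /=.
by rewrite -val_eqE /= in jk; rewrite (negPf jk).
Qed.

Lemma comb_unit (k : 'I_n.+1) : comb (unit_seq k) = b k.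
Proof.
rewrite /comb (bigD1 k) //= nth_mkseq // eqxx mulr1z big1 ?addr0 // => j.
by rewrite -val_eqE /= nth_mkseq // => /negPf ->; rewrite mulr0z.
Qed.

Lemma check_highest_root L th u k : check_roots L th u k -> highest_root D b (comb th).
Proof.
case/and5P => /allP L1 /allP L2 /allP L3 /eqP uE /allP ku; split.
  have hk : (k < n.+1)%N by apply: ku; rewrite mem_head.
  exists [seq inord i | i <- u], (Ordinal hk).
  have : {in u, forall i, (i < n.+1)%N} by move=> i iu; apply: ku; rewrite inE iu orbT.
  rewrite -uE {L3 ku uE}; elim: u => [_|i u IH hu];
    first exact: (comb_unit (Ordinal hk)).
  transitivity (comb (refl_seq (inord i : 'I_n.+1) (foldr refl_seq (unit_seq k) u))).
    by rewrite inordK ?hu ?mem_head.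
  by rewrite -refl_comb IH // => j ju; apply: hu; rewrite inE ju orbT.
move=> y; have {}L1 (i : 'I_n.+1) : unit_seq i \in L by apply: L1; rewrite mem_iota /=.
case=> v [i ->]; have [c cL ->] : exists2 c, c \in L &
    foldr (fun k0 => reflection D (b k0)) (b i) v = comb c.
  elim: v => [|l v [c cL E]] /=; first by exists (unit_seq i); rewrite ?comb_unit.
  exists (refl_seq l c); last by rewrite E refl_comb.
  by move/allP: (L2 c cL); apply; rewrite mem_iota /=.
have c0 (l : 'I_n.+1) : 0 <= nth 0 th l - nth 0 c l.
  by move/allP: (L3 c cL); apply; rewrite mem_iota /=.
exists (fun l : 'I_n.+1 => absz (nth 0 th l - nth 0 c l)%R); rewrite /comb -sumrB.
by apply: eq_bigr => l _; rewrite -mulrzBr pmulrn gez0_abs.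
Qed.

End FiniteCheck.

(** The Cartan matrix of the finite part of R^iota, the transpose of that of R; likewise for G_2. *)
Definition cartan_F4 (k j : nat) : int :=
  nth 0 (nth [::] [:: [:: 2; -1; 0; 0]; [:: -1; 2; -2; 0]; [:: 0; -1; 2; -1];
    [:: 0; 0; -1; 2]] k) j.

Definition cartan_G2 (k j : nat) : int :=
  nth 0 (nth [::] [:: [:: 2; -3]; [:: -1; 2]] k) j.

Lemma check_F4 : check_roots 3 cartan_F4
  (iter 12 (close_roots 3 cartan_F4) [seq unit_seq 3 k | k <- iota 0 4])
  [:: 2; 4; 3; 2] [:: 3; 2; 1; 0; 2; 1; 2]%N 3.
Proof. by vm_compute. Qed.

Lemma check_G2 : check_roots 1 cartan_G2
  (iter 6 (close_roots 1 cartan_G2) [seq unit_seq 1 k | k <- iota 0 2])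
  [:: 3; 2] [:: 1; 0]%N 1.
Proof. by vm_compute. Qed.

(** * Parameters *)

Section ScalarInversion.
Variables (R : realType) (n : nat) (D D' : affine_data R n) (tau tau' : R -> R).
Local Notation dv := (d_values D).
Local Notation dv' := (d_values D').
Hypotheses (tauP : {in dv, forall x, tau x \in dv'})
           (tauP' : {in dv', forall x, tau' x \in dv})
           (tauK : {in dv, cancel tau tau'}) (tauK' : {in dv', cancel tau' tau}).

(** Index 0 is the variable q^(1/m); index k + 1 belongs to the k-th value of d and is sent to the
    variable of its image under [t]. *)
Definition var_map (E E' : affine_data R n) (t : R -> R)
    (k : 'I_(size (d_values E)).+1) : 'I_(size (d_values E')).+1 :=
  inord (if nat_of_ord k is k'.+1 then (index (t (nth 0 (d_values E) k'))
    (d_values E')).+1 else 0%N).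

Lemma var_mapS (E E' : affine_data R n) (t : R -> R) x :
  x \in d_values E -> t x \in d_values E' ->
  var_map (E := E) E' t (inord (index x (d_values E)).+1)
  = inord (index (t x) (d_values E')).+1.
Proof.
move=> xE tE; rewrite /var_map inordK; last by rewrite ltnS index_mem.
by rewrite nth_index.
Qed.

Lemma ord_d_values (E : affine_data R n) (k : 'I_(size (d_values E)).+1) :
  k = inord 0 \/ exists2 x, x \in d_values E & k = inord (index x (d_values E)).+1.
Proof.
case: k => [[|k] hk]; [left|right]; first by apply: val_inj; rewrite /= inordK.
exists (nth 0 (d_values E) k); first exact: mem_nth.
by apply: val_inj; rewrite /= inordK index_uniq ?undup_uniq.
Qed.

Lemma var_map0 (E E' : affine_data R n) (t : R -> R) :
  var_map (E := E) E' t (inord 0) = inord 0.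
Proof. by rewrite /var_map inordK. Qed.

Lemma d_in_values (E : affine_data R n) j : d_ E j \in d_values E.
Proof. by rewrite mem_undup map_f // mem_enum. Qed.

Lemma d_valuesP (E : affine_data R n) x :
  reflect (exists j, x = d_ E j) (x \in d_values E).
Proof.
rewrite mem_undup; apply: (iffP mapP) => [[j _ ->]|[j ->]]; first by exists j.
by exists j; rewrite ?mem_enum.
Qed.

End ScalarInversion.

Lemma var_mapK (R : realType) (n : nat) (D D' : affine_data R n) (tau tau' : R -> R) :
  {in d_values D, forall x, tau x \in d_values D'} ->
  {in d_values D, cancel tau tau'} ->
  cancel (var_map (E := D) D' tau) (var_map (E := D') D tau').
Proof.
move=> tP tK k; case: (ord_d_values k) => [->|[x xD ->]]; first by rewrite !var_map0.
by rewrite !var_mapS ?tP ?tK.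
Qed.

(** Vertices with equal d share an indeterminate, so the variables are matched by a bijection [tau]
    of the values of d. Equality of the two [m_] is what carries q to q^-1 once the roots are
    inverted. *)
Lemma scalar_inversion (R : realType) (n : nat) (D D' : affine_data R n)
  (tau tau' : R -> R) :
  {in d_values D, forall x, tau x \in d_values D'} ->
  {in d_values D', forall x, tau' x \in d_values D} ->
  {in d_values D, cancel tau tau'} -> {in d_values D', cancel tau' tau} ->
  (forall i, d_ D' (fin i) = tau (d_ D (fin i))) -> m_ D = m_ D' ->
  exists sigma : {rmorphism scalars D -> scalars D'},
    [/\ phi_scalar_spec sigma,
        forall c, sigma (scalar_const D c) = scalar_const D' c,
        sigma (q_root D) = (q_root D')^-1 &
        forall j j', d_ D' j' = tau (d_ D j) -> sigma (t_root D j) = (t_root D' j')^-1].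
Proof.
move=> tP tP' tK tK' dE mE.
have [s [sC sX]] := @ex_inv_subst R[i] _ _ _ _ (var_mapK tP tK) (var_mapK tP' tK').
have st j j' : d_ D' j' = tau (d_ D j) -> s (t_root D j) = (t_root D' j')^-1.
  by move=> E; rewrite /t_root /indet sX var_mapS ?tP ?d_in_values // E.
have sq : s (q_root D) = (q_root D')^-1 by rewrite /q_root /indet sX var_map0.
exists s; split=> //; split=> // [i|i|].
- exact: st.
- by rewrite /t_ rmorphXn /= (st _ _ (dE i)) exprVn.
- by rewrite /q_ rmorphXn /= sq exprVn mE.
Qed.

(** [phi_scalar_spec] speaks of t_i for the finite vertices; it determines the morphism on all
    indeterminates because d_0 is among the d_i. *)
Lemma scalar_inversionK (R : realType) (n : nat) (D D' : affine_data R n)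
    (s : {rmorphism scalars D -> scalars D'})
      (s' : {rmorphism scalars D' -> scalars D}) :
  phi_scalar_spec s -> phi_scalar_spec s' ->
  (forall j, exists i, d_ D j = d_ D (fin i)) -> cancel s s'.
Proof.
move=> [sC sT _ sq _] [sC' sT' _ sq' _] d0.
pose f := GRing.RMorphism.clone _ _ (s' \o s) _.
suff E : f =1 (idfun : {rmorphism scalars D -> scalars D}) by move=> x; exact: E.
apply: mfraction_rmorph_eq => [c|k] /=; first by rewrite [s _]sC [LHS]sC'.
case: (ord_d_values k) => [->|[x /d_valuesP[j ->] ->]].
  by rewrite [s _]sq fmorphV sq' invrK.
by case: (d0 j) => i ->; rewrite [s _]sT fmorphV sT' invrK.
Qed.

Lemma algebra_morphismK (R : realType) (n : nat) (D D' : affine_data R n)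
    (Y : hdual R n -> daag D) (Y' : hdual R n -> daag D')
    (phi : daag D -> daag D') (phi' : daag D' -> daag D)
    (s : scalars D -> scalars D') (s' : scalars D' -> scalars D)
    (Phi : {rmorphism daha Y -> daha Y'}) (Phi' : {rmorphism daha Y' -> daha Y}) :
  phi_algebra_spec phi s Phi -> phi_algebra_spec phi' s' Phi' ->
  cancel s s' -> cancel phi phi' -> cancel Phi Phi'.
Proof.
move=> [PZ Pg] [PZ' Pg'] sK phiK; elim/alg_classW; elim/ga_ind => [|a b Ia Ib|g x].
- have -> : alg_class (hecke_rel Y) 0 = 0 by apply: (addrI (alg_class _ 0));
  rewrite -alg_classD !addr0.
  by rewrite !raddf0.
- by rewrite alg_classD !raddfD /= Ia Ib.
have -> : alg_class (hecke_rel Y) (mkmalgU g x) = x *: hecke_elt Y g :> daha Y.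
  by rewrite [RHS]aq_scaleE ga_scaleU mulr1.
by rewrite PZ Pg PZ' Pg' sK phiK.
Qed.

Section FundamentalWeights.
Variables (R : realType) (n : nat) (D : affine_data R n).
Hypothesis rD : affine_realization D.

(** This is duality with the coroots, as alpha_j^vee = d_j alpha_j. Common denominators thus depend
    on the numbers 1 / d_j alone. *)
Lemma form_fundamental_weight (j k : 'I_n.+1) :
  form D (simple D (fin j)) (fundamental_weight D k)
  = (j == k)%:R / d_ D (fin j).
Proof.
rewrite /fundamental_weight; set B := \matrix_(i, j) _.
have nz i : form D (simple D (fin i)) (simple D (fin i)) != 0.
  by rewrite lt0r_neq0 // (simple_norm_gt0 rD).
(* A row vector killed by [B] gives a vector orthogonal to all finite simple roots, which is 0 by
   nondegeneracy. *)
have Bu : B \in unitmx.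
  rewrite -row_free_unit -kermx_eq0; apply/eqP/row_matrixP => i; rewrite row0.
  set v := row i _; have : v *m B = 0 by apply/sub_kermxP; exact: row_sub.
  move=> vB; apply/rowP => l; rewrite [RHS]mxE.
  apply: (fin_nondegenerate rD (c := fun l => v 0 l)) => m.
  have := congr1 (fun M : 'rV_n.+1 => M 0 m) vB; rewrite [LHS]mxE [RHS]mxE => E.
  rewrite (form_suml rD); apply: (mulIf (nz m));
    apply: (mulIf (_ : 2 / form D (simple D (fin m)) (simple D (fin m)) ^+ 2 != 0)).
    by rewrite mulf_neq0 ?pnatr_eq0 // invr_neq0 // expf_neq0.
  rewrite !mul0r -[RHS]E !mulr_suml; apply: eq_bigr => h _.
  by rewrite [B h m]mxE (form_coroot rD) (formZl rD); field; exact: nz.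
rewrite (form_sumr rD); transitivity (\sum_i (invmx B) k i * B i j / d_ D (fin j)).
  apply: eq_bigr => i _; rewrite (formZr rD) [B i j]mxE (form_coroot rD) /d_ (formC rD).
  by field; rewrite nz.
rewrite -mulr_suml; congr (_ / _); have := mulVmx Bu.
by move=> /(congr1 (fun M : 'M_n.+1 => M k j)); rewrite !mxE eq_sym.
Qed.

Lemma common_denominatorE m : common_denominator D m <->
  (0 < m)%N /\ forall j, m%:R / d_ D (fin j) \is a Num.int.
Proof.
split=> -[m0 H]; split=> //.
  by move=> j; have := H j j; rewrite form_fundamental_weight eqxx mul1r.
by move=> j k; rewrite form_fundamental_weight; case: eqP => _;
  rewrite ?mul1r // mul0r mulr0 rpred0.
Qed.

End FundamentalWeights.

Lemma m_unique (R : realType) (n : nat) (D D' : affine_data R n) :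
  (forall m, common_denominator D m <-> common_denominator D' m) -> m_ D = m_ D'.
Proof.
move=> E; have E' m : lcd_spec D m <-> lcd_spec D' m.
  by split=> -[c1 c2]; split; [exact/E|move=> k /E/c2|exact/E|move=> k /E/c2].
have U (F : affine_data R n) k l : lcd_spec F k -> lcd_spec F l -> k = l.
  by move=> [a1 a2] [b1 b2]; apply/eqP; rewrite eqn_leq a2 // b2.
rewrite /m_; case: pselect => [h|h]; case: pselect => [h'|h'] //.
- case: cid => k hk /=; case: cid => l hl /=.
  by apply: (U D) => //; exact/E'.
- by case: h'; case: h => k /E' ?; exists k.
- by case: h; case: h' => k /E' ?; exists k.
Qed.

(** The conclusion of the theorem with the second root system left free, so that R^iota can be
    replaced by D or by an explicit [with_theta]. *)
Definition hecke_duality (R : realType) (n : nat) (D Di : affine_data R n) : Prop :=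
  forall (Y : hdual R n -> daag D) (Yi : hdual R n -> daag Di)
    (hY : translation_elements Y) (hYi : translation_elements Yi)
    (phi : {multiplicative daag D -> daag Di})
    (phii : {multiplicative daag Di -> daag D})
    (hphi : phi_group_spec Y Yi phi) (hphii : phi_group_spec Yi Y phii)
    (phiK : cancel phi phii) (phiiK : cancel phii phi),
  exists (sigma : {rmorphism scalars D -> scalars Di})
         (Phi : {rmorphism daha Y -> daha Yi})
         (sigmai : {rmorphism scalars Di -> scalars D})
         (Phii : {rmorphism daha Yi -> daha Y}),
    [/\ phi_scalar_spec sigma /\ phi_algebra_spec phi sigma Phi,
        phi_scalar_spec sigmai /\ phi_algebra_spec phii sigmai Phii,
        cancel Phi Phii
      & cancel Phii Phi].

Definition edge_node (R : realType) (n : nat) (D : affine_data R n) (i : 'I_n.+1) :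
  Prop :=
  form D (simple D ord0) (coroot D (simple D (fin i))) = -1 /\
  form D (simple D (fin i)) (coroot D (simple D ord0)) = -1.

Lemma edge_node_d (R : realType) (n : nat) (D : affine_data R n) i :
  affine_realization D -> edge_node D i -> d_ D ord0 = d_ D (fin i).
Proof.
move=> rD []; rewrite !(form_coroot rD) (formC rD (simple D (fin i)) (simple D ord0)).
have n0 := lt0r_neq0 (simple_norm_gt0 rD ord0).
have ni := lt0r_neq0 (simple_norm_gt0 rD (fin i)).
move=> E1 E2; rewrite /d_; congr (_ / _).
have F (u v : R) : v != 0 -> u / v = -1 ->
  u = - v by move=> v0 /(canRL (divfK v0)) ->; rewrite mulN1r.
by apply: oppr_inj; rewrite -(F _ _ n0 E2) -(F _ _ ni E1).
Qed.

(** * The duality for p = 1 *)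

Section DualityOne.
Variables (R : realType) (n : nat) (D : affine_data R n).
Hypotheses (rD : affine_realization D) (p1 : p_ D = 1).
Hypothesis d_zero : exists i, d_ D ord0 = d_ D (fin i).

Lemma A_p1 i : A_ D i = simple D (fin i).
Proof.
suff E : e_ D i = 1 by rewrite /A_ E scale1r.
by apply/le_anti; rewrite e_ge1 -{1}p1 ((p_spec rD).1 i).
Qed.

Lemma d_fin j : exists i, d_ D j = d_ D (fin i).
Proof. by have [i ->|->] := unliftP ord0 j; [exists i|]. Qed.

(** Here A_i = alpha_i, so M is the finite root lattice and contains theta. The same [s], which
    inverts every indeterminate, serves in both directions. *)
Lemma duality_p1 :
  (exists i, edge_node D i) \/ (exists c f kappa, chain D c f kappa) ->
  hecke_duality D D.
Proof.
move=> node Y Y' hY hY' phi phi' hphi hphi' phiK phiK'.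
have inD : {in d_values D, forall x, id x \in d_values D} by [].
have canD : {in d_values D, cancel id id} by [].
have [s [hs _ _ st]] := scalar_inversion inD inD canD canD (fun=> erefl) (erefl (m_ D)).
have sE : Num.sqrt (p_ D) = 1 by rewrite p1 sqrtr1.
have AE i : A_ D i = 1 *: simple D (fin i) by rewrite A_p1 scale1r.
have simpleE i : simple D (fin i) = 1^-1 *: A_ D i by rewrite A_p1 invr1 scale1r.
have h0 Z Z' (psi : {multiplicative daag D -> daag D}) : translation_elements Z ->
    translation_elements Z' -> phi_group_spec Z Z' psi -> quad (hecke_rel Z')
      (psi ((T_ D ord0)^-1 * X_ D (simple D ord0))%g) (s (t_root D ord0)).
  move=> hZ hZ' hpsi; case: node => [[i ei]|[c [f [kappa hc]]]].
    have [e1 e2] := ei.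
    exact: (h0_edge rD hpsi hs e1 e2 (edge_node_d rD ei)).
  have M0 : in_M D (f 0%N).
    have : in_Qo D (f 0%N) by have := theta_in_Qo rD; rewrite (chain_zero hc) subKr.
    by case/asboolP => k ->; apply/in_MP; exists k; apply: eq_bigr => i _; rewrite A_p1.
  apply: (h0_chain1 rD rD hpsi sE (rev_chain_word c 0 n) _ M0
    (Y_chain rD hc hZ M0) erefl erefl erefl (Y_chain rD hc hZ' M0)).
    by rewrite (chain_zero hc) subKr.
  exact: st.
have [Phi PhiP] := hecke_morphism rD rD hY hY' hphi hs sE AE simpleE
  (h0 _ _ _ hY hY' hphi).
have [Phi' PhiP'] := hecke_morphism rD rD hY' hY hphi' hs sE AE simpleE
  (h0 _ _ _ hY' hY hphi').
have sK := scalar_inversionK hs hs d_fin.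
exists s, Phi, s, Phi'; split=> //.
- exact: algebra_morphismK PhiP PhiP' sK phiK.
- exact: algebra_morphismK PhiP' PhiP sK phiK'.
Qed.

End DualityOne.

(** * The duality for p > 1 *)

Section DualityUntwisted.
Variables (R : realType) (n : nat) (D D' : affine_data R n) (p : R).
Hypotheses (rD : affine_realization D) (rD' : affine_realization D').
Hypotheses (p_gt1 : 1 < p) (formE' : form D' = form D).
Hypothesis d_val : forall i, d_ D (fin i) = 1 \/ d_ D (fin i) = p.
Hypotheses (d_one : exists i, d_ D (fin i) = 1) (d_p : exists i, d_ D (fin i) = p).
Hypotheses (d_zero : d_ D ord0 = 1) (d_zero' : d_ D' ord0 = 1).
Hypothesis simple' : forall i, simple D' (fin i) = iota_fin_simple D i.
Implicit Type i : 'I_n.+1.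

Let p0 : p != 0. Proof. by rewrite lt0r_neq0 // (lt_trans ltr01). Qed.

Lemma untwisted_e i : e_ D i = d_ D (fin i).
Proof. by rewrite /e_; case: (d_val i) => ->; rewrite ?maxxx // max_r // ltW. Qed.

Lemma untwisted_p : p_ D = p.
Proof.
have [H [i Ei]] := p_spec rD; have [k dk] := d_p.
apply/le_anti; rewrite -{2}dk -untwisted_e H andbT -Ei untwisted_e.
by case: (d_val i) => ->; rewrite ?lexx ?ltW.
Qed.

Let r := Num.sqrt p.

Lemma untwisted_rr : r * r = p.
Proof. by rewrite -expr2 sqr_sqrtr // ltW // (lt_trans ltr01). Qed.

Lemma untwisted_r0 : r != 0.
Proof. by rewrite lt0r_neq0 // sqrtr_gt0 (lt_trans ltr01). Qed.

Lemma untwisted_simple i : simple D' (fin i) = r^-1 *: A_ D i.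
Proof. by rewrite simple' /iota_fin_simple untwisted_p. Qed.

(** The vector A_i / sqrt p has square length d_i^2 (2 / d_i) / p = 2 d_i / p: short and long roots
    are exchanged. *)
Lemma untwisted_d i : d_ D' (fin i) = p / d_ D (fin i).
Proof.
rewrite /d_ untwisted_simple formE' (formZl rD) (formZr rD) /A_ (formZl rD) (formZr rD).
have n0 := lt0r_neq0 (simple_norm_gt0 rD (fin i)).
rewrite untwisted_e /d_ -untwisted_rr; field.
by rewrite n0 untwisted_r0.
Qed.

Lemma untwisted_e' i : e_ D' i = p / d_ D (fin i).
Proof.
rewrite /e_ untwisted_d; case: (d_val i) => ->; rewrite ?divr1 ?divff ?maxxx //.
by rewrite max_r // ltW.
Qed.

Lemma untwisted_A i : A_ D' i = r *: simple D (fin i).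
Proof.
rewrite /A_ untwisted_e' untwisted_simple /A_ untwisted_e !scalerA.
have d0 : d_ D (fin i) != 0 by case: (d_val i) => ->; rewrite ?oner_neq0.
congr (_ *: _); rewrite -untwisted_rr; field.
by rewrite d0 untwisted_r0.
Qed.

Lemma untwisted_p' : p_ D' = p.
Proof.
have [H [i Ei]] := p_spec rD'; have [k dk] := d_one.
apply/le_anti; have := H k; rewrite untwisted_e' dk divr1 => ->; rewrite andbT.
by rewrite -Ei untwisted_e'; case: (d_val i) => ->; rewrite ?divr1 ?divff // ltW.
Qed.

Lemma untwisted_simple2 i : simple D (fin i) = r^-1 *: A_ D' i.
Proof. by rewrite untwisted_A scalerA mulVf ?untwisted_r0 // scale1r. Qed.

Lemma untwisted_A2 i : A_ D i = r *: simple D' (fin i).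
Proof. by rewrite untwisted_simple scalerA divff ?untwisted_r0 // scale1r. Qed.

Lemma untwisted_values : d_values D =i [:: 1; p].
Proof.
move=> x; rewrite !inE; apply/d_valuesP/orP.
  case=> j ->; have [i ->|->] := unliftP ord0 j; last by left; rewrite d_zero.
  by case: (d_val i) => ->; [left|right].
by case=> /eqP ->; [case: d_one|case: d_p] => i <-; exists (fin i).
Qed.

Lemma untwisted_values' : d_values D' =i [:: 1; p].
Proof.
move=> x; rewrite !inE; apply/d_valuesP/orP.
  case=> j ->; have [i ->|->] := unliftP ord0 j; last by left; rewrite d_zero'.
  by rewrite untwisted_d; case: (d_val i) => ->; rewrite ?divr1 ?divff //; [right|left].
case=> /eqP ->; [case: d_p|case: d_one] => i di; exists (fin i);
  rewrite untwisted_d di ?divff //.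
by rewrite divr1.
Qed.

(** Both sides have {1, p} as the set of the d_i, and the least common denominator depends on this
    set alone. *)
Lemma untwisted_m : m_ D = m_ D'.
Proof.
apply: m_unique => m; rewrite !common_denominatorE //.
have [[i0 d0] [i1 d1]] := (d_one, d_p).
have dvd : (m%:R / 1 \is a @Num.int R) /\ (m%:R / p \is a Num.int) <->
   forall j, m%:R / d_ D (fin j) \is a Num.int.
  split=> [[h1 h2] j|H]; first by case: (d_val j) => ->.
  by split; [have := H i0; rewrite d0|have := H i1; rewrite d1].
have dvd' : (m%:R / 1 \is a @Num.int R) /\ (m%:R / p \is a Num.int) <->
   forall j, m%:R / d_ D' (fin j) \is a Num.int.
  split=> [[h1 h2] j|H].
    by rewrite untwisted_d; case: (d_val j) => ->;
      rewrite ?divr1 ?divff // -[m%:R]divr1.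
  by split; [have := H i1|have := H i0]; rewrite untwisted_d ?d0 ?d1 ?(divff p0) ?divr1.
by rewrite -dvd -dvd'.
Qed.

Definition untwisted_node (E : affine_data R n) : Prop :=
  (exists i, edge_node E i) \/
  [/\ exists c f, chain E c f 2^-1, (0 < n)%N & p = 2].

Lemma duality_untwisted :
  untwisted_node D -> untwisted_node D' -> hecke_duality D D'.
Proof.
move=> node node' Y Y' hY hY' phi phi' hphi hphi' phiK phiK'.
have pK x : x != 0 -> p / (p / x) = x by move=> _; rewrite invf_div mulrCA mulfV ?mulr1.
have tP (E E' : affine_data R n) : d_values E =i [:: 1; p] -> d_values E' =i [:: 1;
  p] ->
    {in d_values E, forall x, p / x \in d_values E'}.
  by move=> h h' x; rewrite h h' !inE => /orP[] /eqP ->;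
    rewrite ?divr1 ?divff ?eqxx ?orbT.
have tK (E : affine_data R n) : d_values E =i [:: 1; p] ->
    {in d_values E, cancel (fun x => p / x) (fun x => p / x)}.
  by move=> h x; rewrite h !inE => /orP[] /eqP ->; rewrite pK ?oner_neq0.
have v := untwisted_values; have v' := untwisted_values'.
have [s [hs _ _ st]] := scalar_inversion (tP _ _ v v') (tP _ _ v' v) (tK _ v) (tK _ v')
  untwisted_d untwisted_m.
have d2 i : d_ D (fin i) = p / d_ D' (fin i).
  by rewrite untwisted_d pK //; case: (d_val i) => ->; rewrite ?oner_neq0.
have [s' [hs' _ _ st']] := scalar_inversion (tP _ _ v' v) (tP _ _ v v') (tK _ v')
  (tK _ v)
  d2 (esym untwisted_m).
have sE : Num.sqrt (p_ D) = r by rewrite untwisted_p.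
have sE' : Num.sqrt (p_ D') = r by rewrite untwisted_p'.
have h0 : quad (hecke_rel Y')
      (phi ((T_ D ord0)^-1 * X_ D (simple D ord0))%g) (s (t_root D ord0)).
  case: node => [[i ei]|[[c [f hc]] n0 p2]].
    by have [e1 e2] := ei; exact: (h0_edge rD hphi hs e1 e2 (edge_node_d rD ei)).
  apply: (h0_chain2 rD rD' hY hphi hs sE untwisted_simple hc n0 _ formE').
  by rewrite untwisted_rr.
have h0' : quad (hecke_rel Y)
      (phi' ((T_ D' ord0)^-1 * X_ D' (simple D' ord0))%g) (s' (t_root D' ord0)).
  case: node' => [[i ei]|[[c [f hc]] n0 p2]].
    by have [e1 e2] := ei; exact: (h0_edge rD' hphi' hs' e1 e2 (edge_node_d rD' ei)).
  apply: (h0_chain2 rD' rD hY' hphi' hs' sE' untwisted_simple2 hc n0 _ (esym formE')).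
  by rewrite untwisted_rr.
have [Phi PhiP] := hecke_morphism rD rD' hY hY' hphi hs sE untwisted_A
  untwisted_simple h0.
have [Phi' PhiP'] := hecke_morphism rD' rD hY' hY hphi' hs' sE' untwisted_A2
  untwisted_simple2 h0'.
have dD j : exists i, d_ D j = d_ D (fin i).
  have [i ->|->] := unliftP ord0 j; first by exists i.
  by case: d_one => i di; exists i; rewrite di.
have dD' j : exists i, d_ D' j = d_ D' (fin i).
  have [i ->|->] := unliftP ord0 j; first by exists i.
  by case: d_p => i di; exists i; rewrite untwisted_d di divff.
have sK := scalar_inversionK hs hs' dD; have sK' := scalar_inversionK hs' hs dD'.
exists s, Phi, s', Phi'; split=> //.
- exact: algebra_morphismK PhiP PhiP' sK phiK.
- exact: algebra_morphismK PhiP' PhiP sK' phiK'.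
Qed.

End DualityUntwisted.

(** * Orthogonal coordinates recovered from the Gram matrix *)

Section OrthogonalizedChain.
Variables (R : realType) (n : nat) (D : affine_data R n).
Variables (b : nat -> hdual R n) (kappa : R).
Hypothesis rD : affine_realization D.
Local Notation "'( x , y )" := (form D x y) (format "''(' x ,  y )").
Hypotheses (kappa0 : kappa != 0) (bnn : '(b n, b n) = 2)
  (bkk : forall k, (k < n)%N -> '(b k, b k) = 4 * kappa ^+ 2)
  (bkS : forall k, (k.+1 < n)%N -> '(b k, b k.+1) = - (2 * kappa ^+ 2))
  (bkn : forall k, k.+1 = n -> '(b k, b n) = - (2 * kappa))
  (bjk : forall j k, (j.+1 < k)%N -> (k <= n)%N -> '(b j, b k) = 0).

(** The solution f of b_n = f_n and b_k = kappa (f_k - f_{k+1}). *)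
Definition chain_vector (k : nat) : hdual R n :=
  b n + kappa^-1 *: \sum_(k <= j < n) b j.
Local Notation f := chain_vector.

Lemma chain_vector_last : f n = b n.
Proof. by rewrite /f big_geq // scaler0 addr0. Qed.

Lemma chain_vectorS k : (k < n)%N -> f k = f k.+1 + kappa^-1 *: b k.
Proof.
by move=> hk; rewrite /f (big_ltn hk) scalerDr addrCA addrC.
Qed.

Lemma chain_vector_mid k : (k < n)%N -> b k = kappa *: (f k - f k.+1).
Proof.
by move=> hk; rewrite [f k]chain_vectorS // addrAC subrr add0r scalerA divff // scale1r.
Qed.

Lemma chain_vector_downward (P : nat -> Prop) :
  P n -> (forall k, (k < n)%N -> P k.+1 -> P k) -> forall k, (k <= n)%N -> P k.
Proof.
move=> Pn PS k hk; rewrite -(subKn hk); elim: (n - k)%N (leq_subr k n) => [|m IH] hm.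
  by rewrite subn0.
apply: PS; first by lia.
have -> : ((n - m.+1).+1 = n - m)%N by lia.
by apply: IH; lia.
Qed.

Lemma form_b_chain k j : (k < n)%N -> (j <= n)%N ->
  '(b k, f j) = if j == k then 2 * kappa else if j == k.+1 then - (2 * kappa) else 0.
Proof.
move=> hk hj; move: j hj; apply: chain_vector_downward => [|j hj IH].
  rewrite chain_vector_last; case: ifP => [/eqP|_]; first by lia.
  case: ifP => [/eqP E|/eqP nE]; first by rewrite bkn.
  by rewrite bjk //; lia.
rewrite chain_vectorS // (formDr rD) (formZr rD) IH.
have [jk|[kj|[jk|[jk|kj]]]] : k.+1 = j \/ j.+1 = k \/ j = k \/ (j.+1 < k)%N
  \/ (k.+1 < j)%N by lia.
- rewrite -jk bkS; last by lia.
  have -> : (k.+2 == k) = false by lia.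
  have -> : (k.+2 == k.+1) = false by lia.
  have -> : (k.+1 == k) = false by lia.
  by rewrite eqxx; field.
- rewrite (formC rD) -kj bkS; last by lia.
  have -> : (j == j.+1) = false by lia.
  have -> : (j == j.+2) = false by lia.
  by rewrite eqxx; field.
- rewrite jk bkk //; have -> : (k.+1 == k) = false by lia.
  by rewrite !eqxx; field.
- rewrite (formC rD) bjk ?(ltnW hk) //.
  have -> : (j.+1 == k) = false by lia.
  have -> : (j.+1 == k.+1) = false by lia.
  have -> : (j == k) = false by lia.
  have -> : (j == k.+1) = false by lia.
  by rewrite mulr0 addr0.
- rewrite bjk // 1?ltnW //.
  have -> : (j.+1 == k) = false by lia.
  have -> : (j.+1 == k.+1) = false by lia.
  have -> : (j == k) = false by lia.
  have -> : (j == k.+1) = false by lia.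
  by rewrite mulr0 addr0.
Qed.

Lemma form_bn_chain j : (j <= n)%N -> '(b n, f j) = if j == n then 2 else 0.
Proof.
move: j; apply: chain_vector_downward => [|j hj IH];
  first by rewrite chain_vector_last eqxx.
rewrite chain_vectorS // (formDr rD) (formZr rD) IH (formC rD).
have -> : (j == n) = false by lia.
case: eqP => E; first by rewrite bkn //; field.
by rewrite bjk //; [rewrite mulr0 addr0|lia].
Qed.

Lemma form_chain_vector j k : (j <= n)%N -> (k <= n)%N ->
  '(f j, f k) = if j == k then 2 else 0.
Proof.
move=> hj hk; move: j hj; apply: chain_vector_downward => [|j hj IH].
  by rewrite chain_vector_last form_bn_chain // eq_sym.
rewrite chain_vectorS // (formDl rD) (formZl rD) IH form_b_chain //.
have [->|[->|jk]] : k = j \/ k = j.+1 \/ (k <> j /\ k <> j.+1) by lia.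
- have -> : (j.+1 == j) = false by lia.
  by rewrite !eqxx; field.
- have -> : (j.+1 == j) = false by lia.
  have -> : (j == j.+1) = false by lia.
  by rewrite !eqxx; field.
have -> : (k == j) = false by lia.
have -> : (k == j.+1) = false by lia.
have -> : (j.+1 == k) = false by lia.
have -> : (j == k) = false by lia.
by rewrite mulr0 addr0.
Qed.

End OrthogonalizedChain.

Lemma chain_vector_fin (R : realType) (n : nat) (D : affine_data R n)
    (b : nat -> hdual R n) kappa k :
  (forall j, in_fin D (b j)) -> in_fin D (chain_vector b kappa k).
Proof.
move=> hb; rewrite /chain_vector; apply: in_finD => //; apply: in_finZ.
elim/big_ind: _ => // [|x y]; last exact: in_finD.
by exists (fun=> 0); rewrite big1 // => i _; rewrite scale0r.
Qed.

Section ChainOfGram.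
Variables (R : realType) (n : nat) (D : affine_data R n).
Variables (c : nat -> 'I_n.+1) (kappa : R).
Hypothesis rD : affine_realization D.
Local Notation b := (fun k => simple D (fin (c k))).
Local Notation "'( x , y )" := (form D x y) (format "''(' x ,  y )").
Hypotheses (kappa0 : 0 < kappa) (bnn : '(b n, b n) = 2)
  (bkk : forall k, (k < n)%N -> '(b k, b k) = 4 * kappa ^+ 2)
  (bkS : forall k, (k.+1 < n)%N -> '(b k, b k.+1) = - (2 * kappa ^+ 2))
  (bkn : forall k, k.+1 = n -> '(b k, b n) = - (2 * kappa))
  (bjk : forall j k, (j.+1 < k)%N -> (k <= n)%N -> '(b j, b k) = 0).
Hypothesis c_onto : forall i, exists2 k, (k <= n)%N & i = c k.
Hypothesis zeroE : simple D ord0 = delta D - chain_vector b kappa 0.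

Lemma chain_of_gram : chain D c (chain_vector b kappa) kappa.
Proof.
have k0 := lt0r_neq0 kappa0; split=> //.
- by move=> k _; apply: chain_vector_fin => j; exact: in_fin_simple.
- by move=> j k hj hk; exact: form_chain_vector.
- by move=> k hk; exact: (chain_vector_mid _ k0).
- by rewrite chain_vector_last.
Qed.

End ChainOfGram.

(** A highest root dominates the first simple root, so their difference has integral coordinates. *)
Lemma highest_root_in_Qo (R : realType) (n : nat) (D : affine_data R n) th :
  highest_root D (iota_fin_simple D) th -> in_Qo (with_theta D th) th.
Proof.
case=> _ /(_ (iota_fin_simple D ord0)) [|c cE]; first by exists [::], ord0.
rewrite -[X in in_Qo _ X](subrK (iota_fin_simple D ord0)).
apply: in_QoD; last by rewrite -(with_theta_fin D th ord0) in_Qo_simple.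
rewrite cE.
apply/in_QoP; exists (fun i => (c i)%:Z).
by apply: eq_bigr => i _; rewrite with_theta_fin pmulrn.
Qed.

(** * The affine types *)

Lemma cartan_trmx n (A : 'M[int]_n.+2) :
  generalized_cartan A -> indecomposable A ->
  generalized_cartan A^T /\ indecomposable A^T.
Proof.
move=> [A2 Aneg Asym] iA; split.
  split=> [j|j k jk|j k]; rewrite !mxE //; first by rewrite Aneg // eq_sym.
  exact: Asym.
move=> S S0 ST; have [||j [k [jS kS Ajk]]] := iA (~: S).
- by apply: contra_neq ST => /(congr1 (@setC _)); rewrite setCK setC0.
- by apply: contra_neq S0 => /(congr1 (@setC _)); rewrite setCK setCT.
rewrite !inE in jS kS; exists k, j; split=> //; first by rewrite negbK in kS.
by rewrite mxE.
Qed.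

Section KacType.
Variables (R : realType) (n : nat) (A : 'M[int]_n.+2)
    (X : affine_type) (a av : 'I_n.+2 -> nat).
Hypotheses (hA : irreducible_affine_cartan A)
    (hX : kac_enumerated A X) (hX2 : ~~ is_A2even X)
    (ha : numerical_labels A a) (hav : numerical_labels A^T av).
Local Notation D := (cartan_data R A a av).
Local Notation lab := (kac_label X).
Local Notation dlab := (kac_label (kac_dual X)).
Implicit Type i : 'I_n.+1.

Lemma type_a j : a j = lab j.
Proof. by case: hA => gA iA _; exact: (labelsE hX hX2 gA iA ha). Qed.

Lemma type_av j : av j = dlab j.
Proof.
case: hA => gA iA _; have [gT iT] := cartan_trmx gA iA.
have [h2 _ _] := kac_dualP hX2.
exact: (labelsE (kac_tr_enumerated hX hX2) h2 gT iT hav).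
Qed.

Lemma type_a0 : a ord0 = 1%N. Proof. by rewrite type_a kac_label0. Qed.

Lemma type_sym j k : A j k * (av j)%:Z * (a k)%:Z = A k j * (av k)%:Z * (a j)%:Z.
Proof.
rewrite !type_a !type_av; have [adm _ AE] := hX; rewrite !AE.
by apply: kac_symmetrizable; rewrite // (kac_ord hX).
Qed.

Lemma type_realization : affine_realization D.
Proof.
by case: hA => gA iA _; exact: (cartan_realization R gA iA ha type_a0 hav type_sym).
Qed.

Lemma type_d j : d_ D j = (lab j)%:R / (dlab j)%:R.
Proof.
rewrite d_cartan_data; first by rewrite /cartan_d type_a type_av.
by case: hA => -[].
Qed.

Lemma type_form j k : form D (simple D j) (simple D k)
  = (dlab j)%:R / (lab j)%:R * (kac_entry X j k)%:~R.
Proof.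
by rewrite cartan_data_form /cartan_d type_a type_av invf_div; case: hX => _ _ ->.
Qed.

Lemma type_pairing j k : form D (simple D j) (coroot D (simple D k))
  = (kac_entry X k j)%:~R.
Proof.
rewrite (form_coroot type_realization) (formC type_realization) !cartan_data_form.
have [[A2 _ _] _ _] := hA; have [_ _ AE] := hX; rewrite A2 -AE.
have d0 : cartan_d R a av k != 0 by rewrite lt0r_neq0 // (d_gt0 R ha hav).
by field.
Qed.

Lemma type_edge i : kac_entry X 0 i.+1 = -1 -> kac_entry X i.+1 0 = -1 -> edge_node D i.
Proof.
by move=> e1 e2; split; rewrite type_pairing /= /bump /= ?e1 ?e2.
Qed.

(** Labels bounded by the dual labels mean d_j <= 1, hence e = 1 throughout. *)
Lemma type_p1 : (forall j, (j <= kac_rank X)%N -> (lab j <= dlab j)%N) -> p_ D = 1.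
Proof.
move=> H; have [_ [i <-]] := p_spec type_realization.
rewrite /e_ type_d max_l // ler_pdivrMr ?mul1r ?ler_nat ?H ?(kac_ord hX) //.
have [_ _ er] := kac_dualP hX2.
by rewrite ltr0n kac_label_gt0 // er (kac_ord hX).
Qed.

Lemma type_edge_p1 i : (forall j, (j <= kac_rank X)%N -> (lab j <= dlab j)%N) ->
  kac_entry X 0 i.+1 = -1 -> kac_entry X i.+1 0 = -1 ->
  hecke_duality D (iota_data D).
Proof.
move=> /type_p1 p1 e1 e2; have rD := type_realization; have ei := type_edge e1 e2.
rewrite (iota_data_p1 rD p1); apply: duality_p1 => //; last by left; exists i.
by exists i; exact: edge_node_d.
Qed.

Local Notation c := (fun k => inord k : 'I_n.+1).

Lemma c_onto i : exists2 k, (k <= n)%N & i = c k.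
Proof. by exists i; rewrite ?inord_val // -ltnS. Qed.

Lemma val_c k : (k <= n)%N -> (fin (c k) : nat) = k.+1.
Proof. by move=> hk; rewrite /= /bump /= inordK. Qed.

Lemma type_formc j k : (j <= n)%N -> (k <= n)%N ->
  form D (simple D (fin (c j))) (simple D (fin (c k)))
  = (dlab j.+1)%:R / (lab j.+1)%:R * (kac_entry X j.+1 k.+1)%:~R.
Proof. by move=> hj hk; rewrite type_form !val_c. Qed.

(** The last label is 1 and the other finite ones are 1 / kappa, so theta, the sum of the a_i
    alpha_i, is the chain vector of index 0. *)
Lemma type_chain kappa : 0 < kappa ->
  form D (simple D (fin (c n))) (simple D (fin (c n))) = 2 ->
  (forall k, (k < n)%N -> form D (simple D (fin (c k))) (simple D (fin
    (c k))) = 4 * kappa ^+ 2) ->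
  (forall k, (k.+1 < n)%N ->
    form D (simple D (fin (c k))) (simple D (fin (c k.+1))) = - (2 * kappa ^+ 2)) ->
  (forall k, k.+1 = n -> form D (simple D (fin (c k))) (simple D (fin (c n))) = -
    (2 * kappa)) ->
  (forall j k, (j.+1 < k)%N -> (k <= n)%N ->
    form D (simple D (fin (c j))) (simple D (fin (c k))) = 0) ->
  lab n.+1 = 1%N -> (forall k, (k < n)%N -> (lab k.+1)%:R = kappa^-1) ->
  exists f, chain D c f kappa.
Proof.
move=> k0 g1 g2 g3 g4 g5 ln lk; eexists; apply: chain_of_gram => //.
- exact: type_realization.
- exact: c_onto.
rewrite (cartan_delta R A av type_a0) /chain_vector big_ord_recr /= type_a.
have -> : fin (ord_max : 'I_n.+1) = fin (c n).
  by congr fin; apply: val_inj; rewrite /= inordK.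
rewrite val_c // ln scale1r big_mkord scaler_sumr.
rewrite [X in _ + X - _]addrC;
  have -> : \sum_(i < n) (a (fin (widen_ord (leqnSn n) i)))%:R
    *: simple D (fin (widen_ord (leqnSn n) i))
  = \sum_(i < n) kappa^-1 *: simple D (fin (c i)).
  apply: eq_bigr => i _; have -> : widen_ord (leqnSn n) i = c i.
    by apply: val_inj; rewrite /= inordK // ltnS ltnW.
  by rewrite type_a val_c ?lk // ltnW.
by rewrite addrK.
Qed.

Lemma chain_d_zero f kappa : chain D c f kappa -> exists i, d_ D ord0 = d_ D (fin i).
Proof.
move=> hc; exists (c n); rewrite /d_ (alpha0_norm type_realization hc).
by rewrite (chain_last hc) (chain_form hc) // eqxx.
Qed.

End KacType.

Section DualityTheta.
Variables (R : realType) (n : nat) (D : affine_data R n) (p : R).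
Hypotheses (rD : affine_realization D) (p_gt1 : 1 < p).
Hypothesis d_val : forall i, d_ D (fin i) = 1 \/ d_ D (fin i) = p.
Hypotheses (d_one : exists i, d_ D (fin i) = 1) (d_p : exists i, d_ D (fin i) = p).
Hypotheses (d_zero : d_ D ord0 = 1).
Local Notation b := (iota_fin_simple D).

Lemma untwisted_iota_form i k :
  form D (b i) (b k) = d_ D (fin i) * d_ D (fin k) / p
    * form D (simple D (fin i)) (simple D (fin k)).
Proof.
rewrite /iota_fin_simple /A_ !(formZl rD) !(formZr rD).
rewrite !(untwisted_e p_gt1 d_val) (untwisted_p rD p_gt1 d_val d_p).
by rewrite -[X in _ / X](untwisted_rr p_gt1); field; rewrite untwisted_r0.
Qed.

(** Square length 2 of the highest root gives d_0 = 1 for R^iota as well, so [duality_untwisted]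
    applies. *)
Lemma duality_theta th : highest_root D b th -> form D th th = 2 ->
  untwisted_node p D ->
  (affine_realization (with_theta D th) -> untwisted_node p (with_theta D th)) ->
  hecke_duality D (iota_data D).
Proof.
move=> hth nth node node'.
have rT : affine_realization (with_theta D th).
  by apply: (with_theta_realization rD (highest_root_in_Qo hth)); rewrite nth.
have p1 : p_ D != 1 by rewrite (untwisted_p rD p_gt1 d_val d_p) gt_eqF.
rewrite (iota_data_theta rT p1 hth).
apply: (duality_untwisted rD rT p_gt1 erefl d_val d_one d_p d_zero _ _ node (node' rT)).
  rewrite /d_ with_theta_zero [form _ _ _](formBl rD) !(formBr rD) (form_delta rD).
  have := form_simple_delta rT ord0;
    rewrite with_theta_zero [form _ _ _](formBl rD) (form_delta rD) sub0r.
  move=> /eqP; rewrite oppr_eq0 => /eqP thd.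
  by rewrite (formC rD (delta D)) thd nth !sub0r opprK oppr0 add0r divff ?pnatr_eq0.
by move=> i; rewrite with_theta_fin.
Qed.

Lemma theta_edge th i : affine_realization (with_theta D th) ->
  form D th (coroot D (b i)) = 1 -> form D (b i) (b i) = 2 -> form D th th = 2 ->
  edge_node (with_theta D th) i.
Proof.
move=> rT thb nb nth; have fT : form (with_theta D th) = form D by [].
have thE : form D th (b i) = 1 by rewrite -thb (form_coroot rD) nb; field.
have db := form_delta_simple rT i; rewrite with_theta_fin fT in db.
have dth : form D th (delta D) = 0.
  have := form_simple_delta rT ord0;
    rewrite with_theta_zero fT (formBl rD) (form_delta rD) sub0r.
  by move=> /eqP; rewrite oppr_eq0 => /eqP.
have E : form D (delta D - th) (b i) = -1 by rewrite (formBl rD) db thE sub0r.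
have N : form D (delta D - th) (delta D - th) = 2.
  rewrite (formBl rD) !(formBr rD) dth nth (formC rD (delta D) th) dth (form_delta rD).
  by ring.
split; rewrite (form_coroot rT) with_theta_zero with_theta_fin fT.
  by rewrite E nb; field.
by rewrite (formC rD (b i)) E N; field.
Qed.

End DualityTheta.

Section Types.
Variables (R : realType) (n : nat) (A : 'M[int]_n.+2) (a av : 'I_n.+2 -> nat).
Hypotheses (hA : irreducible_affine_cartan A)
    (ha : numerical_labels A a) (hav : numerical_labels A^T av).
Local Notation D := (cartan_data R A a av).
Local Notation c := (fun k => inord k : 'I_n.+1).
Local Notation dual := (hecke_duality D (iota_data D)).

Let rank X (h : kac_enumerated A X) : kac_rank X = n.+1. Proof. by case: h. Qed.

Lemma duality_A l : kac_enumerated A (Aff_A l) -> dual.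
Proof.
move=> hX; have := rank hX => /= lE; move: hX; rewrite lE => hX.
have [n0|n0] := posnP n; last first.
  by apply: (@type_edge_p1 _ _ _ _ _ _ hA hX isT ha hav ord0) => //=;
    rewrite /kac_entry /= /kac_mult;
    case: n n0 => //.
have H : forall j, (j <= kac_rank (Aff_A n.+1))%N ->
  (kac_label (Aff_A n.+1) j <= kac_label (kac_dual (Aff_A n.+1)) j)%N by [].
have p1 := type_p1 R hA hX isT ha hav H.
have rD := type_realization R hA hX isT ha hav.
(* In rank 1 the basis consists of alpha_1 = theta alone. *)
have [f hc] : exists f, chain D c f 1.
  apply: (type_chain hA hX isT ha hav) => //; try by move=> *; exfalso; lia.
  by rewrite (type_formc _ hA hX isT ha hav) // /kac_entry eqxx /=; field.
rewrite (iota_data_p1 rD p1); apply: duality_p1 => //.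
  exact: (chain_d_zero hA hX isT ha hav hc).
by right; exists c, f, 1.
Qed.

Lemma duality_D2 l : kac_enumerated A (Aff_D2 l) -> dual.
Proof.
move=> hX; have := rank hX => /= lE; move: hX; rewrite lE => hX.
have n0 : (0 < n)%N by case: hX.
have H : forall j, (j <= kac_rank (Aff_D2 n.+1))%N ->
  (kac_label (Aff_D2 n.+1) j <= kac_label (kac_dual (Aff_D2 n.+1)) j)%N.
  by move=> j _ /=; case: ifP.
have p1 := type_p1 R hA hX isT ha hav H.
have rD := type_realization R hA hX isT ha hav.
have [f hc] : exists f, chain D c f 1.
{ apply: (type_chain hA hX isT ha hav) => //.
  all: try (move=> j k ? ?); try (move=> k ?);
    rewrite ?(type_formc _ hA hX isT ha hav) ?invr1 //; try lia.
  all: rewrite /kac_entry /kac_mult /= ?xpair_eqE.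
  all: repeat (case: ifP => ? /=; try (exfalso; lia)); try by field. }
rewrite (iota_data_p1 rD p1); apply: duality_p1 => //.
  exact: (chain_d_zero hA hX isT ha hav hc).
by right; exists c, f, 1.
Qed.

(** R^iota has type B in the orthonormal vectors g_k = f_k / sqrt 2, with highest root g_0 + g_1.
    From rank 3 on, its vertex 0 is joined by a simple edge to the second finite vertex; rank 2 is
    again of type C. *)
Lemma duality_C l : kac_enumerated A (Aff_C l) -> dual.
Proof.
move=> hX; have := rank hX => /= lE; move: hX; rewrite lE => hX.
have n0 : (0 < n)%N by case: hX.
have rD := type_realization R hA hX isT ha hav.
have [f hc] : exists f, chain D c f 2^-1.
{ apply: (type_chain hA hX isT ha hav) => //.
  all: try (move=> j k ? ?); try (move=> k ?);
    rewrite ?(type_formc _ hA hX isT ha hav) ?invrK //; try lia.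
  all: rewrite /kac_entry /kac_mult /kac_label /= ?xpair_eqE.
  all: repeat (case: ifP => ? /=; try (exfalso; lia)); try by field.
  all: by rewrite ?invr_gt0. }
have dE k : (k <= n)%N -> d_ D (fin (c k)) = if k == n then 1 else 2.
  move=> hk; rewrite (type_d _ hA hX isT ha hav) val_c //= divr1.
  by rewrite eqSS; case: ifP.
have d_val i : d_ D (fin i) = 1 \/ d_ D (fin i) = 2.
  by have [k hk ->] := c_onto i; rewrite dE //; case: ifP; [left|right].
have d_one : exists i, d_ D (fin i) = 1 by exists (c n); rewrite dE // eqxx.
have d_p : exists i, d_ D (fin i) = 2.
  by exists (c 0%N); rewrite dE //; have -> : (0%N == n) = false by lia.
have d_zero : d_ D ord0 = 1 by rewrite (type_d _ hA hX isT ha hav) /= divr1.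
have p_gt1 : 1 < 2 :> R by rewrite ltr1n.
have pD := untwisted_p rD p_gt1 d_val d_p.
set b := iota_fin_simple D; pose r : R := Num.sqrt 2; pose g k := r^-1 *: f k.
have rr : r^-1 * r^-1 = 2^-1 by rewrite -invfM (untwisted_rr p_gt1).
have gg j k : (j <= n)%N -> (k <= n)%N -> form D (g j) (g k) = if j == k then 1 else 0.
  move=> hj hk; rewrite (formZl rD) (formZr rD) (chain_form hc) // mulrA rr.
  by case: ifP; rewrite ?mulr0 ?mulVf ?pnatr_eq0.
have bE k : (k <= n)%N -> b (c k) = r^-1 *: (d_ D (fin (c k)) *: simple D (fin (c k))).
  by move=> hk; rewrite /b /iota_fin_simple pD /A_ (untwisted_e p_gt1 d_val).
have b_mid k : (k < n)%N -> b (c k) = 1 *: (g k - g k.+1).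
  move=> hk; rewrite bE 1?ltnW // dE 1?ltnW // (ltn_eqF hk) (chain_mid hc) //.
  by rewrite scalerA divff ?pnatr_eq0 // !scale1r scalerBr.
have b_last : b (c n) = g n by rewrite bE // dE // eqxx scale1r (chain_last hc).
have hth := highest_root_B rD (oner_neq0 R) (oner_neq0 R) gg b_mid b_last
  (@c_onto n) erefl n0.
have g00 : form D (g 0%N) (g 0%N) = 1 := gg 0%N 0%N isT isT;
  have g11 : form D (g 1%N) (g 1%N) = 1 := gg 1%N 1%N n0 n0.
have g01 : form D (g 0%N) (g 1%N) = 0 := gg 0%N 1%N isT n0;
  have g10 : form D (g 1%N) (g 0%N) = 0 := gg 1%N 0%N n0 isT.
have nth : form D (g 0%N + g 1%N) (g 0%N + g 1%N) = 2.
  by rewrite (formDl rD) !(formDr rD) g00 g01 g10 g11; ring.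
apply: (duality_theta rD p_gt1 d_val d_one d_p d_zero hth nth) => [|rT].
  by right; split=> //; exists c, f.
have z0 := with_theta_zero D (g 0%N + g 1%N).
have zf := with_theta_fin D (g 0%N + g 1%N).
have gfin k : (k <= n)%N -> in_fin (with_theta D (g 0%N + g 1%N)) (g k).
  move=> hk; have [cf cE] := in_finZ r^-1 (chain_fin hc hk).
  exists (fun i => cf i * ((Num.sqrt (p_ D))^-1 * e_ D i)^-1).
  rewrite /g cE; apply: eq_bigr => i _; rewrite zf iota_simpleE scalerA.
  by rewrite divfK // lt0r_neq0 // iota_scale_gt0.
have gdelta k : (k <= n)%N -> form D (delta D) (g k) = 0.
  by move=> hk; rewrite (formC rD); exact: (form_fin_delta rT (gfin _ hk)).
have [n1|n2] : n = 1%N \/ (2 <= n)%N by lia.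
  (* B_2 is C_2 with the numbering reversed: g_0 + g_1 and g_0 - g_1 are orthogonal of square length
     2, and g_1 is half their difference. *)
  right; split=> //; exists (fun k => c (1 - k)%N),
    (fun k => if k == 0%N then g 0%N + g 1%N else g 0%N - g 1%N).
  have b0 : b (c 0%N) = g 0%N - g 1%N by rewrite b_mid // scale1r.
  have b1 : b (c 1%N) = g 1%N.
    have -> : c 1%N = c n by apply: val_inj; rewrite /= !inordK; lia.
    by rewrite b_last; exact: (congr1 g n1).
  split; rewrite ?invr_gt0 ?ltr0n ?z0 //.
  - move=> k hk; have := gfin 0%N isT; have := gfin 1%N n0 => h1 h2.
    case: k hk => [|k] hk; first exact: in_finD.
    by rewrite -(scaleN1r (g 1%N)); apply: in_finD => //; exact: in_finZ.
  - move=> j k hj hk; have jk : (j <= 1)%N /\ (k <= 1)%N by lia.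
    change (form D (if j == 0%N then g 0%N + g 1%N else g 0%N - g 1%N)
      (if k == 0%N then g 0%N + g 1%N else g 0%N - g 1%N) = if j == k then 2 else 0).
    case: j k jk {hj hk} => [|[|j]] [|[|k]] [] // _ _; rewrite ?eqxx.
    + by rewrite (formBr rD) !(formDl rD) g00 g01 g10 g11; ring.
    + by rewrite (formDr rD) !(formBl rD) g00 g01 g10 g11; ring.
    + by rewrite (formBr rD) !(formBl rD) g00 g01 g10 g11; ring.
  - move=> k hk; have -> : k = 0%N by lia.
    rewrite zf -/b subn0 b1 eqxx (_ : (1 == 0)%N = false) //;
      by move: (g 0%N) (g 1%N) => u v; apply/rowP => i; rewrite !mxE; field.
  - have -> : (n == 0%N) = false by lia.
    have -> : (1 - n = 0)%N by lia.
    by rewrite zf -/b b0.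
  - move=> i; have [k hk ->] := c_onto i; exists (1 - k)%N; first by lia.
    by congr inord; lia.
left; exists (c 1%N).
have b1 : b (c 1%N) = g 1%N - g 2%N by rewrite b_mid // scale1r.
have g02 : form D (g 0%N) (g 2%N) = 0 := gg 0%N 2%N isT n2; have g12 : form D (g
  1%N) (g 2%N) = 0 := gg 1%N 2%N n0 n2;
    have g21 : form D (g 2%N) (g 1%N) = 0 := gg 2%N 1%N n2 n0.
have g22 : form D (g 2%N) (g 2%N) = 1 := gg 2%N 2%N n2 n2;
  have g20 : form D (g 2%N) (g 0%N) = 0 := gg 2%N 0%N n2 isT.
have E : form D (delta D - (g 0%N + g 1%N)) (g 1%N - g 2%N) = -1.
  rewrite (formBr rD) !(formBl rD) !(formDl rD) !gdelta // g01 g11 g02 g12; ring.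
have N1 : form D (g 1%N - g 2%N) (g 1%N - g 2%N) = 2.
  by rewrite (formBr rD) !(formBl rD) g11 g12 g21 g22; ring.
have N0 : form D (delta D - (g 0%N + g 1%N)) (delta D - (g 0%N + g 1%N)) = 2.
  rewrite (formBl rD) !(formBr rD) nth (form_delta rD) !(formDr rD) !gdelta //.
  by rewrite (formC rD _ (delta D)) !(formDr rD) !gdelta //; ring.
have fT : form (with_theta D (g 0%N + g 1%N)) = form D by [].
split; rewrite (form_coroot rT) z0 zf -/b b1 fT.
  by rewrite E N1; field.
by rewrite (formC rD (g 1%N - g 2%N)) E N0; field.
Qed.

(** R has a simple edge from 0 to the vertex 2. R^iota has type C: its coordinates come from the
    Gram matrix, with kappa = 1/2, and its highest root is f_0. *)
Lemma duality_B l : kac_enumerated A (Aff_B l) -> dual.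
Proof.
move=> hX; have := rank hX => /= lE; move: hX; rewrite lE => hX.
have n2 : (1 < n)%N by case: hX.
have rD := type_realization R hA hX isT ha hav.
have dE k : (k <= n)%N -> d_ D (fin (c k)) = if k == n then 2 else 1.
  move=> hk; rewrite (type_d _ hA hX isT ha hav) val_c //=.
  by repeat (case: ifP => ? /=; try (exfalso; lia)); rewrite ?divr1 ?divff ?pnatr_eq0.
have d_val i : d_ D (fin i) = 1 \/ d_ D (fin i) = 2.
  by have [k hk ->] := c_onto i; rewrite dE //; case: ifP; [right|left].
have d_p : exists i, d_ D (fin i) = 2 by exists (c n); rewrite dE // eqxx.
have d_one : exists i, d_ D (fin i) = 1.
  by exists (c 0%N); rewrite dE //; have -> : (0%N == n) = false by lia.
have d_zero : d_ D ord0 = 1 by rewrite (type_d _ hA hX isT ha hav) /= divr1.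
have p_gt1 : 1 < 2 :> R by rewrite ltr1n.
set b := iota_fin_simple D.
have bE j k : (j <= n)%N -> (k <= n)%N -> form D (b (c j)) (b (c k)) =
    (if j == n then 2 else 1) * (if k == n then 2 else 1) / 2
    * ((kac_label (kac_dual (Aff_B n.+1)) j.+1)%:R / (kac_label (Aff_B n.+1) j.+1)%:R
       * (kac_entry (Aff_B n.+1) j.+1 k.+1)%:~R).
  move=> hj hk; rewrite (untwisted_iota_form rD p_gt1 d_val d_p) !dE //.
  by rewrite (type_formc _ hA hX isT ha hav).
have kappa_gt0 : 0 < 2^-1 :> R by rewrite invr_gt0.
have kappa0 := lt0r_neq0 kappa_gt0.
pose f := chain_vector (fun k => b (c k)) 2^-1.
have [bnn bkk bkS bkn bjk] : [/\ form D (b (c n)) (b (c n)) = 2,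
  forall k, (k < n)%N -> form D (b (c k)) (b (c k)) = 4 * 2^-1 ^+ 2,
  forall k, (k.+1 < n)%N -> form D (b (c k)) (b (c k.+1)) = - (2 * 2^-1 ^+ 2),
  forall k, k.+1 = n -> form D (b (c k)) (b (c n)) = - (2 * 2^-1) &
  forall j k, (j.+1 < k)%N -> (k <= n)%N -> form D (b (c j)) (b (c k)) = 0].
{ split.
  all: try (move=> j k ? ?); try (move=> k ?); rewrite bE //; try lia.
  all: rewrite /kac_entry /kac_mult /kac_label /= ?xpair_eqE.
  all: repeat (case: ifP => ? /=; try (exfalso; lia)); by field. }
have gg j k hj hk := form_chain_vector rD kappa0 bnn bkk bkS bkn bjk (j := j)
  (k := k) hj hk.
have b_mid k : (k < n)%N -> b (c k) = 2^-1 *: (f k - f k.+1).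
  by move=> hk; exact: (chain_vector_mid (fun k => b (c k)) kappa0 hk).
have b_last : b (c n) = f n by rewrite /f chain_vector_last.
have two0 : 2 != 0 :> R by rewrite pnatr_eq0.
have hth := highest_root_C rD two0 kappa0 gg b_mid b_last (@c_onto n) erefl.
have nth : form D (f 0%N) (f 0%N) = 2 by rewrite gg.
apply: (duality_theta rD p_gt1 d_val d_one d_p d_zero hth nth) => [|rT].
  left; exists (c 1%N); apply: (type_edge _ hA hX isT ha hav);
    rewrite inordK // /kac_entry /kac_mult ?xpair_eqE /=;
    repeat (case: ifP => ? /=; try (exfalso; lia)); first [by [] | lia].
right; split=> //; last by lia.
have zf := with_theta_fin D (f 0%N).
have bfin i : in_fin (with_theta D (f 0%N)) (b i).
  by rewrite /b -zf; exact: in_fin_simple.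
exists c, f; split=> //.
- by move=> k _; apply: chain_vector_fin => j; exact: bfin.
- by move=> k hk; rewrite zf; exact: b_mid.
- by rewrite zf; exact: b_last.
- exact: with_theta_zero.
- exact: c_onto.
Qed.

End Types.

Lemma duality_F4 (R : realType) n (A : 'M[int]_n.+2) (a av : 'I_n.+2 -> nat) :
  irreducible_affine_cartan A -> numerical_labels A a -> numerical_labels A^T av ->
  kac_enumerated A Aff_F4 ->
  hecke_duality (cartan_data R A a av) (iota_data (cartan_data R A a av)).
Proof.
move=> hA ha hav hX; have [E] : 4%N = n.+1 by case: hX.
subst n; set D := cartan_data R A a av.
have rD : affine_realization D := type_realization R hA hX isT ha hav.
have dE (i : 'I_4) : d_ D (fin i) = if (i <= 1)%N then 1 else 2.
  by rewrite (type_d _ hA hX isT ha hav); case: i => [[|[|[|[|//]]]] hi] /=; field.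
have d_val (i : 'I_4) : d_ D (fin i) = 1 \/ d_ D (fin i) = 2.
  by rewrite dE; case: ifP; [left|right].
have d_one : exists i : 'I_4, d_ D (fin i) = 1 by exists ord0; rewrite dE.
have d_p : exists i : 'I_4, d_ D (fin i) = 2 by exists ord_max; rewrite dE.
have d_zero : d_ D ord0 = 1 by rewrite (type_d _ hA hX isT ha hav) /= divr1.
have p_gt1 : 1 < 2 :> R by rewrite ltr1n.
set b := iota_fin_simple D.
have bE (i k : 'I_4) : form D (b i) (b k) = d_ D (fin i) * d_ D (fin k) / 2
    * ((kac_label Aff_E6_2 i.+1)%:R / (kac_label Aff_F4 i.+1)%:R
       * (kac_entry Aff_F4 i.+1 k.+1)%:~R).
  by rewrite (untwisted_iota_form rD p_gt1 d_val d_p) (type_form _ hA hX isT ha hav).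
have hC (i j : 'I_4) : 2 * form D (b j) (b i) / form D (b i) (b i)
  = (cartan_F4 i j)%:~R.
  by rewrite !bE !dE; case: i => [[|[|[|[|//]]]] hi]; case: j => [[|[|[|[|//]]]] hj];
    rewrite /cartan_F4 /kac_entry /=; field.
have hth := check_highest_root rD hC check_F4.
have bmax : form D (b ord_max) (b ord_max) = 2.
  by rewrite bE !dE /kac_entry /=; field.
have nb i : form D (b i) (b i) != 0.
  rewrite bE !dE; case: i => [[|[|[|[|//]]]] hi]; rewrite /kac_entry /=;
    apply: lt0r_neq0; lra.
have hp (i : 'I_4) : \sum_(j < 4) cartan_F4 i j * nth 0 [:: 2; 4; 3;
  2] j = (i == ord_max)%:Z.
  by rewrite !big_ord_recr big_ord0; case: i => [[|[|[|[|//]]]] hi].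
have nth := comb_norm rD hC (erefl : nth 0 [:: 2; 4; 3;
  2] (ord_max : 'I_4) = 2 :> int) nb hp.
rewrite bmax in nth.
apply: (duality_theta rD p_gt1 d_val d_one d_p d_zero hth nth) => [|rT]; left.
  by exists ord0; apply: (type_edge _ hA hX isT ha hav).
(* The numbering of R^iota runs backwards: its highest root pairs to 1 with the last simple root and
   to 0 with the others. *)
exists ord_max; apply: (theta_edge rD rT _ bmax nth).
by rewrite (comb_pairing rD hC) hp eqxx.
Qed.

Lemma duality_G2 (R : realType) n (A : 'M[int]_n.+2) (a av : 'I_n.+2 -> nat) :
  irreducible_affine_cartan A -> numerical_labels A a -> numerical_labels A^T av ->
  kac_enumerated A Aff_G2 ->
  hecke_duality (cartan_data R A a av) (iota_data (cartan_data R A a av)).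
Proof.
move=> hA ha hav hX; have [E] : 2%N = n.+1 by case: hX.
subst n; set D := cartan_data R A a av.
have rD : affine_realization D := type_realization R hA hX isT ha hav.
have dE (i : 'I_2) : d_ D (fin i) = if i == ord0 then 1 else 3.
  by rewrite (type_d _ hA hX isT ha hav); case: i => [[|[|//]] hi] /=; field.
have d_val (i : 'I_2) : d_ D (fin i) = 1 \/ d_ D (fin i) = 3.
  by rewrite dE; case: ifP; [left|right].
have d_one : exists i : 'I_2, d_ D (fin i) = 1 by exists ord0; rewrite dE.
have d_p : exists i : 'I_2, d_ D (fin i) = 3 by exists ord_max; rewrite dE.
have d_zero : d_ D ord0 = 1 by rewrite (type_d _ hA hX isT ha hav) /= divr1.
have p_gt1 : 1 < 3 :> R by rewrite ltr1n.
set b := iota_fin_simple D.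
have bE (i k : 'I_2) : form D (b i) (b k) = d_ D (fin i) * d_ D (fin k) / 3
    * ((kac_label Aff_D4_3 i.+1)%:R / (kac_label Aff_G2 i.+1)%:R
       * (kac_entry Aff_G2 i.+1 k.+1)%:~R).
  by rewrite (untwisted_iota_form rD p_gt1 d_val d_p) (type_form _ hA hX isT ha hav).
have hC (i j : 'I_2) : 2 * form D (b j) (b i) / form D (b i) (b i)
  = (cartan_G2 i j)%:~R.
  by rewrite !bE !dE; case: i => [[|[|//]] hi]; case: j => [[|[|//]] hj];
    rewrite /cartan_G2 /kac_entry /=; field.
have hth := check_highest_root rD hC check_G2.
have bmax : form D (b ord_max) (b ord_max) = 2.
  by rewrite bE !dE /kac_entry /=; field.
have nb i : form D (b i) (b i) != 0.
  rewrite bE !dE; case: i => [[|[|//]] hi]; rewrite /kac_entry /=;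
    apply: lt0r_neq0; lra.
have hp (i : 'I_2) : \sum_(j < 2) cartan_G2 i j * nth 0 [:: 3; 2] j = (i == ord_max)%:Z.
  by rewrite !big_ord_recr big_ord0; case: i => [[|[|//]] hi].
have nth := comb_norm rD hC (erefl : nth 0 [:: 3; 2] (ord_max : 'I_2) = 2 :> int) nb hp.
rewrite bmax in nth.
apply: (duality_theta rD p_gt1 d_val d_one d_p d_zero hth nth) => [|rT]; left.
  by exists ord0; apply: (type_edge _ hA hX isT ha hav).
exists ord_max; apply: (theta_edge rD rT _ bmax nth).
by rewrite (comb_pairing rD hC) hp eqxx.
Qed.

Lemma duality_edge (R : realType) n (A : 'M[int]_n.+2) (a av : 'I_n.+2 -> nat) X k :
  irreducible_affine_cartan A -> kac_enumerated A X -> ~~ is_A2even X ->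
  numerical_labels A a -> numerical_labels A^T av ->
  (forall j, (j <= kac_rank X)%N -> (kac_label X j <= kac_label (kac_dual X) j)%N) ->
  (k < kac_rank X)%N -> kac_entry X 0 k.+1 = -1 -> kac_entry X k.+1 0 = -1 ->
  hecke_duality (cartan_data R A a av) (iota_data (cartan_data R A a av)).
Proof.
move=> hA hX hX2 ha hav hl hk e1 e2; have rk : kac_rank X = n.+1 by case: hX.
by apply: (@type_edge_p1 R n A X a av hA hX hX2 ha hav (inord k)); rewrite ?inordK -?rk.
Qed.

Theorem theorem2p3 (R : realType) (n : nat) (A : 'M[int]_n.+2)
    (X : affine_type) (a av : 'I_n.+2 -> nat)
    (hA : irreducible_affine_cartan A)
    (hX : kac_enumerated A X) (hX2 : ~~ is_A2even X)
    (ha : numerical_labels A a) (hav : numerical_labels A^T av) :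
  let D := cartan_data R A a av in
  let Di := iota_data D in
  forall (Y : hdual R n -> daag D) (Yi : hdual R n -> daag Di)
    (hY : translation_elements Y) (hYi : translation_elements Yi)
    (phi : {multiplicative daag D -> daag Di})
    (phii : {multiplicative daag Di -> daag D})
    (hphi : phi_group_spec Y Yi phi) (hphii : phi_group_spec Yi Y phii)
    (phiK : cancel phi phii) (phiiK : cancel phii phi),
  exists (sigma : {rmorphism scalars D -> scalars Di})
         (Phi : {rmorphism daha Y -> daha Yi})
         (sigmai : {rmorphism scalars Di -> scalars D})
         (Phii : {rmorphism daha Yi -> daha Y}),
    [/\ phi_scalar_spec sigma /\ phi_algebra_spec phi sigma Phi,
        phi_scalar_spec sigmai /\ phi_algebra_spec phii sigmai Phii,
        cancel Phi Phii
      & cancel Phii Phi].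
Proof.
rewrite /=; rewrite -/(hecke_duality _ _); have [adm _ _] := hX.
have edge k := @duality_edge R n A a av X k hA hX hX2 ha hav.
case: X hX hX2 adm edge => [l|l|l|l|||||||l|l||] hX hX2 adm edge //.
- exact: duality_A hX.
- exact: duality_B hX.
- exact: duality_C hX.
(* The argument of [edge] is a neighbour of the vertex 0, diminished by one. *)
- apply: (edge 1%N) => //=; first by move: adm => /=; lia.
- exact: (edge 5%N).
- exact: (edge 0%N).
- exact: (edge 0%N).
- exact: duality_F4 hX.
- exact: duality_G2 hX.
- rewrite /= in adm; apply: (edge 1%N) => //=; [|lia|..].
    by move=> j _; repeat (case: ifP => ? /=; try (exfalso; lia)).
  1, 2: by rewrite /kac_entry /kac_mult ?xpair_eqE /=; repeat (case: ifP => ? /=;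
    try (exfalso; lia)).
- exact: duality_D2 hX.
- by apply: (edge 0%N) => //; case=> [|[|[|[|[|j]]]]].
- by apply: (edge 0%N) => //; case=> [|[|[|[|[|j]]]]].
Qed.
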